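(* Let $C>0$, $G\geq 0$, $M\geq 0$ and $0<Y<2$, and set $\theta=(G-M)/2$ and $\tilde\theta=(G+M)/2$. Let $\mathcal{T}=\{\mathcal{T}(t),t\geq 0\}$ be the subordinator (increasing L\'evy process with $\mathcal{T}(0)=0$, zero drift) with L\'evy density $$\nu_{\mathcal{T}}(x)=C\frac{2^{Y/2-1}\Gamma(Y/2)}{\Gamma(Y)}\frac{e^{-(\tilde{\theta}^2-\theta^2)x/2}}{x^{1+Y/2}}\,{\rm E}\left[\exp\left(-\frac{\tilde{\theta}^2x}{2}\frac{\gamma_{Y/2}}{\gamma_{1/2}}\right)\right],\qquad x>0,$$ where $\gamma_{Y/2}$ and $\gamma_{1/2}$ are independent gamma random variables with unit scale and shapes $Y/2$ and $1/2$ respectively. Fix $t>0$, put $\widetilde{C}:=tC2^{Y/2-1}/\Gamma(Y)$, and let $\mathcal{R}:=\gamma_{Y/2}/\gamma_{1/2}$. Then for every $L>0$, $\mathcal{T}(t)$ admits the decomposition $$\mathcal{T}(t)=\mathcal{T}_L(t)+\epsilon_L(t),$$ where $\mathcal{T}_L(t)$ and $\epsilon_L(t)$ are independent nonnegative random variables with the following properties: (i) $\mathcal{T}_L(t)$ is a generalized gamma convolution random variable with Laplace exponent $$-\log\left({\rm E}\left[e^{-\mu\mathcal{T}_L(t)}\right]\right)=\frac{2\widetilde{C}L^{Y/2}}{Y}\,{\rm E}\left[\log\left(1+\mu R\right)\right],\qquad \mu>0,$$ where $$R:=\frac{1}{\frac{GM+\tilde{\theta}^2\mathcal{R}}{2}+\mathcal{Z}},$$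 with $\mathcal{Z}$ independent of $\mathcal{R}$ and having probability density $f_{\mathcal{Z}}(z)=\frac{Y}{2}L^{-Y/2}z^{Y/2-1}$ for $0\leq z\leq L$; (ii) the standardized variable $(\epsilon_L(t)-{\rm E}[\epsilon_L(t)])/\sqrt{{\rm Var}(\epsilon_L(t))}$ converges in distribution to a standard normal random variable as $L\to\infty$, and $${\rm E}[\epsilon_L(t)^2]\leq\frac{\widetilde{C}^2}{(1-Y/2)^2L^{2-Y}}+\frac{\widetilde{C}}{(2-Y/2)L^{2-Y/2}}.$$
   Context: A CGMY process with parameters $C>0,G\geq0,M\geq0,0<Y<2$ is the pure-jump L\'evy process with L\'evy density $C\left(\frac{e^{-G|x|}}{|x|^{1+Y}}I\{x<0\}+\frac{e^{-Mx}}{x^{1+Y}}I\{x>0\}\right)$; it can be represented as $X(t)=\theta\mathcal{T}(t)+W(\mathcal{T}(t))$ with $W$ a standard Brownian motion independent of the subordinator $\mathcal{T}$ described in the claim (the ''time change''). A generalized gamma convolution random variable is a nonnegative infinitely divisible random variable whose Laplace exponent has the form $\int_{(0,\infty)}\log(1+\mu/s)\,U(ds)$ (plus possibly a linear drift term) for some nonnegative measure $U$ (Thorin measure). The decomposition is meant in distribution: the law of $\mathcal{T}(t)$ equals the law of the sum of the independent variables $\mathcal{T}_L(t)$ and $\epsilon_L(t)$ (so the law of $\epsilon_L(t)$ is determined by those of $\mathcal{T}(t)$ and $\mathcal{T}_L(t)$). *)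

(* Defs.v *)
From HB Require Import structures.
From mathcomp Require Import all_boot all_order all_algebra.
From mathcomp Require Import all_classical all_reals all_analysis.
Set Implicit Arguments. Unset Strict Implicit. Unset Printing Implicit Defensive.
Import Order.TTheory GRing.Theory Num.Theory.
Import numFieldNormedType.Exports.
Local Open Scope classical_set_scope.
Local Open Scope ring_scope.

Section defs.
Variable R : realType.
Local Notation mu := (@lebesgue_measure R).

Definition Gammaf (s : R) : R :=
  Rintegral mu `]0%R, +oo[%classic (fun x => x `^ (s - 1) * expR (- x)).

Definition gamma_pdf (a x : R) : R :=
  x `^ (a - 1) * expR (- x) / Gammaf a.

Definition E_gamma_ratio (a b : R) (f : R -> R) : R :=
  Rintegral mu `]0%R, +oo[%classic (fun u =>
    Rintegral mu `]0%R, +oo[%classic (fun v => f (u / v) * gamma_pdf b v) * gamma_pdf a u).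

Definition nuT (C G M Y x : R) : R :=
  let th := (G - M) / 2 in
  let tth := (G + M) / 2 in
  C * (2 `^ (Y / 2 - 1) * Gammaf (Y / 2) / Gammaf Y)
    * expR (- ((tth ^+ 2 - th ^+ 2) * x / 2)) / x `^ (1 + Y / 2)
    * E_gamma_ratio (Y / 2) (1 / 2) (fun r => expR (- (tth ^+ 2 * x / 2 * r))).

(* Laplace transform E[exp(-mu T(t))] of the marginal at time t of the
   driftless subordinator with Levy density nu (Levy-Khintchine formula) *)
Definition subord_LT (nu : R -> R) (t m : R) : R :=
  expR (- (t * Rintegral mu `]0%R, +oo[%classic (fun x => (1 - expR (- (m * x))) * nu x))).

Definition fZ (Y L z : R) : R := Y / 2 * L `^ (- (Y / 2)) * z `^ (Y / 2 - 1).

Definition E_log_R (G M Y L m : R) : R :=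
  let tth := (G + M) / 2 in
  E_gamma_ratio (Y / 2) (1 / 2) (fun r =>
    Rintegral mu `[0%R, L]%classic (fun z =>
      ln (1 + m * (1 / ((G * M + tth ^+ 2 * r) / 2 + z))) * fZ Y L z)).

Definition indep2 d (T : measurableType d) (P : probability T R) (X Y : T -> R) :=
  forall A B : set R, measurable A -> measurable B ->
    P (X @^-1` A `&` Y @^-1` B) = (P (X @^-1` A) * P (Y @^-1` B))%E.

(* generalized gamma convolution: nonnegative r.v. whose Laplace exponent is
   a*mu + int_(0,oo) log(1 + mu/s) U(ds) for a drift a >= 0 and a nonnegative
   (Thorin) measure U on (0,oo) *)
Definition is_GGC d (T : measurableType d) (P : probability T R) (X : T -> R) :=
  (forall w, 0 <= X w) /\
  exists (a : R) (U : {measure set R -> \bar R}),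
    0 <= a /\ U `]-oo, 0]%classic = 0%E /\
    forall m : R, 0 < m ->
      ((- ln (fine ('E_P[fun w => expR (- (m * X w))])))%:E =
       (a * m)%:E + \int[U]_(s in `]0%R, +oo[%classic) (ln (1 + m / s))%:E)%E.

End defs.

(* Main.v *)
Require Import Defs.
From HB Require Import structures.
From mathcomp Require Import all_boot all_order all_algebra.
From mathcomp Require Import all_classical all_reals all_analysis.
From mathcomp Require Import measurable_realfun.
From mathcomp Require Import ring lra.
Set Implicit Arguments. Unset Strict Implicit. Unset Printing Implicit Defensive.
Import Order.TTheory GRing.Theory Num.Theory.
Import numFieldNormedType.Exports.
Local Open Scope classical_set_scope.
Local Open Scope ring_scope.

(* Since the integral of z^(Y/2-1) e^(-zx) over z > 0 is Gamma(Y/2) x^(-Y/2), the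
   Levy density of T(t) is x^-1 times the integral of e^(-wx) over the pairs
   (z, r), with weight Ct z^(Y/2-1) dz times the law of the ratio of gamma
   variables, and rate w = z + (GM + ((G+M)/2)^2 r)/2.  The pairs with z <= L give
   the Levy density of T_L, those with z > L that of eps_L.  Frullani's integral
   turns the exponent of T_L into an integral of log (1 + m/w), and its Thorin
   measure is the image of the weight by w.
   A variable with a given Levy density g is obtained as the limit of compound
   Poisson variables, coupled monotonically by their quantile functions.  It
   satisfies the size-bias identity E[X f(X)] = int x g(x) E[f(x + X)] dx, which
   yields the two moments of eps_L and, by Stein's method, a normal approximation
   with error of the order of int x^3 g / sigma^3 <= 2 / (L sigma) -> 0. *)

(** * Lebesgue measure and densities *)

Lemma measurable_invr {R : realType} : measurable_fun [set: R] (fun x : R => x^-1).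
Proof.
have -> : (fun x : R => x^-1) = (fun x : R => x * `|x| `^ (- 2)).
  apply/funext => x; have [->|x0] := eqVneq x 0; first by rewrite invr0 mul0r.
  by rewrite powRN powR_mulrn// real_normK ?num_real//; field.
apply: measurable_funM => //.
apply: (measurableT_comp (f := fun t => powR t (- 2))); first exact: measurable_powR.
exact: normr_measurable.
Qed.

Ltac mfun := repeat first
  [ assumption
  | exact: measurable_cst | exact: measurable_id
  | exact: measurable_fst | exact: measurable_snd
  | lazymatch goal with
    | |- measurable_fun _ (fun x => EFin _) => apply/measurable_EFinP
    | |- measurable_fun _ (fun x => expR _) => apply: (measurableT_comp (f := expR)); first by []
    | |- measurable_fun _ (fun x => ln _) => apply: (measurableT_comp (f := @ln _)); first exact: measurable_ln
    | |- measurable_fun _ (fun x => powR _ ?e) =>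
        apply: (measurableT_comp (f := fun t => powR t e)); first exact: measurable_powR
    | |- measurable_fun _ (fun x => @Num.norm ?K ?V _) =>
        apply: (measurableT_comp (f := @Num.norm K V)); first exact: normr_measurable
    | |- measurable_fun _ (fun x => @GRing.inv _ _) => apply: (measurableT_comp measurable_invr)
    | |- measurable_fun _ (fun x => GRing.exp _ _) => apply: measurable_funX
    end
  | match goal with
    | H : measurable_fun [set: _] ?f |- measurable_fun _ (fun x => ?f _) =>
        apply: (measurableT_comp H)
    end
  | apply: measurable_funM | apply: measurable_funB | apply: measurable_funD
  | apply: measurable_funN
  | apply: emeasurable_funM | apply: emeasurable_funD
  | by [] ].

(* [lebesgue_measure] lives on the alias [measurableTypeR R]; restated on [R],
   it can be multiplied with the probability measures on [R]. *)
Definition leb {R : realType} : set R -> \bar R := @lebesgue_measure R.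

Section leb_measure.
Context {R : realType}.

Let leb_sigma_additive : @semi_sigma_additive _ R _ (@leb R).
Proof. exact: (@measure_semi_sigma_additive _ _ _ (@lebesgue_measure R)). Qed.

HB.instance Definition _ := @isMeasure.Build _ R R (@leb R)
  (measure0 (@lebesgue_measure R)) (measure_ge0 (@lebesgue_measure R))
  leb_sigma_additive.

Let leb_sigma_finite : @sigma_finite _ R _ setT (@leb R).
Proof. exact: (@sigma_finiteT _ _ _ (@lebesgue_measure R)). Qed.

HB.instance Definition _ := @Measure_isSigmaFinite.Build _ _ _ (@leb R) leb_sigma_finite.

Lemma ge0_lebE (D : set R) (f : R -> \bar R) : measurable D ->
  measurable_fun D f -> (forall x, D x -> 0 <= f x)%E ->
  (\int[leb]_(x in D) f x = \int[@lebesgue_measure R]_(x in D) f x)%E.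
Proof.
move=> mD mf f0; pose phi : measurableTypeR R -> R := idfun.
have mphi : measurable_fun [set: measurableTypeR R] phi by exact: measurable_id.
have f0' : {in D, forall y, 0 <= f y}%E by move=> y /set_mem; exact: f0.
have := ge0_integral_pushforward mphi (@lebesgue_measure R) mD mf f0'.
by rewrite (@eq_measure_integral _ R _ _ leb).
Qed.

Lemma lebE (D : set R) (f : R -> \bar R) : measurable D -> measurable_fun D f ->
  (\int[leb]_(x in D) f x = \int[@lebesgue_measure R]_(x in D) f x)%E.
Proof.
move=> mD mf; rewrite integralE [RHS]integralE; congr (_ - _)%E;
by apply: ge0_lebE => //; first [exact: measurable_funepos | exact: measurable_funeneg].
Qed.

End leb_measure.

Section density_probability.
Context d (T : measurableType d) {R : realType} (mu : {measure set T -> \bar R}).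

Definition density_measure (g : T -> R) (mg : measurable_fun [set: T] g)
  (g0 : forall x, 0 <= g x) : set T -> \bar R :=
  fun A => (\int[mu]_(x in A) (g x)%:E)%E.

Context (g : T -> R) (mg : measurable_fun [set: T] g) (g0 : forall x, 0 <= g x).

Let dens0 : density_measure mg g0 set0 = 0%E.
Proof. by rewrite /density_measure integral_set0. Qed.

Let dens_ge0 A : (0 <= density_measure mg g0 A)%E.
Proof. by apply: integral_ge0 => x _; rewrite lee_fin. Qed.

Let dens_sigma_additive : semi_sigma_additive (density_measure mg g0).
Proof.
move=> /= F mF tF mUF; rewrite /density_measure; apply: cvg_toP.
  apply: ereal_nondecreasing_is_cvgn => m n mn.
  apply: lee_sum_nneg_natr => // k _ _; apply: integral_ge0 => /= x Fkx.
  by rewrite lee_fin.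
rewrite ge0_integral_bigcup//=.
- by apply/measurable_funTS/measurableT_comp.
- by move=> x _; rewrite lee_fin.
Qed.

HB.instance Definition _ := isMeasure.Build _ _ _
  (density_measure mg g0) dens0 dens_ge0 dens_sigma_additive.

Import HBNNSimple.

Lemma ge0_integral_density (f : T -> \bar R) : measurable_fun [set: T] f ->
  (forall x, 0 <= f x)%E ->
  (\int[density_measure mg g0]_x f x = \int[mu]_x (f x * (g x)%:E))%E.
Proof.
move=> mf f0.
have mgE : measurable_fun [set: T] (EFin \o g) by exact: measurableT_comp.
have gE0 x : (0 <= (g x)%:E)%E by rewrite lee_fin.
pose f_ := nnsfun_approx measurableT mf.
have step (n : nat) : (\int[density_measure mg g0]_x (f_ n x)%:E =
    \int[mu]_x ((f_ n x)%:E * (g x)%:E))%E.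
  under [LHS]eq_integral do rewrite fimfunE -fsumEFin//.
  rewrite [LHS]ge0_integral_fsum//; last 2 first.
    - by move=> r; exact/measurable_EFinP/measurableT_comp.
    - by move=> r x _; rewrite EFinM nnfun_muleindic_ge0.
  under [RHS]eq_integral.
    move=> x _; rewrite fimfunE -fsumEFin// muleC ge0_mule_fsumr; last first.
      by move=> r; rewrite EFinM nnfun_muleindic_ge0.
    over.
  rewrite [RHS]ge0_integral_fsum//; last 2 first.
    - move=> r; apply: emeasurable_funM => //.
      by apply/measurable_EFinP; do 2 apply/measurableT_comp => //.
    - by move=> r x _; rewrite mule_ge0// EFinM nnfun_muleindic_ge0.
  apply: eq_fsbigr => r _; rewrite integralZl_indic_nnsfun//= integral_indic//.
  rewrite setIT -[X in (_ * X)%E]/(\int[mu]_(x in f_ n @^-1` [set r]) (g x)%:E)%E.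
  rewrite [X in (_ * X)%E = _]integral_mkcond.
  have [r0|r0] := ltP r 0.
    have -> : f_ n @^-1` [set r] = set0 by exact: preimage_nnfun0.
    rewrite (eq_integral (fun=> 0%E)); last by move=> x _; rewrite patchE in_set0.
    rewrite integral0 mule0; apply/esym; rewrite [LHS](eq_integral (fun=> 0%E)) ?integral0//.
    by move=> x _; rewrite indic0 mulr0 mule0.
  rewrite -ge0_integralZl//; last 2 first.
    - by apply/(measurable_restrictT _ _).1 => //; exact: measurable_funTS.
    - by move=> x _; exact: erestrict_ge0.
  apply: eq_integral => x _; rewrite patchE indicE; case: ifPn => _.
    by rewrite mulr1 muleC.
  by rewrite mulr0 !mule0.
transitivity (limn (fun n => \int[density_measure mg g0]_x (f_ n x)%:E))%E.
  rewrite -monotone_convergence//=.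
  - apply: eq_integral => x _; apply/esym/cvg_lim => //.
    exact: cvg_nnsfun_approx.
  - by move=> n; exact/measurable_EFinP/measurable_funTS.
  - by move=> n x _; rewrite lee_fin.
  - by move=> x _ m n mn; rewrite lee_fin; exact/lefP/nd_nnsfun_approx.
under eq_fun do rewrite step.
rewrite -monotone_convergence//=.
- apply: eq_integral => x _; apply/cvg_lim => //.
  by apply: cvgeZr => //; exact: cvg_nnsfun_approx.
- by move=> n; apply: emeasurable_funM => //; exact/measurable_EFinP/measurable_funTS.
- by move=> n x _; rewrite mule_ge0// lee_fin.
- move=> x _ m n mn; apply: lee_wpmul2r => //.
  by rewrite lee_fin; exact/lefP/nd_nnsfun_approx.
Qed.

End density_probability.

Lemma ex_density_probability {R : realType} (g : R -> R) :
  measurable_fun [set: R] g -> (forall x, 0 <= g x) ->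
  (\int[leb]_x (g x)%:E = 1)%E ->
  exists p : probability R R, forall f : R -> \bar R,
    measurable_fun [set: R] f -> (forall x, 0 <= f x)%E ->
    (\int[p]_x f x = \int[leb]_x (f x * (g x)%:E))%E.
Proof.
move=> mg g0 g1.
pose mix := @Measure_isProbability.Build _ _ R (density_measure leb mg g0) g1.
pose p : probability R R := HB.pack (density_measure leb mg g0) mix.
by exists p => f mf f0; rewrite -(ge0_integral_density leb mg g0 mf f0).
Qed.

Section abs_convolution.
Context {R : realType}.

(** * Laws with a given Levy density *)

(* Laws of nonnegative variables are represented by arbitrary probabilities on
   [R], pushed forward by the absolute value. *)
Definition absadd (z : R * R) : R := `|z.1| + `|z.2|.

Lemma measurable_absadd : measurable_fun [set: R * R] absadd.
Proof. by apply: measurable_funD; apply: measurableT_comp. Qed.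

HB.instance Definition _ := isMeasurableFun.Build _ _ _ _ absadd measurable_absadd.

Definition padd (p q : probability R R) : probability R R :=
  distribution (p \x q)%E absadd.

Section padd_theory.
Variable f : R -> \bar R.
Hypotheses (mf : measurable_fun [set: R] f) (f0 : forall x, (0 <= f x)%E).

Lemma measurable_comp_absadd : measurable_fun [set: R * R] (f \o absadd).
Proof. by apply: measurableT_comp => //; exact: measurable_absadd. Qed.

Lemma measurable_integral_absadd (q : probability R R) :
  measurable_fun [set: R] (fun x => \int[q]_y f (`|x| + `|y|))%E.
Proof.
exact: (measurable_fun_fubini_tonelli_F (m2 := q) _ measurable_comp_absadd (fun z => f0 _)).
Qed.

Lemma ge0_integral_padd (p q : probability R R) :
  (\int[padd p q]_x f x = \int[p]_x \int[q]_y f (`|x| + `|y|))%E.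
Proof.
rewrite ge0_integral_distribution//.
exact: (fubini_tonelli1 (m1 := p) (m2 := q) _ measurable_comp_absadd (fun z => f0 _)).
Qed.

Lemma absadd_tonelli (p q : probability R R) :
  (\int[p]_x \int[q]_y f (`|x| + `|y|) = \int[q]_y \int[p]_x f (`|x| + `|y|))%E.
Proof.
exact: (fubini_tonelli (m1 := p) (m2 := q) _ measurable_comp_absadd (fun z => f0 _)).
Qed.

End padd_theory.

Fixpoint ppow (p : probability R R) (k : nat) : probability R R :=
  if k is k'.+1 then padd p (ppow p k') else dirac (0 : R).

End abs_convolution.

Lemma nneseries_exp {R : realType} (c b : R) : 0 <= c -> 0 <= b ->
  (\sum_(0 <= k <oo) (c * (b ^+ k / k`!%:R))%:E = (c * expR b)%:E)%E.
Proof.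
move=> c0 b0; apply/cvg_lim => //.
under eq_fun do rewrite sumEFin; apply: cvg_EFin.
  by near=> n.
have -> : fine \o (fun n => (\sum_(0 <= k < n) c * (b ^+ k / k`!%:R))%:E) =
    (fun n => c * series (exp_coeff b) n).
  by apply/funext => n /=; rewrite /series/= mulr_sumr.
by apply: cvgMr; exact: is_cvg_series_exp_coeff.
Unshelve. all: by end_near. Qed.

Section compound_poisson.
Context {R : realType}.
Variable p : probability R R.
Local Notation "'J' q f" := (\int[p]_x (`|x|%R%:E * \int[q]_y f (`|x| + `|y|)%R))%E
  (at level 10, q at level 9, f at level 9).

Lemma measurable_ge0_normM (f : R -> \bar R) : measurable_fun [set: R] f ->
  measurable_fun [set: R] (fun x => `|x|%R%:E * f `|x|%R)%E.
Proof. by move=> mf; mfun. Qed.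

Lemma ppow_laplace (m : R) (k : nat) : 0 < m ->
  (\int[ppow p k]_x (expR (- (m * `|x|)))%:E =
   ((fine (\int[p]_x (expR (- (m * `|x|)))%:E)) ^+ k)%:E)%E.
Proof.
move=> m0.
have mE : measurable_fun [set: R] (fun x : R => (expR (- (m * `|x|)))%:E).
  by mfun.
have E0 (x : R) : (0 <= (expR (- (m * `|x|)))%:E)%E by rewrite lee_fin expR_ge0.
have fin : (\int[p]_x (expR (- (m * `|x|)))%:E)%E \is a fin_num.
  rewrite ge0_fin_numE ?integral_ge0//; apply: (@le_lt_trans _ _ (\int[p]_x (cst 1%E x))%E).
    apply: ge0_le_integral => //.
    move=> x _; rewrite lee_fin -[leRHS]expR0 ler_expR oppr_le0.
    by rewrite mulr_ge0// ltW.
  by rewrite integral_cst// mul1e; apply: (le_lt_trans (probability_le1 _ _)) => //; rewrite ltry.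
elim: k => [|k IHk]; first by rewrite expr0 integral_dirac//= diracT mul1e normr0 mulr0 oppr0 expR0.
rewrite [ppow p _.+1]/(padd p (ppow p k)) (ge0_integral_padd mE E0).
under eq_integral => x _.
  under eq_integral => y _.
    rewrite ger0_norm ?addr_ge0// mulrDr opprD expRD EFinM.
    over.
  rewrite ge0_integralZl// IHk.
  over.
rewrite ge0_integralZr//; last by rewrite lee_fin exprn_ge0// fine_ge0// integral_ge0.
by rewrite -[X in (X * _)%E]fineK// -EFinM exprS.
Qed.

Lemma ppow_size_bias (k : nat) (f : R -> \bar R) : measurable_fun [set: R] f ->
  (forall x, (0 <= f x)%E) ->
  (\int[ppow p k]_x (`|x|%R%:E * f `|x|%R) = k%:R%:E * J (ppow p k.-1) f)%E.
Proof.
elim: k f => [|k IHk] f mf f0.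
  by rewrite mul0e integral_dirac//= ?normr0 ?mul0e ?mule0//; exact: measurable_ge0_normM.
have mg1 : measurable_fun [set: R * R] (fun z => `|z.1|%R%:E * f (`|z.1| + `|z.2|)%R)%E.
  by mfun.
have mg2 : measurable_fun [set: R * R] (fun z => `|z.2|%R%:E * f (`|z.1| + `|z.2|)%R)%E.
  by mfun.
have g10 (z : R * R) : (0 <= `|z.1|%R%:E * f (`|z.1| + `|z.2|)%R)%E by rewrite mule_ge0.
have g20 (z : R * R) : (0 <= `|z.2|%R%:E * f (`|z.1| + `|z.2|)%R)%E by rewrite mule_ge0.
have mfx (x : R) : measurable_fun [set: R] (fun y => f (`|x| + y)%R).
  by mfun.
have mfy (x : R) : measurable_fun [set: R] (fun y => f (`|x| + `|y|)%R).
  by mfun.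
pose q := ppow p k.
have mF1 : measurable_fun [set: R] (fun x => \int[q]_y (`|x|%R%:E * f (`|x| + `|y|)%R))%E.
  exact: (measurable_fun_fubini_tonelli_F (m2 := q) _ mg1 g10).
have mF2 : measurable_fun [set: R] (fun x => \int[q]_y (`|y|%R%:E * f (`|x| + `|y|)%R))%E.
  exact: (measurable_fun_fubini_tonelli_F (m2 := q) _ mg2 g20).
rewrite [ppow p _.+1]/(padd p q).
rewrite (ge0_integral_padd (measurable_ge0_normM mf)); last by move=> x; rewrite mule_ge0.
transitivity (\int[p]_x (\int[q]_y (`|x|%R%:E * f (`|x| + `|y|)%R) +
                         \int[q]_y (`|y|%R%:E * f (`|x| + `|y|)%R)))%E.
  apply: eq_integral => x _.
  rewrite -ge0_integralD//; last 4 first.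
  - by move=> y _; exact: (g10 (x, y)).
  - by apply: emeasurable_funM.
  - by move=> y _; exact: (g20 (x, y)).
  - by apply: emeasurable_funM => //; apply/measurable_EFinP; exact: normr_measurable.
  apply: eq_integral => y _.
  by rewrite (ger0_norm (addr_ge0 _ _))// EFinD ge0_muleDl.
rewrite ge0_integralD//; last 2 first.
- by move=> x _; apply: integral_ge0 => y _; exact: (g10 (x, y)).
- by move=> x _; apply: integral_ge0 => y _; exact: (g20 (x, y)).
have -> : (\int[p]_x \int[q]_y (`|x|%R%:E * f (`|x| + `|y|)%R) = J q f)%E.
  by apply: eq_integral => x _; rewrite ge0_integralZl.
have -> : (\int[p]_x \int[q]_y (`|y|%R%:E * f (`|x| + `|y|)%R) = k%:R%:E * J q f)%E.
  under eq_integral => x _ do rewrite (IHk (fun t => f (`|x| + t)%R) (mfx x) (fun t => f0 _)).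
  case: k @q mF1 mF2 {IHk} => [|k] q mF1 mF2.
    by rewrite integral0_eq ?mul0e// => x _; rewrite mul0e.
  have m11 : measurable_fun [set: R * R * R] (fun z => z.1.1).
    by apply: (measurableT_comp (f := fst)) => //; exact: measurable_fst.
  have m12 : measurable_fun [set: R * R * R] (fun z => z.1.2).
    by apply: (measurableT_comp (f := snd)) => //; exact: measurable_snd.
  have mf3 : measurable_fun [set: R * R * R]
      (fun z => f (`|z.1.1| + (`|z.1.2| + `|z.2|))%R) by mfun.
  pose H (z : R * R) := (\int[ppow p k]_y f (`|z.1| + (`|z.2| + `|y|))%R)%E.
  have mH : measurable_fun [set: R * R] H.
    exact: (measurable_fun_fubini_tonelli_F (m2 := ppow p k) _ mf3 (fun z => f0 _)).
  have H0 z : (0 <= H z)%E by apply: integral_ge0 => y _.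
  have mHy (y : R) : measurable_fun [set: R] (fun x => H (x, y)).
    by apply: (measurableT_comp mH); exact: measurable_pair2.
  have mHn : measurable_fun [set: R * R] (fun z => `|z.2|%R%:E * H z)%E by mfun.
  have Hn0 z : (0 <= `|z.2|%R%:E * H z)%E by rewrite mule_ge0.
  rewrite ge0_integralZl//; last 2 first.
  - exact: (measurable_fun_fubini_tonelli_F (m2 := p) _ mHn Hn0).
  - by move=> x _; apply: integral_ge0 => y _; exact: (Hn0 (x, y)).
  congr (_ * _)%E.
  rewrite (fubini_tonelli (m1 := p) (m2 := p) _ mHn Hn0).
  apply: eq_integral => x _; rewrite /= ge0_integralZl//=.
  congr (_ * _)%E; rewrite (ge0_integral_padd (mfy x))//.
  apply: eq_integral => y _; apply: eq_integral => w _.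
  by rewrite (ger0_norm (addr_ge0 _ _))// addrCA.
by rewrite -[in X in (X + _)%E](mul1e (J q f)) -ge0_muleDl ?lee_fin// -EFinD -natr1 addrC.
Qed.

End compound_poisson.

Section levy_law.
Context {R : realType}.
Local Notation D := (`]0%R, +oo[%classic : set R).

Lemma ex_mixture (w : nat -> R) (q_ : nat -> probability R R) :
  (forall k, 0 <= w k) -> (\sum_(0 <= k <oo) (w k)%:E = 1)%E ->
  exists q : probability R R, forall f : R -> \bar R,
    measurable_fun [set: R] f -> (forall x, 0 <= f x)%E ->
    (\int[q]_x f x = \sum_(0 <= k <oo) ((w k)%:E * \int[q_ k]_x f x))%E.
Proof.
move=> w0 w1.
pose m_ (k : nat) : {measure set R -> \bar R} := mscale (NngNum (w0 k)) (q_ k).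
have q1 : mseries m_ 0 [set: R] = 1%E.
  rewrite -w1; apply: eq_eseriesr => k _.
  by rewrite -[LHS]/((w k)%:E * q_ k [set: R])%E probability_setT mule1.
pose mix := @Measure_isProbability.Build _ _ R (mseries m_ 0) q1.
pose q : probability R R := HB.pack (mseries m_ 0) mix.
exists q => f mf f0.
rewrite [LHS](ge0_integral_measure_series m_)//.
by apply: eq_eseriesr => k _; rewrite ge0_integral_mscale.
Qed.

Definition levy_exponent (g : R -> R) (m : R) : R :=
  \int[leb]_(x in D) ((1 - expR (- (m * x))) * g x).

Definition levy_law (g : R -> R) (q : probability R R) : Prop :=
  (forall m : R, 0 < m -> (\int[q]_x (expR (- (m * `|x|)))%:E =
    (expR (- levy_exponent g m))%:E)%E) /\
  (forall f : R -> \bar R, measurable_fun [set: R] f -> (forall x, 0 <= f x)%E ->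
    (\int[q]_x (`|x|%R%:E * f `|x|%R) =
     \int[leb]_(x in D) ((x * g x)%:E * \int[q]_y f (x + `|y|)%R))%E).

Lemma ex_normalized_density (g : R -> R) (a : R) : measurable_fun [set: R] g ->
  (forall x, 0 <= g x) -> (\int[leb]_(x in D) (g x)%:E = a%:E)%E ->
  exists p : probability R R, forall f : R -> \bar R,
    measurable_fun [set: R] f -> (forall x, 0 <= f x)%E ->
    (a%:E * \int[p]_x f x = \int[leb]_(x in D) (f x * (g x)%:E))%E.
Proof.
move=> mg g0 ga.
have mD : measurable D by [].
have mgE : measurable_fun D (EFin \o g) by apply/measurable_EFinP/measurable_funTS.
have a0 : 0 <= a by rewrite -lee_fin -ga integral_ge0// => x _; rewrite lee_fin.
have [a0'|an0] := eqVneq a 0.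
  exists (dirac (0 : R)) => f mf f0; rewrite a0' mul0e; apply/esym.
  have /(ae_eq_integral_abs leb mD mgE) gae : (\int[leb]_(x in D) `|(g x)%:E| = 0)%E.
    apply: etrans (etrans ga _); last by rewrite a0'.
    by apply: eq_integral => x _; rewrite gee0_abs// lee_fin.
  transitivity (\int[leb]_(x in D) (f x * 0))%E; last first.
    by rewrite integral0_eq// => x _; rewrite mule0.
  apply: ae_eq_integral => //.
  - by apply: emeasurable_funM => //; exact: measurable_funTS.
  - by apply: emeasurable_funM => //; exact: measurable_funTS.
  - exact: ae_eqe_mul2l.
pose h x := a^-1 * g x * \1_D x.
have a_gt0 : 0 < a by rewrite lt_neqAle eq_sym an0.
have mh : measurable_fun [set: R] h.
  by apply: measurable_funM; [exact: measurable_funM|exact: measurable_indic].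
have h0 x : 0 <= h x by rewrite mulr_ge0// mulr_ge0// invr_ge0.
have hD (f : R -> \bar R) : measurable_fun [set: R] f -> (forall x, 0 <= f x)%E ->
    (\int[leb]_x (f x * (h x)%:E) = a^-1%:E * \int[leb]_(x in D) (f x * (g x)%:E))%E.
  move=> mf f0; rewrite -ge0_integralZl//; last 3 first.
  - by apply: emeasurable_funM => //; exact: measurable_funTS.
  - by move=> x _; rewrite mule_ge0// lee_fin.
  - by rewrite lee_fin invr_ge0.
  rewrite [RHS]integral_mkcond epatch_indic; apply: eq_integral => x _ /=.
  by rewrite /h 2!EFinM !muleA (muleC (f x)).
have [|p ph] := @ex_density_probability R h mh h0.
  have := hD (cst 1%E) (measurable_cst _) (fun=> lee01).
  under eq_integral do rewrite mul1e.
  by under [in X in (_ = _ * X)%E]eq_integral do rewrite mul1e;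
    rewrite ga -EFinM mulVf.
exists p => f mf f0.
by rewrite ph// hD// muleA -EFinM divff// mul1e.
Qed.

End levy_law.

Section levy_law_construction.
Context {R : realType}.
Local Notation D := (`]0%R, +oo[%classic : set R).

Lemma probability_integral_le d (T : measurableType d) (P : probability T R)
    (f : T -> \bar R) (B : R) : measurable_fun [set: T] f ->
  (forall x, 0 <= f x)%E -> (forall x, f x <= B%:E)%E -> (\int[P]_x f x <= B%:E)%E.
Proof.
move=> mf f0 fB; apply: (@le_trans _ _ (\int[P]_x (cst B%:E x))%E).
  by apply: ge0_le_integral.
by rewrite integral_cst// [X in (_ * X)%E](@probability_setT _ _ _ P) mule1.
Qed.

Lemma probability_integral_fin d (T : measurableType d) (P : probability T R)
    (f : T -> \bar R) (B : R) : measurable_fun [set: T] f ->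
  (forall x, 0 <= f x)%E -> (forall x, f x <= B%:E)%E ->
  (\int[P]_x f x)%E \is a fin_num.
Proof.
move=> mf f0 fB; rewrite ge0_fin_numE ?integral_ge0//.
by apply: (le_lt_trans (probability_integral_le P mf f0 fB)); rewrite ltry.
Qed.

Lemma measurable_integral_shift (f : R -> \bar R) (q : probability R R) :
  measurable_fun [set: R] f -> (forall x, 0 <= f x)%E ->
  measurable_fun [set: R] (fun t => \int[q]_y f (t + `|y|)%R)%E.
Proof.
move=> mf f0.
have m2 : measurable_fun [set: R * R] (fun z => f (z.1 + `|z.2|)) by mfun.
exact: (measurable_fun_fubini_tonelli_F (m2 := q) _ m2 (fun z => f0 _)).
Qed.

Lemma integrable_density (g : R -> R) : measurable_fun [set: R] g ->
  (forall x, 0 <= g x) -> (\int[leb]_(x in D) (g x)%:E < +oo)%E ->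
  leb.-integrable D (EFin \o g).
Proof.
move=> mg g0 goo; apply/integrableP; split.
  by apply/measurable_EFinP; exact: measurable_funTS.
by under eq_integral do rewrite gee0_abs ?lee_fin//.
Qed.

Lemma integrable_laplaceM (g : R -> R) (m : R) : 0 < m -> measurable_fun [set: R] g ->
  (forall x, 0 <= g x) -> (\int[leb]_(x in D) (g x)%:E < +oo)%E ->
  leb.-integrable D (fun x => (expR (- (m * x)) * g x)%:E) /\
  leb.-integrable D (fun x => ((1 - expR (- (m * x))) * g x)%:E).
Proof.
move=> m0 mg g0 /(integrable_density mg g0) ig.
have mD : measurable D by [].
have e1 x : D x -> expR (- (m * x)) <= 1.
  by rewrite /= in_itv/= andbT => x0; rewrite -[leRHS]expR0 ler_expR oppr_le0 mulr_ge0// ltW.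
split; apply: (le_integrable mD _ _ ig).
- by apply: measurable_funTS; mfun.
- move=> x Dx /=; rewrite lee_fin normrM !ger0_norm ?g0 ?expR_ge0//.
  by rewrite ler_piMl// e1.
- by apply: measurable_funTS; mfun.
- move=> x Dx /=; rewrite lee_fin normrM !ger0_norm ?g0 ?subr_ge0 ?e1//.
  by rewrite ler_piMl// lerBlDr lerDl expR_ge0.
Qed.

Lemma ex_compound_poisson (g : R -> R) (a : R) : measurable_fun [set: R] g ->
  (forall x, 0 <= g x) -> (\int[leb]_(x in D) (g x)%:E = a%:E)%E ->
  exists q : probability R R, levy_law g q.
Proof.
move=> mg g0 ga.
have a0 : 0 <= a by rewrite -lee_fin -ga integral_ge0// => x _; rewrite lee_fin.
have goo : (\int[leb]_(x in D) (g x)%:E < +oo)%E by rewrite ga ltry.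
have [p pE] := ex_normalized_density mg g0 ga.
pose w k := expR (- a) * (a ^+ k / k`!%:R).
have w0 k : 0 <= w k by rewrite mulr_ge0 ?expR_ge0// divr_ge0// exprn_ge0.
have w1 : (\sum_(0 <= k <oo) (w k)%:E = 1)%E.
  by rewrite nneseries_exp ?expR_ge0// -expRD addNr expR0.
have [q qE] := ex_mixture (ppow p) w0 w1.
exists q; split=> [m m0|f mf f0].
  set E := fun x : R => (expR (- (m * `|x|)))%:E.
  have mE : measurable_fun [set: R] E by rewrite /E; mfun.
  have E0 x : (0 <= E x)%E by rewrite lee_fin expR_ge0.
  have [ie i1e] := integrable_laplaceM m0 mg g0 goo.
  set phi := fine (\int[p]_x E x).
  have phi0 : 0 <= phi by rewrite fine_ge0// integral_ge0.
  have phifin : (\int[p]_x E x)%E = phi%:E.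
    rewrite /phi fineK// (@probability_integral_fin _ _ p E 1)// => x.
    by rewrite lee_fin -[leRHS]expR0 ler_expR oppr_le0 mulr_ge0// ltW.
  have aphi : (a * phi = \int[leb]_(x in D) (expR (- (m * x)) * g x))%R.
    rewrite /Rintegral -[LHS]/(fine (a%:E * phi%:E)) -phifin pE//.
    congr fine; apply: eq_integral => x; rewrite inE/= in_itv/= andbT => x0.
    by rewrite EFinM /E gtr0_norm.
  rewrite qE//.
  under eq_eseriesr => k _.
    rewrite ppow_laplace// -/E -/phi -EFinM /w -!mulrA.
    rewrite (_ : a ^+ k * _ = (a * phi) ^+ k / k`!%:R); last first.
      by rewrite exprMn -mulrA; congr (_ * _); rewrite mulrC.
    over.
  rewrite nneseries_exp ?expR_ge0 ?mulr_ge0// -expRD; congr (expR _)%:E.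
  rewrite /levy_exponent aphi.
  have -> : a = \int[leb]_(x in D) g x by rewrite /Rintegral ga.
  rewrite addrC -opprB; congr (- _).
  rewrite -RintegralB//; last exact: integrable_density.
  by apply: eq_Rintegral => x _; rewrite mulrBl mul1r.
rewrite qE//; last 2 first.
- exact: measurable_ge0_normM.
- by move=> x; rewrite mule_ge0.
pose K k := (\int[p]_x (`|x|%R%:E * \int[ppow p k]_y f (`|x| + `|y|)%R))%E.
have mKk k : measurable_fun [set: R] (fun x => `|x|%R%:E * \int[ppow p k]_y f (`|x| + `|y|)%R)%E.
  apply: emeasurable_funM; first by mfun.
  exact: measurable_integral_absadd.
have K0 k : (0 <= K k)%E.
  by apply: integral_ge0 => x _; rewrite mule_ge0//; apply: integral_ge0.
rewrite nneseries_recl//; last first.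
  by move=> k _; rewrite mule_ge0 ?lee_fin//; apply: integral_ge0 => x _; rewrite mule_ge0.
rewrite ppow_size_bias// mul0e mule0 add0e.
rewrite -(nneseries_addn 1); last first.
  by move=> k; rewrite mule_ge0 ?lee_fin//; apply: integral_ge0 => x _; rewrite mule_ge0.
transitivity (\sum_(0 <= k <oo) (a%:E * ((w k)%:E * K k)))%E.
  apply: eq_eseriesr => k _; rewrite addn1 ppow_size_bias//= -/(K k) !muleA -!EFinM.
  congr (_%:E * _)%E; rewrite /w factS natrM exprS.
  have k0 : k`!%:R != 0 :> R by rewrite pnatr_eq0 -lt0n fact_gt0.
  have k1 : k.+1%:R != 0 :> R by rewrite pnatr_eq0.
  by field; rewrite ?k0 ?k1 ?nat1r ?natr1 ?k1.
rewrite nneseriesZl; last by move=> k _; rewrite mule_ge0// lee_fin.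
have mI k : measurable_fun [set: R] (fun x => \int[ppow p k]_y f (`|x| + `|y|)%R)%E.
  exact: measurable_integral_absadd.
transitivity (a%:E * \int[p]_x (`|x|%R%:E * \int[q]_y f (`|x| + `|y|)%R))%E.
  congr (_ * _)%E.
  transitivity (\sum_(0 <= k <oo) \int[p]_x
      ((w k)%:E * (`|x|%R%:E * \int[ppow p k]_y f (`|x| + `|y|)%R)))%E.
    apply: eq_eseriesr => k _; rewrite ge0_integralZl// ?lee_fin//.
    by move=> x _; rewrite mule_ge0// integral_ge0.
  rewrite -integral_nneseries//; last 2 first.
  - by move=> k; apply: emeasurable_funM.
  - by move=> k x _; rewrite mule_ge0 ?lee_fin// mule_ge0// integral_ge0.
  apply: eq_integral => x _; rewrite qE//; last by mfun.
  rewrite -nneseriesZl; last by move=> k _; rewrite mule_ge0 ?lee_fin// integral_ge0.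
  by apply: eq_eseriesr => k _; rewrite muleCA.
rewrite pE; last 2 first.
- by apply: emeasurable_funM; [mfun|exact: measurable_integral_absadd].
- by move=> x; rewrite mule_ge0// integral_ge0.
apply: eq_integral => x; rewrite inE/= in_itv/= andbT => x0.
by rewrite gtr0_norm// EFinM muleAC.
Qed.

End levy_law_construction.

Section levy_law_sequence.
Context {R : realType}.
Local Notation D := (`]0%R, +oo[%classic : set R).

Lemma levy_law_padd (g1 g2 : R -> R) (q1 q2 : probability R R) :
  measurable_fun [set: R] g1 -> (forall x, 0 <= g1 x) ->
  (\int[leb]_(x in D) (g1 x)%:E < +oo)%E ->
  measurable_fun [set: R] g2 -> (forall x, 0 <= g2 x) ->
  (\int[leb]_(x in D) (g2 x)%:E < +oo)%E ->
  levy_law g1 q1 -> levy_law g2 q2 ->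
  levy_law (fun x => g1 x + g2 x) (padd q1 q2).
Proof.
move=> mg1 g10 ig1 mg2 g20 ig2 [L1 S1] [L2 S2]; split=> [m m0|f mf f0].
  have mE : measurable_fun [set: R] (fun x : R => (expR (- (m * `|x|)))%:E) by mfun.
  have E0 (x : R) : (0 <= (expR (- (m * `|x|)))%:E)%E by rewrite lee_fin expR_ge0.
  rewrite (ge0_integral_padd mE E0).
  under eq_integral => x _.
    under eq_integral => y _.
      rewrite ger0_norm ?addr_ge0// mulrDr opprD expRD EFinM.
      over.
    rewrite ge0_integralZl// L2//.
    over.
  rewrite ge0_integralZr ?lee_fin ?expR_ge0//.
  rewrite L1// -EFinM -expRD -opprD; congr (expR (- _))%:E.
  rewrite /levy_exponent -RintegralD//; last 2 first.
    exact: (integrable_laplaceM m0 mg1 g10 ig1).2.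
    exact: (integrable_laplaceM m0 mg2 g20 ig2).2.
  by apply: eq_Rintegral => x _; rewrite mulrDr.
have mfa := measurable_comp_absadd mf.
have mn1 : measurable_fun [set: R * R] (fun z => `|z.1|%R%:E * f (`|z.1| + `|z.2|)%R)%E.
  by apply: emeasurable_funM => //; mfun.
have mn2 : measurable_fun [set: R * R] (fun z => `|z.2|%R%:E * f (`|z.1| + `|z.2|)%R)%E.
  by apply: emeasurable_funM => //; mfun.
have n10 (z : R * R) : (0 <= `|z.1|%R%:E * f (`|z.1| + `|z.2|)%R)%E by rewrite mule_ge0.
have n20 (z : R * R) : (0 <= `|z.2|%R%:E * f (`|z.1| + `|z.2|)%R)%E by rewrite mule_ge0.
have mft (t : R) : measurable_fun [set: R] (fun y => f (t + `|y|)) by mfun.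
have mK := measurable_integral_shift (padd q1 q2) mf f0.
have K0 (x : R) : (0 <= \int[padd q1 q2]_y f (x + `|y|)%R)%E by exact: integral_ge0.
have gK g : measurable_fun [set: R] g ->
    measurable_fun D (fun x => (x * g x)%:E * \int[padd q1 q2]_y f (x + `|y|)%R)%E.
  by move=> mg; apply: measurable_funTS; apply: emeasurable_funM => //; mfun.
have gK0 g : (forall x : R, 0 <= g x) ->
    forall x, D x -> (0 <= (x * g x)%:E * \int[padd q1 q2]_y f (x + `|y|)%R)%E.
  move=> g0 x; rewrite /= in_itv/= andbT => x0.
  by rewrite mule_ge0// lee_fin mulr_ge0// ltW.
transitivity (\int[leb]_(x in D) ((x * g1 x)%:E * \int[padd q1 q2]_y f (x + `|y|)%R) +
    \int[leb]_(x in D) ((x * g2 x)%:E * \int[padd q1 q2]_y f (x + `|y|)%R))%E; last first.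
  rewrite -ge0_integralD//; last 4 first.
  - exact: gK0.
  - exact: gK.
  - exact: gK0.
  - exact: gK.
  apply: eq_integral => x; rewrite inE/= in_itv/= andbT => x0.
  by rewrite -ge0_muleDl ?lee_fin ?mulr_ge0 ?(ltW x0)// -EFinD mulrDr.
rewrite (ge0_integral_padd (measurable_ge0_normM mf)); last by move=> x; rewrite mule_ge0.
transitivity (\int[q1]_x (\int[q2]_y (`|x|%R%:E * f (`|x| + `|y|)%R) +
                         \int[q2]_y (`|y|%R%:E * f (`|x| + `|y|)%R)))%E.
  apply: eq_integral => x _.
  rewrite -ge0_integralD//; last 4 first.
  - by move=> y _; exact: (n10 (x, y)).
  - by apply: emeasurable_funM.
  - by move=> y _; exact: (n20 (x, y)).
  - by apply: emeasurable_funM => //; mfun.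
  apply: eq_integral => y _.
  by rewrite (ger0_norm (addr_ge0 _ _))// EFinD ge0_muleDl.
rewrite ge0_integralD//; last 4 first.
- by move=> x _; apply: integral_ge0 => y _; exact: (n10 (x, y)).
- exact: (measurable_fun_fubini_tonelli_F (m2 := q2) _ mn1 n10).
- by move=> x _; apply: integral_ge0 => y _; exact: (n20 (x, y)).
- exact: (measurable_fun_fubini_tonelli_F (m2 := q2) _ mn2 n20).
congr (_ + _)%E.
  under eq_integral => x _ do rewrite ge0_integralZl//.
  rewrite (S1 (fun t => \int[q2]_y f (t + `|y|)%R)%E); last 2 first.
  - exact: measurable_integral_shift.
  - by move=> x; exact: integral_ge0.
  apply: eq_integral => x _; congr (_ * _)%E.
  rewrite (ge0_integral_padd (mft x))//.
  apply: eq_integral => y _; apply: eq_integral => z _.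
  by rewrite (ger0_norm (addr_ge0 _ _))// addrA.
rewrite (fubini_tonelli (m1 := q1) (m2 := q2) _ mn2 n20)/=.
have mfs (t : R) : measurable_fun [set: R] (fun y => f (`|y| + t)) by mfun.
under eq_integral => y _ do rewrite ge0_integralZl//.
under eq_integral => y _ do under eq_integral do rewrite addrC.
rewrite (S2 (fun t => \int[q1]_x f (t + `|x|)%R)%E); last 2 first.
- exact: measurable_integral_shift.
- by move=> x; exact: integral_ge0.
apply: eq_integral => x _; congr (_ * _)%E.
rewrite (ge0_integral_padd (mft x))// (absadd_tonelli (f := fun t => f (x + `|t|)%R))//.
apply: eq_integral => y _; apply: eq_integral => z _.
by rewrite (ger0_norm (addr_ge0 _ _))// (addrC `|z|) addrA.
Qed.

End levy_law_sequence.

Section quantile.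
Context {R : realType}.

Lemma ex_uniform01 : exists U : probability R R, forall A, measurable A ->
  U A = leb (A `&` `]0, 1[).
Proof.
have i01 : measurable_fun [set: R] (\1_(`]0, 1[%classic) : R -> R) by exact: measurable_indic.
have i01E : (\int[leb]_x (\1_(`]0, 1[%classic : set R) x)%:E = 1 :> \bar R)%E.
  rewrite integral_indic//= setIT -[LHS]/(lebesgue_measure (`]0, 1[%classic : set R)).
  by rewrite lebesgue_measure_itv/= lte_fin ltr01 oppr0 adde0.
have [p pE] := ex_density_probability i01 (fun x => ltac:(rewrite indicE; exact: ler0n)) i01E.
exists p => A mA.
have mAE : measurable_fun [set: R] (fun x => (\1_A x)%:E : \bar R).
  by apply/measurable_EFinP; exact: measurable_indic.
have := pE _ mAE (fun x => ltac:(rewrite lee_fin indicE; exact: ler0n)).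
rewrite integral_indic// setIT => ->.
transitivity (\int[leb]_x (\1_(A `&` `]0, 1[) x)%:E)%E.
  by apply: eq_integral => x _; rewrite indicI EFinM.
by rewrite integral_indic ?setIT//; exact: measurableI.
Qed.

Definition abs_cdf (q : probability R R) (x : R) : R := fine (q [set y | `|y| <= x]).

(* Used on the uniform space, where the quantile functions of a stochastically
   increasing sequence of laws increase pointwise and so have a limit. *)
Definition quantile (q : probability R R) (u : R) : R :=
  if 0 < u < 1 then inf [set x | 0 <= x /\ u <= abs_cdf q x] else 0.

Section fixed_law.
Variable q : probability R R.

Lemma measurable_abs_le (x : R) : measurable [set y : R | `|y| <= x].
Proof.
have -> : [set y : R | `|y| <= x] = (@Num.norm R R) @^-1` `]-oo, x].
  by apply/seteqP; split => y /=; rewrite in_itv.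
by rewrite -[X in measurable X]setTI; exact: normr_measurable.
Qed.

Let mN : measurable_fun [set: R] (@Num.norm R R). Proof. exact: normr_measurable. Qed.

Let N : {mfun R >-> R} := mfun_Sub (mem_set mN).

Let NE x : distribution q N `]-oo, x] = q [set y | `|y| <= x].
Proof.
by rewrite /distribution /pushforward; congr (q _).
Qed.

Lemma abs_cdfE x : ((abs_cdf q x)%:E = q [set y | (`|y| <= x)%R])%E.
Proof. by rewrite fineK// fin_num_measure//; exact: measurable_abs_le. Qed.

Lemma abs_cdf_homo : {homo abs_cdf q : x y / x <= y}.
Proof.
move=> x y xy; rewrite -lee_fin !abs_cdfE; apply: le_measure.
- by rewrite inE; exact: measurable_abs_le.
- by rewrite inE; exact: measurable_abs_le.
- by move=> z /= /le_trans; apply.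
Qed.

Lemma abs_cdf_le1 x : abs_cdf q x <= 1.
Proof. by rewrite -lee_fin abs_cdfE; apply: probability_le1; exact: measurable_abs_le. Qed.

Lemma abs_cdf_ge0 x : 0 <= abs_cdf q x.
Proof. by rewrite -lee_fin abs_cdfE. Qed.

Lemma abs_cdf_lt0 x : x < 0 -> abs_cdf q x = 0.
Proof.
move=> x0; rewrite /abs_cdf (_ : [set y | `|y| <= x] = set0) ?measure0//.
by apply/seteqP; split => y //= yx; have := normr_ge0 y; rewrite leNgt (le_lt_trans yx).
Qed.

Lemma abs_cdf_cvgy : abs_cdf q x @[x --> +oo] --> (1 : R).
Proof.
apply: fine_cvg; have := @cvg_cdfy1 _ _ _ q N.
by apply: cvg_trans; apply: near_eq_cvg; near=> x; rewrite -NE.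
Unshelve. all: by end_near. Qed.

Lemma abs_cdf_right_continuous x : abs_cdf q y @[y --> x^'+] --> abs_cdf q x.
Proof.
apply: fine_cvg; rewrite abs_cdfE -NE; have := @cdf_right_continuous _ _ _ q N x.
by apply: cvg_trans; apply: near_eq_cvg; near=> y; rewrite -NE.
Unshelve. all: by end_near. Qed.

Lemma quantile_ge0 u : 0 <= quantile q u.
Proof.
rewrite /quantile; case: ifPn => // _.
have [[x xS]|S0] := pselect ([set x | 0 <= x /\ u <= abs_cdf q x] !=set0).
  by apply: lb_le_inf; [exists x|move=> y []].
have -> : [set x | 0 <= x /\ u <= abs_cdf q x] = set0.
  by apply/seteqP; split => // y ?; case: S0; exists y.
by rewrite inf0.
Qed.

Lemma quantile_le u x : 0 < u < 1 -> (quantile q u <= x) = (u <= abs_cdf q x).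
Proof.
move=> u01; have /andP[u0 u1] := u01; rewrite /quantile u01.
set S := [set x | _].
have S_lb : has_lbound S by exists 0 => y [].
apply/idP/idP => [Sx|ux]; last first.
  apply: ge_inf => //; split => //; rewrite leNgt; apply/negP => /abs_cdf_lt0 x0.
  by move: ux; rewrite x0 leNgt u0.
have S_ne : S !=set0.
  have : \forall y \near +oo, u < abs_cdf q y.
    by apply: (cvgr_gt _ abs_cdf_cvgy).
  move=> [A [_ /(_ (Num.max (A + 1) 0))]]; rewrite lt_max ltrDl ltr01/= => /(_ erefl) uA.
  by exists (Num.max (A + 1) 0); split; [rewrite le_max lexx orbT|exact: ltW].
apply: (@closed_cvg _ _ (x^'+) _ (abs_cdf q) (fun t => u <= t)).
- exact: closed_ge.
- near=> y; have xy : x < y by near: y; exact: nbhs_right_gt.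
  have [s [s0 us] sy] := inf_lt S_ne (le_lt_trans Sx xy).
  by apply: (le_trans us); apply: abs_cdf_homo; exact: ltW.
- exact: abs_cdf_right_continuous.
Unshelve. all: by end_near. Qed.

Lemma quantile_homo : {in `]0, 1[ &, {homo quantile q : u v / u <= v}}.
Proof.
move=> u v; rewrite !in_itv/= => u01 v01 uv.
by rewrite quantile_le// (le_trans uv)// -quantile_le.
Qed.

Lemma measurable_quantile : measurable_fun [set: R] (quantile q).
Proof.
have h : measurable_fun (`]0, 1[%classic : set R) (quantile q).
  apply: (measurability (@RGenCInfty.G R)) => [|/= _ [_] [r] -> <-].
    exact: RGenCInfty.measurableE.
  apply: is_interval_measurable => s t /= [s01 rs] [t01 rt] y /andP[sy yt].
  have y01 : y \in `]0, 1[.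
    move: s01 t01; rewrite /= !in_itv/= => /andP[s0 _] /andP[_ t1].
    by rewrite (lt_le_trans s0 sy) (le_lt_trans yt t1).
  split => //; move: rs; rewrite /= !in_itv/= !andbT => /le_trans; apply.
  exact: quantile_homo.
suff -> : quantile q = quantile q \_ `]0, 1[ by apply/(measurable_restrictT _ _).1.
apply/funext => u; rewrite patchE; case: ifPn => //; rewrite notin_setE/= in_itv/=.
by rewrite /quantile => /negP/negbTE ->.
Qed.

Variable U : probability R R.
Hypothesis UE : forall A, measurable A -> U A = leb (A `&` `]0, 1[).

Lemma quantile_law (f : R -> \bar R) : measurable_fun [set: R] f ->
  (forall x, 0 <= f x)%E ->
  (\int[U]_u f (quantile q u) = \int[q]_x f `|x|%R)%E.
Proof.
move=> mf f0.
pose Q : {mfun R >-> R} := mfun_Sub (mem_set measurable_quantile).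
rewrite -[LHS](ge0_integral_distribution (P := U) Q mf f0).
rewrite -[RHS](ge0_integral_distribution (P := q) N mf f0).
apply: eq_measure_integral => A mA _.
have UQ x : U (quantile q @^-1` `]-oo, x]) = (abs_cdf q x)%:E.
  have mQx : measurable (quantile q @^-1` `]-oo, x]).
    by rewrite -[X in measurable X]setTI; exact: measurable_quantile.
  rewrite UE//.
  have [x0|x0] := ltP x 0.
    rewrite abs_cdf_lt0// (_ : _ `&` _ = set0) ?measure0//.
    apply/seteqP; split => // u [/=]; rewrite in_itv/= => Qx _.
    by have := quantile_ge0 u; rewrite leNgt (le_lt_trans Qx).
  have [F1|F1] := eqVneq (abs_cdf q x) 1.
    have -> : quantile q @^-1` `]-oo, x] `&` `]0, 1[ = `]0, 1[%classic.
      apply/seteqP; split => [u []//|u u01]; split => //=; move: u01.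
      by rewrite /= !in_itv/= => u01; rewrite quantile_le// F1; case/andP: u01 => _ /ltW.
    rewrite F1 -[LHS]/(lebesgue_measure (`]0, 1[%classic : set R)).
    by rewrite lebesgue_measure_itv/= lte_fin ltr01 oppr0 adde0.
  have F_lt1 : abs_cdf q x < 1 by rewrite lt_neqAle F1 abs_cdf_le1.
  have -> : quantile q @^-1` `]-oo, x] `&` `]0, 1[ = `]0, abs_cdf q x]%classic.
    apply/seteqP; split => u /=; rewrite !in_itv/=.
      by move=> [ux u01]; rewrite -quantile_le// ux andbT; case/andP: u01.
    move=> /andP[u0 uF]; have u01 : 0 < u < 1 by rewrite u0 (le_lt_trans uF).
    by rewrite quantile_le.
  rewrite -[LHS]/(lebesgue_measure (`]0, abs_cdf q x]%classic : set R)).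
  rewrite lebesgue_measure_itv/= lte_fin; case: ltP => F0; first by rewrite oppr0 adde0.
  by congr (_%:E); apply/eqP; rewrite eq_le F0 abs_cdf_ge0.
apply: (measure_unique (@RGenOInfty.G R) (fun n : nat => `]- n%:R, +oo[%classic)) => //.
- exact: RGenOInfty.measurableE.
- move=> _ _ [x ->] [y ->]; exists (Num.max x y).
  apply/seteqP; split => z /=; rewrite !in_itv/= gt_max !andbT.
    by move=> [-> ->].
  by move=> /andP[].
- by move=> n; exists (- n%:R).
- apply/seteqP; split => // x _.
  have xn := archi_boundP (normr_ge0 x).
  exists (Num.bound `|x|) => //=; rewrite in_itv/= andbT ltrNl.
  by apply: le_lt_trans xn; rewrite -normrN ler_norm.
- move=> _ [x ->].
  have C (P : probability R R) :
      (P (`]x, +oo[%classic : set R) = 1 - P (`]-oo, x]%classic : set R))%E.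
    by rewrite -setCitvl; exact: probability_setC.
  transitivity (1 - distribution U Q `]-oo, x])%E; first exact: C.
  transitivity (1 - distribution q N `]-oo, x])%E; last by rewrite -C.
  by congr (1 - _)%E; rewrite NE -abs_cdfE -UQ.
- by move=> k; apply: (le_lt_trans (probability_le1 _ _)) => //; rewrite ltry.
Qed.

End fixed_law.
End quantile.

Lemma cvg_dominated d (T : measurableType d) (R : realType)
    (mu : {measure set T -> \bar R}) (D : set T) (f_ : nat -> T -> \bar R)
    (f h : T -> \bar R) : measurable D ->
  (forall n, measurable_fun D (f_ n)) -> measurable_fun D f ->
  (forall x, D x -> f_ n x @[n --> \oo] --> f x) ->
  mu.-integrable D h -> (forall n x, D x -> (`|f_ n x| <= h x)%E) ->
  (\int[mu]_(x in D) f_ n x)%E @[n --> \oo] --> (\int[mu]_(x in D) f x)%E.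
Proof.
move=> mD mf_ mf ff ih fh.
by have [] := dominated_convergence mD mf_ mf (aeW _ ff) ih
  (aeW _ (fun x n => fh n x)).
Qed.

Section levy_quantile.
Context {R : realType}.
Local Notation D := (`]0%R, +oo[%classic : set R).

Lemma abs_cdf_padd (p q : probability R R) (x : R) :
  abs_cdf (padd p q) x <= abs_cdf q x.
Proof.
rewrite -lee_fin !abs_cdfE.
have mA := measurable_abs_le x.
apply: (@le_trans _ _ ((p \x q)%E ([set: R] `*` [set y : R | `|y| <= x]))).
  apply: (@le_measure _ _ _ (p \x q)%E (absadd @^-1` [set y | `|y| <= x])).
  - by rewrite inE -[X in measurable X]setTI; exact: measurable_absadd.
  - by rewrite inE; exact: measurableX.
  - move=> [a b] /=; rewrite /absadd/= ger0_norm ?addr_ge0// => abx.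
    by split => //; apply: le_trans abx; rewrite lerDr.
rewrite product_measure1E//.
by rewrite [X in (X * _)%E](@probability_setT _ _ _ p) mul1e.
Qed.

Lemma expR_onem_dominated (m : R) : 0 < m -> exists K : R, 0 <= K /\
  forall x, 0 <= x -> 1 - expR (- (m * x)) <= K * (1 - expR (- x)).
Proof.
move=> m0; have := archi_boundP (ltW m0); set n := Num.bound m => mn.
exists n%:R; split => // x x0.
set y := expR (- x); have y0 : 0 <= y by exact: expR_ge0.
have y1 : y <= 1 by rewrite -[leRHS]expR0 ler_expR oppr_le0.
apply: (@le_trans _ _ (1 - y ^+ n)).
  rewrite lerD2l lerN2 -expRM_natl ler_expR mulrN lerN2.
  by apply: ler_wpM2r => //; exact: ltW.
elim: n {mn} => [|n IHn]; first by rewrite expr0 subrr mul0r.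
have -> : 1 - y ^+ n.+1 = 1 - y + y * (1 - y ^+ n) by rewrite exprS; ring.
rewrite -natr1 mulrDl mul1r addrC lerD2r.
apply: le_trans IHn; rewrite ler_piMl// subr_ge0.
by rewrite exprn_ile1.
Qed.

Context (g : R -> R) (mg : measurable_fun [set: R] g) (g0 : forall x, 0 <= g x).
Hypothesis gfin : (\int[leb]_(x in D) ((1 - expR (- x)) * g x)%:E < +oo)%E.

Let mD : measurable D. Proof. by []. Qed.

Let onem_ge0 (m x : R) : 0 <= m -> 0 <= x -> 0 <= 1 - expR (- (m * x)).
Proof. by move=> m0 x0; rewrite subr_ge0 -[leRHS]expR0 ler_expR oppr_le0 mulr_ge0. Qed.

Lemma integrable_levy_exponent (m : R) : 0 < m ->
  leb.-integrable D (fun x : R => ((1 - expR (- (m * x))) * g x)%:E).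
Proof.
move=> m0; have [K [K0 hK]] := expR_onem_dominated m0.
have i0 : leb.-integrable D (fun x : R => ((1 - expR (- x)) * g x)%:E).
  apply/integrableP; split; first by apply: measurable_funTS; mfun.
  apply: le_lt_trans gfin; rewrite le_eqVlt; apply/orP; left; apply/eqP.
  apply: eq_integral => x.
  rewrite inE/= in_itv/= andbT => x0; congr (_%:E); rewrite ger0_norm// mulr_ge0//.
  by have := onem_ge0 ler01 (ltW x0); rewrite mul1r.
have i1 : leb.-integrable D (fun x : R => K%:E * ((1 - expR (- x)) * g x)%:E)%E.
  exact: integrableZl.
apply: (le_integrable mD _ _ i1); first by apply: measurable_funTS; mfun.
move=> x; rewrite /= in_itv/= andbT => x0; rewrite lee_fin.
rewrite ger0_norm; last by rewrite mulr_ge0// onem_ge0// ltW.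
apply: le_trans (ler_norm _); rewrite mulrA; apply: ler_wpM2r => //.
by apply: hK; exact: ltW.
Qed.

Lemma levy_exponent_cvg0 : levy_exponent g n.+1%:R^-1 @[n --> \oo] --> (0 : R).
Proof.
rewrite /levy_exponent; apply: fine_cvg.
have -> : (0%:E = \int[leb]_(x in D) (cst 0%E x))%E by rewrite integral_cst// mul0e.
apply: (cvg_dominated mD _ _ _ (integrable_levy_exponent ltr01)) => //.
- by move=> n; apply: measurable_funTS; mfun.
- move=> x; rewrite /= in_itv/= andbT => x0.
  apply: cvg_EFin; first by near=> n.
  rewrite [X in X @ _ --> _](_ : _ = fun n : nat => (1 - expR (- (n.+1%:R^-1 * x))) * g x)//.
  have -> : (0:R) = (1 - expR (- (0 * x))) * g x by rewrite mul0r oppr0 expR0 subrr mul0r.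
  apply: cvgMl; apply: cvgB; first exact: cvg_cst.
  apply: continuous_cvg; first exact: continuous_expR.
  by apply: cvgN; apply: cvgMl; exact: cvg_harmonic.
- move=> n x; rewrite /= in_itv/= andbT => x0; rewrite lee_fin.
  have n1 : n.+1%:R^-1 <= 1 :> R by rewrite invf_le1// ler1n.
  rewrite ger0_norm; last by rewrite mulr_ge0// onem_ge0// ltW.
  apply: ler_wpM2r => //; rewrite lerD2l lerN2 ler_expR lerN2.
  by apply: ler_wpM2r => //; exact: ltW.
Unshelve. all: by end_near. Qed.

End levy_quantile.

Section levy_quantile_limit.
Context {R : realType}.
Local Notation D := (`]0%R, +oo[%classic : set R).
Variable U : probability R R.
Hypothesis UE : forall A, measurable A -> U A = leb (A `&` `]0, 1[).
Context (g : R -> R) (mg : measurable_fun [set: R] g) (g0 : forall x, 0 <= g x).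
Hypothesis gfin : (\int[leb]_(x in D) ((1 - expR (- x)) * g x)%:E < +oo)%E.

Let mD : measurable D. Proof. by []. Qed.

Definition jump_trunc (n : nat) (x : R) : R := g x * \1_(`[n.+1%:R^-1, +oo[%classic) x.

Lemma measurable_jump_trunc n : measurable_fun [set: R] (jump_trunc n).
Proof. by apply: measurable_funM => //; exact: measurable_indic. Qed.

Lemma jump_trunc_ge0 n x : 0 <= jump_trunc n x.
Proof. by rewrite mulr_ge0// indicE. Qed.

Lemma jump_trunc_le n x : jump_trunc n x <= g x.
Proof. by rewrite /jump_trunc ler_piMr// indicE lern1 leq_b1. Qed.

Lemma jump_trunc_near x : 0 < x -> \forall n \near \oo, jump_trunc n x = g x.
Proof.
move=> x0; near=> n; rewrite /jump_trunc indicE mem_set ?mulr1//= in_itv/= andbT ltW//.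
by near: n; exact: (near_infty_natSinv_lt (PosNum x0)).
Unshelve. all: by end_near. Qed.

Lemma fin_integral_far (h : R -> R) (c : R) : 0 < c -> measurable_fun [set: R] h ->
  (forall x, 0 <= h x <= g x) -> (forall x, x < c -> h x = 0) ->
  (\int[leb]_(x in D) (h x)%:E < +oo)%E.
Proof.
move=> c0 mh hg hc.
pose k := 1 - expR (- c).
have k0 : 0 < k by rewrite subr_gt0 -[ltRHS]expR0 ltr_expR oppr_lt0.
apply: (@le_lt_trans _ _ (k^-1%:E * \int[leb]_(x in D) ((1 - expR (- x)) * g x)%:E)%E).
  rewrite -ge0_integralZl//; last 3 first.
  - by apply: measurable_funTS; mfun.
  - move=> x; rewrite /= in_itv/= andbT => x0; rewrite lee_fin mulr_ge0//.
    by rewrite subr_ge0 -[leRHS]expR0 ler_expR oppr_le0 ltW.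
  - by rewrite lee_fin invr_ge0 ltW.
  apply: ge0_le_integral => //.
  - by move=> x _; rewrite lee_fin; case/andP: (hg x).
  - by apply: measurable_funTS; mfun.
  - by apply: measurable_funTS; mfun.
  - move=> x; rewrite /= in_itv/= andbT => x0; rewrite -EFinM lee_fin.
    have [xc|cx] := ltP x c.
      rewrite hc// mulr_ge0 ?invr_ge0 ?(ltW k0)// mulr_ge0//.
      by rewrite subr_ge0 -[leRHS]expR0 ler_expR oppr_le0 ltW.
    rewrite mulrA; apply: le_trans (_ : g x <= _); first by case/andP: (hg x).
    rewrite ler_peMl// mulrC ler_pdivlMr// mul1r /k lerD2l lerN2 ler_expR.
    by rewrite lerN2.
by rewrite lte_mul_pinfty// lee_fin invr_ge0 ltW.
Qed.

Lemma ex_levy_law_sequence : exists mu_ : nat -> probability R R,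
  (forall n, levy_law (jump_trunc n) (mu_ n)) /\
  (forall n x, abs_cdf (mu_ n.+1) x <= abs_cdf (mu_ n) x).
Proof.
pose d_ (n : nat) (x : R) : R := g x * \1_(`[n.+2%:R^-1, n.+1%:R^-1[%classic) x.
have md n : measurable_fun [set: R] (d_ n).
  by apply: measurable_funM => //; exact: measurable_indic.
have d0 n x : 0 <= d_ n x by rewrite mulr_ge0// indicE.
have inv0 n : 0 < n.+1%:R^-1 :> R by rewrite invr_gt0.
have dfin n : (\int[leb]_(x in D) (d_ n x)%:E < +oo)%E.
  apply: (fin_integral_far (c := n.+2%:R^-1)) => // [x|x xn].
    by rewrite d0 /d_ ler_piMr// indicE lern1 leq_b1.
  rewrite /d_ indicE memNset ?mulr0//= in_itv/= => /andP[].
  by rewrite leNgt xn.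
have gnfin n : (\int[leb]_(x in D) (jump_trunc n x)%:E < +oo)%E.
  apply: (fin_integral_far (c := n.+1%:R^-1)) => // [|x|x xn].
  - exact: measurable_jump_trunc.
  - by rewrite jump_trunc_ge0 jump_trunc_le.
  - rewrite /jump_trunc indicE memNset ?mulr0//= in_itv/= andbT.
    by apply/negP; rewrite -ltNge.
have step (h : R -> R) : measurable_fun [set: R] h -> (forall x, 0 <= h x) ->
    (\int[leb]_(x in D) (h x)%:E < +oo)%E -> exists q, levy_law h q.
  move=> mh h0 hfin.
  apply: (ex_compound_poisson (a := fine (\int[leb]_(x in D) (h x)%:E))) => //.
  by rewrite fineK// ge0_fin_numE// integral_ge0// => x _; rewrite lee_fin.
have [q0 q0P] := step _ (measurable_jump_trunc 0) (jump_trunc_ge0 0) (gnfin 0%N).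
have [kap kapP] := choice (fun n => step _ (md n) (d0 n) (dfin n)).
pose mu_ := nat_rect (fun=> probability R R) q0 (fun n r => padd (kap n) r).
exists mu_; split=> [|n x]; last exact: abs_cdf_padd.
elim=> [//|n IHn].
have -> : jump_trunc n.+1 = (fun x => d_ n x + jump_trunc n x).
  apply/funext => x; rewrite /jump_trunc /d_ -mulrDr; congr (_ * _).
  have lt12 : n.+2%:R^-1 <= n.+1%:R^-1 :> R by rewrite lef_pV2 ?posrE// ler_nat.
  rewrite !indicE !mem_setE/= !in_itv/= !andbT.
  have [xn|nx] := ltP x n.+1%:R^-1; first by rewrite andbT addr0.
  by rewrite andbF add0r (le_trans lt12 nx).
apply: levy_law_padd => //.
- exact: measurable_jump_trunc.
- exact: jump_trunc_ge0.
Qed.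

Lemma levy_exponent_trunc_le n m : 0 < m ->
  levy_exponent (jump_trunc n) m <= levy_exponent g m.
Proof.
move=> m0; have onem0 x : D x -> 0 <= 1 - expR (- (m * x)).
  rewrite /= in_itv/= andbT => x0.
  by rewrite subr_ge0 -[leRHS]expR0 ler_expR oppr_le0 mulr_ge0// ltW.
have ig := integrable_levy_exponent mg g0 gfin m0.
apply: le_Rintegral => //.
  apply: (le_integrable mD _ _ ig).
    apply/measurable_EFinP; apply: measurable_funTS.
    by apply: measurable_funM; [mfun|exact: measurable_jump_trunc].
  move=> x Dx /=; rewrite lee_fin !ger0_norm ?mulr_ge0 ?onem0 ?jump_trunc_ge0//.
  by apply: ler_wpM2l; [exact: onem0|exact: jump_trunc_le].
by move=> x Dx; apply: ler_wpM2l; [exact: onem0|exact: jump_trunc_le].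
Qed.

Lemma levy_exponent_trunc_cvg m : 0 < m ->
  levy_exponent (jump_trunc n) m @[n --> \oo] --> levy_exponent g m.
Proof.
move=> m0; have onem0 x : D x -> 0 <= 1 - expR (- (m * x)).
  rewrite /= in_itv/= andbT => x0.
  by rewrite subr_ge0 -[leRHS]expR0 ler_expR oppr_le0 mulr_ge0// ltW.
have ig := integrable_levy_exponent mg g0 gfin m0.
rewrite /levy_exponent; apply: fine_cvg; rewrite fineK ?integrable_fin_num//.
apply: (cvg_dominated mD _ _ _ ig) => //.
- move=> n; apply/measurable_EFinP; apply: measurable_funTS.
  by apply: measurable_funM; [mfun|exact: measurable_jump_trunc].
- by apply: measurable_funTS; mfun.
- move=> x; rewrite /= in_itv/= andbT => x0.
  apply: cvg_near_cst; near=> n; congr ((_ * _)%:E).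
  by near: n; exact: jump_trunc_near.
- move=> n x Dx; rewrite lee_fin ger0_norm ?mulr_ge0 ?onem0 ?jump_trunc_ge0//.
  by apply: ler_wpM2l; [exact: onem0|exact: jump_trunc_le].
Unshelve. all: by end_near. Qed.

End levy_quantile_limit.

Lemma probability_integral_cst d (T : measurableType d) (R : realType)
  (P : probability T R) (c : \bar R) : (\int[P]_x c = c)%E.
Proof. by rewrite integral_cst// [X in (_ * X)%E](@probability_setT _ _ _ P) mule1. Qed.

Lemma cvg_seq_EFin (R : realType) (f : nat -> R) (l : R) :
  f n @[n --> \oo] --> l -> (f n)%:E @[n --> \oo] --> l%:E.
Proof.
by move=> fl; apply: cvg_EFin => //; near=> n.
Unshelve. all: by end_near. Qed.

Section levy_quantile_existence.
Context {R : realType}.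
Local Notation D := (`]0%R, +oo[%classic : set R).
Variable U : probability R R.
Hypothesis UE : forall A, measurable A -> U A = leb (A `&` `]0, 1[).
Context (g : R -> R) (mg : measurable_fun [set: R] g) (g0 : forall x, 0 <= g x).
Hypothesis gfin : (\int[leb]_(x in D) ((1 - expR (- x)) * g x)%:E < +oo)%E.

Let mD : measurable D. Proof. by []. Qed.

Lemma quantile_bounded (mu_ : nat -> probability R R) (u : R) :
  (forall n, levy_law (jump_trunc g n) (mu_ n)) ->
  exists B, forall n, quantile (mu_ n) u <= B.
Proof.
move=> mu_law; case: (boolP (0 < u < 1)) => [u01|u01]; last first.
  by exists 0 => n; rewrite /quantile (negbTE u01).
have [k kP] : exists k : nat, levy_exponent g k.+1%:R^-1 < (1 - u) / 2.
  have : \forall k \near \oo, levy_exponent g k.+1%:R^-1 < (1 - u) / 2.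
    apply: (cvgr_lt _ (levy_exponent_cvg0 mg g0 gfin)).
    by rewrite divr_gt0// subr_gt0; case/andP: u01.
  by move=> [k _ /(_ k (leqnn k)) h]; exists k.
exists k.+1%:R => n; rewrite quantile_le//.
set m := k.+1%:R^-1 in kP; set F := abs_cdf _ _.
have m0 : 0 < m by rewrite invr_gt0.
have e2 : expR (-1) <= 2^-1 :> R.
  by rewrite expRN lef_pV2 ?posrE ?expR_gt0//; apply: le_trans (expR_ge1Dx 1).
have [L1 _] := mu_law n.
have key : expR (- levy_exponent (jump_trunc g n) m) <= expR (- 1) + (1 - expR (-1)) * F.
  rewrite -lee_fin -L1// EFinD EFinM abs_cdfE.
  set A := [set y : R | _].
  have mA : measurable A by exact: measurable_abs_le.
  have c0 : 0 <= 1 - expR (-1) :> R.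
    by rewrite subr_ge0; apply: le_trans e2 _; rewrite invf_le1// ler1n.
  have -> : ((expR (-1))%:E + (1 - expR (-1))%:E * mu_ n A =
      \int[mu_ n]_x ((expR (-1))%:E + (1 - expR (-1))%:E * (\1_A x)%:E))%E.
    rewrite ge0_integralD//.
    - rewrite probability_integral_cst.
      rewrite ge0_integralZl ?integral_indic ?setIT//.
      by apply/measurable_EFinP; exact: measurable_indic.
    - apply: emeasurable_funM => //.
      by apply/measurable_EFinP; exact: measurable_indic.
  apply: ge0_le_integral => //.
  - by mfun.
  - apply: emeasurable_funD => //; apply: emeasurable_funM => //.
    by apply/measurable_EFinP; exact: measurable_indic.
  - move=> x _; rewrite -EFinM -EFinD lee_fin indicE.
    have [/set_mem xA|xA] := boolP (x \in A).
      rewrite mulr1 addrC subrK -[leRHS]expR0 ler_expR oppr_le0.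
      by rewrite mulr_ge0// ltW.
    rewrite mulr0 addr0 ler_expR lerN2.
    move: xA; rewrite notin_setE /A/= => /negP; rewrite -ltNge => kx.
    by rewrite /m mulrC ler_pdivlMr ?mul1r ?ltW.
have := expR_ge1Dx (- levy_exponent (jump_trunc g n) m).
have := levy_exponent_trunc_le mg g0 gfin n m0.
set a := levy_exponent _ _ in key *; set b := levy_exponent _ _ in kP *.
set e := expR (-1) in key e2; set E := expR _ in key *.
move=> ab aE.
have : (1 - e) * (1 - F) <= b by nra.
have F1 : F <= 1 by exact: abs_cdf_le1.
have e0 : 0 <= e by exact: expR_ge0.
nra.
Qed.

Lemma ex_levy_quantile : exists Q : R -> R,
  [/\ measurable_fun [set: R] Q, forall u, 0 <= Q u,
   forall m, 0 < m ->
     (\int[U]_u (expR (- (m * Q u)))%:E = (expR (- levy_exponent g m))%:E)%E &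
   (\int[leb]_(x in D) (x * g x)%:E < +oo)%E ->
   forall (f : R -> R) (B : R), continuous f -> (forall x, 0 <= f x <= B) ->
     (\int[U]_u (Q u * f (Q u))%:E =
      \int[leb]_(x in D) ((x * g x)%:E * \int[U]_u (f (x + Q u))%:E))%E].
Proof.
have [mu_ [mu_law mu_nd]] := ex_levy_law_sequence mg g0 gfin.
pose Q_ n u := quantile (mu_ n) u.
have Q_nd u : nondecreasing_seq (Q_^~ u).
  apply/nondecreasing_seqP => n; rewrite /Q_.
  case: (boolP (0 < u < 1)) => [u01|u01]; last by rewrite /quantile (negbTE u01).
  by rewrite quantile_le// (le_trans _ (mu_nd n _))// -quantile_le.
have Q_ub u : has_ubound (range (Q_^~ u)).
  by have [B hB] := quantile_bounded u mu_law; exists B => _ [n _ <-]; exact: hB.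
have Q_cvg u : cvgn (Q_^~ u) by exact: nondecreasing_is_cvgn.
pose Q u := limn (Q_^~ u).
have QQ u : Q_ n u @[n --> \oo] --> Q u by exact: Q_cvg.
have Q_le n u : Q_ n u <= Q u by exact: nondecreasing_cvgn_le.
have mQ_ n : measurable_fun [set: R] (Q_ n) by exact: measurable_quantile.
have mQ : measurable_fun [set: R] Q.
  by apply: (measurable_fun_cvg mQ_) => u _; exact: QQ.
have Q_0 n u : 0 <= Q_ n u by exact: quantile_ge0.
have Q0 u : 0 <= Q u by exact: le_trans (Q_0 0%N u) (Q_le 0%N u).
exists Q; split => //.
- move=> m m0.
  have h1 : (\int[U]_u (expR (- (m * Q_ n u)))%:E)%E @[n --> \oo] -->
      (\int[U]_u (expR (- (m * Q u)))%:E)%E.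
    apply: (cvg_dominated measurableT _ _ _ (h := cst 1%E)).
    - by move=> n; have := mQ_ n => ?; mfun.
    - by mfun.
    - move=> u _; apply: cvg_seq_EFin.
      apply: continuous_cvg; first exact: continuous_expR.
      by apply: cvgN; apply: cvgMr; exact: QQ.
    - exact: finite_measure_integrable_cst.
    - move=> n u _; rewrite lee_fin ger0_norm ?expR_ge0//.
      by rewrite -[leRHS]expR0 ler_expR oppr_le0 mulr_ge0// ltW.
  have h2 : (\int[U]_u (expR (- (m * Q_ n u)))%:E)%E @[n --> \oo] -->
      (expR (- levy_exponent g m))%:E.
    have -> : (fun n => \int[U]_u (expR (- (m * Q_ n u)))%:E)%E =
        (fun n => (expR (- levy_exponent (jump_trunc g n) m))%:E).
      apply/funext => n; have [L _] := mu_law n.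
      rewrite -L// -(quantile_law (mu_ n) UE (f := fun t => (expR (- (m * t)))%:E))//.
      by mfun.
    apply: cvg_seq_EFin.
    apply: continuous_cvg; first exact: continuous_expR.
    by apply: cvgN; exact: levy_exponent_trunc_cvg.
  exact: cvg_unique h1 h2.
- move=> xgfin f B cf fB.
  have B0 : 0 <= B by have /andP[/le_trans h /h] := fB 0.
  have mf : measurable_fun [set: R] f by exact: continuous_measurable_fun.
  have f0 x : 0 <= f x by case/andP: (fB x).
  have fleB x : f x <= B by case/andP: (fB x).
  have mxg : measurable_fun [set: R] (fun x => x * g x) by mfun.
  have mt n : measurable_fun [set: R] (jump_trunc g n) by exact: measurable_jump_trunc.
  have xg0 x : D x -> 0 <= x * g x.
    by rewrite /= in_itv/= andbT => x0; rewrite mulr_ge0// ltW.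
  have ixg : leb.-integrable D (fun x => (x * g x)%:E).
    apply/integrableP; split; first by apply/measurable_EFinP; exact: measurable_funTS.
    apply: le_lt_trans xgfin; rewrite le_eqVlt; apply/orP; left; apply/eqP.
    by apply: eq_integral => x /set_mem Dx; rewrite gee0_abs// lee_fin xg0.
  have EQ_ n : (\int[U]_u (Q_ n u)%:E <= \int[leb]_(x in D) (x * g x)%:E)%E.
    have [_ S] := mu_law n.
    have := S (cst 1%E) (measurable_cst _) (fun=> lee01).
    under eq_integral do rewrite mule1.
    have mN : measurable_fun [set: R] (fun t : R => (`|t|)%:E) by mfun.
    have := quantile_law (mu_ n) UE mN (fun t => ltac:(rewrite lee_fin; exact: normr_ge0)).
    under [in X in _ = X]eq_integral do rewrite normr_id.
    have -> : (\int[U]_u (Q_ n u)%:E = \int[U]_u (`|quantile (mu_ n) u|)%:E)%E.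
      by apply: eq_integral => u _; rewrite ger0_norm ?quantile_ge0.
    move=> -> ->; apply: ge0_le_integral => //.
    + move=> x Dx; rewrite mule_ge0 ?integral_ge0// lee_fin mulr_ge0 ?jump_trunc_ge0//.
      by move: Dx; rewrite /= in_itv/= andbT => /ltW.
    + apply: measurable_funTS; apply: emeasurable_funM; first by have := mt n => ?; mfun.
      exact: (measurable_integral_shift (mu_ n) (measurable_cst (1%E : \bar R)) (fun=> lee01)).
    + by apply/measurable_EFinP; exact: measurable_funTS.
    + move=> x Dx; rewrite /= probability_integral_cst mule1.
      rewrite lee_fin; apply: ler_wpM2l; last exact: jump_trunc_le.
      by move: Dx; rewrite /= in_itv/= andbT => /ltW.
  have cvgEQ : (\int[U]_u (Q_ n u)%:E)%E @[n --> \oo] --> (\int[U]_u (Q u)%:E)%E.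
    have -> : (\int[U]_u (Q u)%:E = \int[U]_u (limn (fun n => (Q_ n u)%:E)))%E.
      by apply: eq_integral => u _; apply/esym/cvg_lim => //; exact: cvg_seq_EFin.
    apply: cvg_monotone_convergence => //.
    + by move=> n; exact/measurable_EFinP.
    + by move=> n u _; rewrite lee_fin.
    + by move=> u _ a b ab; rewrite lee_fin; exact: Q_nd.
  have EQ : (\int[U]_u (Q u)%:E <= \int[leb]_(x in D) (x * g x)%:E)%E.
    rewrite -(cvg_lim _ cvgEQ)//; apply: lime_le; first by apply/cvg_ex; eexists; exact: cvgEQ.
    by near=> n; exact: EQ_.
  have iQ : U.-integrable setT (EFin \o Q).
    apply/integrableP; split; first exact/measurable_EFinP.
    apply: le_lt_trans xgfin; apply: le_trans EQ.
    by under eq_integral => u _ do rewrite /= ger0_norm//.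
  have mfQ_ n : measurable_fun [set: R] (fun u => f (Q_ n u)) by exact: measurableT_comp.
  have mfQ : measurable_fun [set: R] (fun u => f (Q u)) by exact: measurableT_comp.
  have h1 : (\int[U]_u (Q_ n u * f (Q_ n u))%:E)%E @[n --> \oo] -->
      (\int[U]_u (Q u * f (Q u))%:E)%E.
    apply: (cvg_dominated measurableT _ _ _ (h := fun u => (B%:E * (Q u)%:E)%E)).
    + by move=> n; apply/measurable_EFinP; exact: measurable_funM.
    + by apply/measurable_EFinP; exact: measurable_funM.
    + move=> u _; apply: cvg_seq_EFin; apply: cvgM; first exact: QQ.
      by apply: continuous_cvg; [exact: cf|exact: QQ].
    + exact: integrableZl.
    + move=> n u _; rewrite lee_fin ger0_norm ?mulr_ge0// mulrC.
      by apply: ler_pM.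
  pose I n x := (\int[U]_u (f (x + Q_ n u))%:E)%E.
  pose J x := (\int[U]_u (f (x + Q u))%:E)%E.
  have mfx (q : R -> R) : measurable_fun [set: R] q ->
      measurable_fun [set: R] (fun x => \int[U]_u (f (x + q u))%:E)%E.
    move=> mq.
    have mq2 : measurable_fun [set: R * R] (fun z => q z.2).
      by apply: (measurableT_comp mq); exact: measurable_snd.
    have m2 : measurable_fun [set: R * R] (fun z => (f (z.1 + q z.2))%:E).
      by apply/measurable_EFinP; apply: (measurableT_comp mf); apply: measurable_funD.
    by apply: (measurable_fun_fubini_tonelli_F (m2 := U) _ m2) => z; rewrite lee_fin.
  have mfxu (q : R -> R) (x : R) : measurable_fun [set: R] q ->
      measurable_fun [set: R] (fun u => (f (x + q u))%:E).
    by move=> mq; apply/measurable_EFinP; apply: (measurableT_comp mf); exact: measurable_funD.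
  have h2 n : (\int[U]_u (Q_ n u * f (Q_ n u))%:E =
      \int[leb]_(x in D) ((x * jump_trunc g n x)%:E * I n x))%E.
    have [_ S] := mu_law n.
    have mfE : measurable_fun [set: R] (fun t => (f t)%:E) by exact/measurable_EFinP.
    have fE0 t : (0 <= (f t)%:E)%E by rewrite lee_fin.
    have Ix x : (I n x = \int[mu_ n]_y (f (x + `|y|))%:E)%E.
      apply: (quantile_law (mu_ n) UE (f := fun t => (f (x + t))%:E)) => //.
      by apply/measurable_EFinP; apply: (measurableT_comp mf); exact: measurable_funD.
    under [RHS]eq_integral do rewrite Ix.
    rewrite -(S _ mfE fE0).
    have mF := measurable_ge0_normM mfE.
    have F0 (t : R) : (0 <= `|t|%R%:E * (f `|t|)%:E)%E by rewrite mule_ge0.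
    have := quantile_law (mu_ n) UE mF F0.
    under [in X in _ = X -> _]eq_integral do rewrite normr_id.
    move=> <-; apply: eq_integral => u _.
    by rewrite ger0_norm ?quantile_ge0.
  have h3 : (\int[leb]_(x in D) ((x * jump_trunc g n x)%:E * I n x))%E @[n --> \oo] -->
      (\int[leb]_(x in D) ((x * g x)%:E * J x))%E.
    have I_le n x : (I n x <= B%:E)%E.
      by apply: probability_integral_le => [|u|u]; rewrite ?lee_fin//; exact: mfxu.
    have I_ge0 n x : (0 <= I n x)%E by apply: integral_ge0 => u _; rewrite lee_fin.
    apply: (@cvg_dominated _ _ _ leb D (fun n x => (x * jump_trunc g n x)%:E * I n x)%E
      (fun x => (x * g x)%:E * J x)%E (fun x => (B%:E * (x * g x)%:E)%E)) => //.
    + move=> n; apply: measurable_funTS; apply: emeasurable_funM; last exact: mfx.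
      by have := mt n => ?; mfun.
    + by apply: measurable_funTS; apply: emeasurable_funM; [mfun|exact: mfx].
    + move=> x; rewrite /= in_itv/= andbT => x0.
      have IJ : I n x @[n --> \oo] --> J x.
        apply: (cvg_dominated measurableT _ _ _ (h := cst B%:E)).
        * by move=> n; exact: mfxu.
        * exact: mfxu.
        * move=> u _; apply: cvg_seq_EFin; apply: continuous_cvg; first exact: cf.
          by apply: cvgD; [exact: cvg_cst|exact: QQ].
        * exact: finite_measure_integrable_cst.
        * by move=> n u _; rewrite lee_fin ger0_norm.
      have : ((x * g x)%:E * I n x)%E @[n --> \oo] --> ((x * g x)%:E * J x)%E.
        exact: cvgeZl.
      apply: cvg_trans; apply: near_eq_cvg; near=> n.
      congr ((_ * _)%:E * _)%E; apply/esym; near: n; exact: jump_trunc_near.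
    + exact: integrableZl.
    + move=> n x Dx; have x0 : 0 <= x by move: Dx; rewrite /= in_itv/= andbT => /ltW.
      rewrite gee0_abs; last by rewrite mule_ge0// lee_fin mulr_ge0// jump_trunc_ge0.
      rewrite muleC; apply: lee_pmul => //; first by rewrite lee_fin mulr_ge0// jump_trunc_ge0.
      by rewrite lee_fin ler_wpM2l// jump_trunc_le.
  apply: (cvg_unique _ h1) => //; apply: cvg_trans h3.
  by apply: near_eq_cvg; near=> n; rewrite h2.
Unshelve. all: by end_near. Qed.

End levy_quantile_existence.

(** * Stein's method *)

Section gaussian_tail.
Context {R : realType}.
Local Notation mu := (@lebesgue_measure R).
Implicit Types x y : R.

Let phi : R -> R := normal_pdf 0 1.

Lemma std_normal_pdfE x : phi x = normal_peak 1 * expR (- (x ^+ 2 / 2)).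
Proof. by rewrite /phi normal_pdfE ?oner_neq0// /normal_fun subr0 expr1n mulNr. Qed.

Lemma std_normal_pdf_gt0 x : 0 < phi x.
Proof. by rewrite std_normal_pdfE mulr_gt0 ?expR_gt0 ?normal_peak_gt0 ?oner_neq0. Qed.

Lemma std_normal_pdfN x : phi (- x) = phi x.
Proof. by rewrite !std_normal_pdfE sqrrN. Qed.

Lemma is_derive_std_normal_pdf x : is_derive x 1 phi (- (x * phi x)).
Proof.
have -> : phi = (fun x => normal_peak 1 * expR (- (x ^+ 2 / 2))).
  by apply/funext => y; exact: std_normal_pdfE.
apply: is_derive_eq; by rewrite /GRing.scale/=; field.
Qed.

Lemma continuous_std_normal_pdf : continuous phi.
Proof. by apply: continuous_normal_pdf; exact: oner_neq0. Qed.

Lemma integrable_std_normal_pdf (A : set R) : measurable A ->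
  mu.-integrable A (EFin \o phi).
Proof.
by move=> mA; apply: (integrableS measurableT) => //; exact: integrable_normal_pdf.
Qed.

Definition gauss_tail x : R := \int[mu]_(y in `[x, +oo[) phi y.
Definition gauss_cdf x : R := \int[mu]_(y in `]-oo, x]) phi y.

Lemma gauss_cdfN x : gauss_cdf (- x) = gauss_tail x.
Proof.
rewrite /gauss_cdf /gauss_tail /Rintegral ge0_integration_by_substitutionNy.
- by congr fine; apply: eq_integral => y _; congr (_%:E); exact: std_normal_pdfN.
- by apply: continuous_subspaceT; exact: continuous_std_normal_pdf.
- by move=> y _; exact/ltW/std_normal_pdf_gt0.
Qed.

Lemma gauss_cdfD x : gauss_cdf x + gauss_tail x = 1.
Proof.
have := Rintegral_setU (measurable_itv `]-oo, x[) (measurable_itv `[x, +oo[)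
  (mu := mu) (f := phi).
rewrite -setCitvl setUv => /(_ (integrable_std_normal_pdf measurableT)).
rewrite disj_set2E setICr eqxx => /(_ isT) h.
rewrite /gauss_cdf /gauss_tail -[in RHS](_ : \int[mu]_y phi y = 1); last first.
  by rewrite /Rintegral integral_normal_pdf.
rewrite h; congr (_ + _).
  by rewrite -Rintegral_itv_bndo_bndc//; exact: integrable_std_normal_pdf.
by rewrite setCitvl.
Qed.

Lemma is_derive_phiV y : 0 < y ->
  is_derive y 1 (fun z => - (phi z * z^-1)) (phi y * (1 + y ^- 2)).
Proof.
move=> y0; have yn0 : y != 0 by rewrite gt_eqF.
have dV : is_derive y 1 (fun z : R => z^-1) (- y ^- 2 *: (1:R)) by exact: is_deriveV.
have dphi := is_derive_std_normal_pdf y.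
have := is_deriveN (is_deriveM dphi dV).
move/is_derive_eq; apply; rewrite /GRing.scale/=; field; exact: yn0.
Qed.

Lemma mills x : 0 < x ->
  (\int[mu]_(y in `[x, +oo[) (phi y * (1 + y ^- 2))%:E = (phi x / x)%:E)%E.
Proof.
move=> x0.
rewrite (@ge0_continuous_FTC2y _ _ (fun y => - (phi y * y^-1)) _ 0).
- by rewrite -EFinB sub0r opprK.
- move=> y xy; rewrite mulr_ge0//; first exact/ltW/std_normal_pdf_gt0.
  by rewrite addr_ge0// invr_ge0 exprn_ge0// (le_trans (ltW x0)).
- apply: continuous_in_subspaceT => y /set_mem; rewrite /= in_itv/= andbT => xy.
  have y0 : y != 0 by rewrite gt_eqF// (lt_le_trans x0).
  apply: cvgM; first exact: continuous_std_normal_pdf.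
  apply: cvgD; first exact: cvg_cst.
  apply: cvgV; first by rewrite expf_neq0.
  exact: exprn_continuous.
- apply/cvgrPdist_le => e e0; near=> y.
  have y0 : 0 < y by near: y; exact: nbhs_pinfty_gt.
  rewrite sub0r opprK ger0_norm ?divr_ge0 ?(ltW y0) ?(ltW (std_normal_pdf_gt0 _))//.
  rewrite ler_pdivrMr//; apply: le_trans (normal_pdf_ub 0 y (oner_neq0 R)) _.
  rewrite -ler_pdivrMl//; near: y; apply: nbhs_pinfty_ge; exact: num_real.
- by move=> y xy; have [] := is_derive_phiV (lt_trans x0 xy).
- apply: cvg_at_right_filter; have [d _] := is_derive_phiV x0.
  by move/derivable1_diffP/differentiable_continuous: d.
- move=> y; rewrite in_itv/= andbT => xy; rewrite derive1E.
  by have [_ ->] := is_derive_phiV (lt_trans x0 xy).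
Unshelve. all: by end_near. Qed.

Lemma gauss_tail_ge0 x : 0 <= gauss_tail x.
Proof. by apply: Rintegral_ge0 => y _; exact/ltW/std_normal_pdf_gt0. Qed.

Lemma gauss_tail_mills x : 0 < x ->
  0 <= phi x / x - gauss_tail x <= gauss_tail x / x ^+ 2.
Proof.
move=> x0.
have ip := integrable_std_normal_pdf (measurable_itv `[x, +oo[).
have mp : measurable_fun [set: measurableTypeR R] phi by exact: measurable_normal_pdf.
have mq : measurable_fun `[x, +oo[ (fun y : measurableTypeR R => phi y * y ^- 2).
  apply: measurable_funM; first exact: measurable_funTS.
  apply: subspace_continuous_measurable_fun => //.
  apply: continuous_in_subspaceT => y /set_mem; rewrite /= in_itv/= andbT => xy.
  have y0 : y != 0 by rewrite gt_eqF// (lt_le_trans x0).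
  by apply: cvgV; [rewrite expf_neq0|exact: exprn_continuous].
have y2 y : `[x, +oo[%classic y -> 0 <= y ^- 2 <= x ^- 2.
  rewrite /= in_itv/= andbT => xy; have y0 := lt_le_trans x0 xy.
  rewrite invr_ge0 exprn_ge0 ?(ltW y0)//= lef_pV2 ?posrE ?exprn_gt0//.
  by rewrite lerXn2r ?nnegrE// ltW.
have ixp : mu.-integrable `[x, +oo[ (fun y => (x ^- 2)%:E * (phi y)%:E)%E.
  exact: integrableZl.
have iq : mu.-integrable `[x, +oo[ (EFin \o (fun y => phi y * y ^- 2)).
  apply: (le_integrable _ _ _ ixp) => //; first exact/measurable_EFinP.
  move=> y xy /=; have /andP[h1 h2] := y2 y xy.
  rewrite lee_fin !normrM mulrC (ger0_norm h1) (ger0_norm (le_trans h1 h2)).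
  by rewrite ler_wpM2r.
have -> : phi x / x = \int[mu]_(y in `[x, +oo[) (phi y + phi y * y ^- 2).
  rewrite /Rintegral -[LHS]/(fine (phi x / x)%:E) -mills//; congr fine.
  by apply: eq_integral => y _; rewrite mulrDr mulr1.
rewrite RintegralD// addrAC subrr add0r; apply/andP; split.
  apply: Rintegral_ge0 => y xy; have /andP[h1 _] := y2 y xy.
  by rewrite mulr_ge0//; exact/ltW/std_normal_pdf_gt0.
rewrite /gauss_tail -RintegralZr//; apply: le_Rintegral => //.
  by apply: eq_integrable ixp => // y _ /=; rewrite -EFinM mulrC.
move=> y xy; have /andP[h1 h2] := y2 y xy.
by apply: ler_wpM2l => //; exact/ltW/std_normal_pdf_gt0.
Qed.

End gaussian_tail.

Lemma is_derive_quotient {R : realType} (u v p : R -> R) (c x du dv dp : R) :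
  p x != 0 -> is_derive x 1 u du -> is_derive x 1 v dv -> is_derive x 1 p dp ->
  is_derive x 1 (fun y => (u y - c * v y) * (p y)^-1)
    ((du - c * dv) / p x - (u x - c * v x) * dp / (p x) ^+ 2).
Proof.
move=> p0 iu iv ip.
have iV := is_deriveV p0 ip.
have := is_deriveM (is_deriveB iu (is_deriveZ c iv)) iV.
move/is_derive_eq; apply; rewrite /GRing.scale/= -[(u - c \*: v) x]/(u x - c * v x).
by move: (u x) (v x) (p x) p0 => a b q q0; field.
Qed.

Lemma is_derive_gauss_cdf {R : realType} (x : R) :
  is_derive x 1 (@gauss_cdf R) (normal_pdf 0 1 x).
Proof.
have x1 : x < x + 1 by rewrite ltrDl.
have [dP P'] := continuous_FTC1 (a := -oo%O) x1
  (integrable_std_normal_pdf (measurable_itv _)) (ltNyr _) (continuous_std_normal_pdf (x := x)).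
by split; [exact: dP|rewrite -derive1E; exact: P'].
Qed.

Lemma continuous_gauss_cdf {R : realType} : continuous (@gauss_cdf R).
Proof.
move=> x; have [d _] := is_derive_gauss_cdf x.
by move/derivable1_diffP/differentiable_continuous: d.
Qed.

Section stein_equation.
Context {R : realType}.
Local Notation mu := (@lebesgue_measure R).
Local Notation phi := (normal_pdf 0 1 : R -> R).
Variables (h : R -> R) (A L : R).
Hypotheses (A1 : 1 <= A) (L0 : 0 <= L) (h01 : forall x, 0 <= h x <= 1).
Hypotheses (hleft : forall x, x <= - A -> h x = 1) (hright : forall x, A <= x -> h x = 0).
Hypothesis hlip : forall x y, `|h x - h y| <= L * `|x - y|.

Lemma lipschitz_continuous (f : R -> R) (K : R) :
  (forall x y, `|f x - f y| <= K * `|x - y|) -> continuous f.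
Proof.
move=> fK x; apply/cvgrPdist_le => e e0; near=> y.
apply: (le_trans (fK x y)); apply: (@le_trans _ _ ((`|K| + 1) * `|x - y|)).
  by apply: ler_wpM2r => //; apply: le_trans (ler_norm _) _; rewrite lerDl.
rewrite -ler_pdivlMl//; near: y; apply: cvgr_dist_le; first exact: cvg_id.
by rewrite mulr_gt0// invr_gt0.
Unshelve. all: by end_near. Qed.

Let ch : continuous h. Proof. exact: lipschitz_continuous hlip. Qed.

Let phi_gt0 := @std_normal_pdf_gt0 R.

Definition gauss_mean : R := \int[mu]_y (h y * phi y).
Let c := gauss_mean.

Let ih (B : set R) : measurable B -> mu.-integrable B (EFin \o (fun y => h y * phi y)).
Proof.
move=> mB; apply: (le_integrable _ _ _ (integrable_std_normal_pdf mB)) => //.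
  apply/measurable_EFinP/measurable_funTS/measurable_funM.
    exact: continuous_measurable_fun.
  exact: measurable_normal_pdf.
move=> x _ /=; rewrite lee_fin normrM ler_piMl//.
by case/andP: (h01 x) => h0 h1; rewrite ger0_norm.
Qed.

Let H x : R := \int[mu]_(y in `]-oo, x]) (h y * phi y).

Lemma gauss_mean_itv : 0 <= c <= 1.
Proof.
apply/andP; split.
  apply: Rintegral_ge0 => y _; rewrite mulr_ge0 ?(ltW (phi_gt0 _))//.
  by case/andP: (h01 y).
have -> : 1 = \int[mu]_y phi y by rewrite /Rintegral integral_normal_pdf.
apply: le_Rintegral => //; [exact: ih|exact: integrable_std_normal_pdf|].
by move=> y _; rewrite ler_piMl ?(ltW (phi_gt0 _))//; case/andP: (h01 y).
Qed.

Lemma gauss_mean_bounds (a b : R) : (forall x, x <= a -> h x = 1) ->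
  (forall x, b <= x -> h x = 0) -> gauss_cdf a <= c <= gauss_cdf b.
Proof.
move=> ha hb; apply/andP; split.
  rewrite /gauss_cdf /c /gauss_mean Rintegral_mkcond; apply: le_Rintegral => //.
  - rewrite -restrict_EFin; apply: (iffLR (integrable_mkcond _ _)) => //; exact: integrable_std_normal_pdf.
  - exact: ih.
  - move=> x _; rewrite patchE; case: ifPn => [/set_mem|_].
      by rewrite /= in_itv/= => xa; rewrite ha// mul1r.
    by rewrite mulr_ge0 ?(ltW (phi_gt0 _))//; case/andP: (h01 x).
rewrite /gauss_cdf /c /gauss_mean [leRHS]Rintegral_mkcond; apply: le_Rintegral => //.
- exact: ih.
- rewrite -restrict_EFin; apply: (iffLR (integrable_mkcond _ _)) => //; exact: integrable_std_normal_pdf.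
- move=> x _; rewrite patchE; case: ifPn => [_|].
    by rewrite ler_piMl ?(ltW (phi_gt0 _))//; case/andP: (h01 x).
  rewrite notin_setE/= in_itv/= => /negP; rewrite -ltNge => bx.
  by rewrite hb ?mul0r// ltW.
Qed.

Let HR x : A <= x -> H x = c.
Proof.
move=> Ax; rewrite /H /c /gauss_mean Rintegral_mkcond; apply: eq_Rintegral => y _.
rewrite patchE; case: ifPn => //; rewrite notin_setE/= in_itv/= => /negP.
by rewrite -ltNge => xy; rewrite hright ?mul0r// (le_trans Ax)// ltW.
Qed.

Let HL x : x <= - A -> H x = gauss_cdf x.
Proof.
move=> xA; rewrite /H /gauss_cdf; apply: eq_Rintegral => y.
by rewrite inE/= in_itv/= => yx; rewrite hleft ?mul1r// (le_trans yx).
Qed.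

Definition stein_sol (x : R) : R := (H x - c * gauss_cdf x) * (phi x)^-1.
Let f := stein_sol.
Let f' x : R := h x - c + x * f x.

Lemma is_derive_stein_sol (x : R) : is_derive x 1 f (f' x).
Proof.
have x1 : x < x + 1 by rewrite ltrDl.
have cx : {for x, continuous (fun y => h y * phi y)}.
  by apply: cvgM; [exact: ch|exact: continuous_std_normal_pdf].
have [dH H'] := continuous_FTC1 (a := -oo%O) x1 (ih (measurable_itv _)) (ltNyr _) cx.
have iH : is_derive x 1 H (h x * phi x) by split; [exact: dH|rewrite -derive1E; exact: H'].
have iP := is_derive_gauss_cdf x.
have p0 : phi x != 0 by rewrite gt_eqF.
have := is_derive_quotient c p0 iH iP (is_derive_std_normal_pdf x).
move/is_derive_eq; apply; rewrite /f' /f /stein_sol.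
move: (H x) (gauss_cdf x) (phi x) p0 => u v p p0; by field.
Qed.

Let cf : continuous f.
Proof.
move=> x; have [d _] := is_derive_stein_sol x.
by move/derivable1_diffP/differentiable_continuous: d.
Qed.

Let tail_bound t : A <= t -> let m := gauss_tail t / phi t in
  [/\ 0 <= m, m <= 1 & 0 <= t * (1 - t * m) <= 1].
Proof.
move=> At m; have t1 : 1 <= t := le_trans A1 At.
have t0 : 0 < t by exact: lt_le_trans t1.
have p0 := phi_gt0 t.
have m0 : 0 <= m by rewrite divr_ge0 ?gauss_tail_ge0 ?ltW.
have /andP[h1 h2] := gauss_tail_mills t0.
have tE : gauss_tail t = m * phi t by rewrite divfK// gt_eqF.
have k1 : t * m <= 1.
  move: h1; rewrite tE subr_ge0 ler_pdivlMr// => h1.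
  by rewrite -(ler_pM2r p0) mul1r (le_trans _ h1)//; nra.
have k2 : t * (1 - t * m) <= m.
  have t2 : 0 < t ^+ 2 by rewrite exprn_gt0.
  move: h2; rewrite tE ler_pdivlMr// => h2.
  rewrite -(ler_pM2r p0) (le_trans _ h2)// le_eqVlt; apply/orP; left; apply/eqP.
  by field; rewrite gt_eqF.
have m1 : m <= 1 by nra.
by split => //; apply/andP; split; nra.
Qed.

Let tail_est x : A <= `|x| -> `|f x| <= 1 /\ `|x * f' x| <= 1.
Proof.
have /andP[c0 c1] := gauss_mean_itv.
have [x0|x0] := leP 0 x => Ax.
  rewrite ger0_norm// in Ax; have [] := tail_bound Ax; set m := _ / _ => m0 m1 /andP[k0 k1].
  have fx : f x = c * m.
    rewrite /f /stein_sol HR// /m; have := gauss_cdfD x => cdfE.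
    have -> : gauss_cdf x = 1 - gauss_tail x by rewrite -cdfE; ring.
    by ring.
  rewrite /f' hright// fx; split; first by rewrite ger0_norm; nra.
  have -> : x * (0 - c + x * (c * m)) = - (c * (x * (1 - x * m))) by ring.
  by rewrite normrN ger0_norm; nra.
rewrite ltr0_norm// in Ax; have [] := tail_bound Ax; set m := _ / _ => m0 m1 /andP[k0 k1].
have fx : f x = (1 - c) * m.
  have tE : gauss_tail (- x) = gauss_cdf x by rewrite -gauss_cdfN opprK.
  have xA : x <= - A by rewrite lerNr.
  rewrite /f /stein_sol (HL xA) /m tE (std_normal_pdfN x).
  by move: (gauss_cdf x) (phi x) => u p; ring.
have xA : x <= - A by rewrite lerNr.
have c0' : 0 <= 1 - c by rewrite subr_ge0.
have c1' : 1 - c <= 1 by rewrite gerBl.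
rewrite /f' (hleft xA) fx; split.
  by rewrite ger0_norm; [exact: mulr_ile1|exact: mulr_ge0].
have -> : x * (1 - c + x * ((1 - c) * m)) = - ((1 - c) * (- x * (1 - - x * m))) by ring.
by rewrite normrN ger0_norm; [exact: mulr_ile1|exact: mulr_ge0].
Qed.

Lemma stein_solution : exists (f f' : R -> R) (K : R),
  [/\ 0 <= K, (forall x : R, is_derive x 1 f (f' x)),
      (forall x y, `|f' x - f' y| <= K * `|x - y|), (forall x, `|f x| <= K) &
      forall x, f' x - x * f x = h x - c].
Proof.
have /andP[c0 c1] := gauss_mean_itv.
have A0 : 0 <= A by exact: le_trans A1.
have [F0 [F00 hF0]] : exists F0, 0 <= F0 /\ forall x, `|x| <= A -> `|f x| <= F0.
  have [||z _ zmax] := @EVT_max R (fun x => `|f x|) (- A) A.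
  - by rewrite ge0_cp.
  - apply: continuous_subspaceT => x; apply: cvg_norm; exact: cf.
  - by exists `|f z|; split => // x; rewrite ler_norml => xA; apply: zmax; rewrite in_itv.
pose K1 : R := 2 + F0 + A * (1 + A * F0).
have K10 : 0 <= K1 by rewrite /K1; nra.
have G' x : `|f x + x * f' x| <= K1.
  apply: le_trans (ler_normD _ _) _.
  have [Ax|xA] := leP A `|x|.
    by have [h1 h2] := tail_est Ax; rewrite /K1; nra.
  have fx := hF0 _ (ltW xA).
  have : `|f' x| <= 1 + A * F0.
    apply: le_trans (ler_normD _ _) _; rewrite normrM.
    have : `|h x - c| <= 1.
      by have /andP[a b] := h01 x; rewrite ler_norml; apply/andP; split; lra.
    by have := normr_ge0 x; have := normr_ge0 (f x); nra.
  move=> f'b; rewrite (normrM x (f' x)).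
  have := ler_pM (normr_ge0 x) (normr_ge0 (f' x)) (ltW xA) f'b.
  by rewrite /K1; lra.
have dG (x : R) : is_derive x 1 (fun y => y * f y) (f x + x * f' x).
  have := is_deriveM (is_derive_id (x : R^o) (1 : R^o)) (is_derive_stein_sol x).
  by move/is_derive_eq; apply; rewrite /GRing.scale/= mulr1 addrC.
have Glip x y : `|y * f y - x * f x| <= K1 * `|y - x|.
  wlog xy : x y / x <= y.
    move=> hw; have [/hw//|/ltW/hw] := leP x y.
    by rewrite distrC (distrC y).
  have [|z _ ->] := MVT_segment xy (fun z _ => dG z).
    apply: continuous_subspaceT => z; apply: cvgM; [exact: cvg_id|exact: cf].
  by rewrite normrM ler_wpM2r.
clearbody K1; exists f, f', (L + K1 + 1 + F0); split.
- by rewrite !addr_ge0.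
- exact: is_derive_stein_sol.
- move=> x y; have -> : f' x - f' y = (h x - h y) + (x * f x - y * f y).
    by rewrite /f'; ring.
  apply: le_trans (ler_normD _ _) _.
  have := hlip x y; have := Glip y x; have := normr_ge0 (x - y); nra.
- move=> x; have [Ax|xA] := leP A `|x|.
    have [h1 _] := tail_est Ax; apply: (le_trans h1).
    by rewrite -addrA (addrC 1) addrA lerDr !addr_ge0.
  by apply: le_trans (hF0 x (ltW xA)) _; rewrite lerDr !addr_ge0.
- by move=> x; rewrite /f'; ring.
Qed.

End stein_equation.

Section size_bias.
Context d (T : measurableType d) {R : realType} (P : probability T R).
Local Notation D := (`]0%R, +oo[%classic : set R).

(* This identity says that the nonnegative variable [X] is infinitely divisible,
   without drift, with Levy density [g]. *)
Definition size_biased (g : R -> R) (X : T -> R) : Prop :=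
  forall (f : R -> R) (B : R), continuous f -> (forall x, 0 <= f x <= B) ->
    (\int[P]_w (X w * f (X w))%:E =
     \int[leb]_(x in D) ((x * g x)%:E * \int[P]_w (f (x + X w))%:E))%E.

Variables (g : R -> R) (X : T -> R).
Hypotheses (mg : measurable_fun [set: R] g) (g0 : forall x, 0 <= g x).
Hypotheses (mX : measurable_fun [set: T] X) (X0 : forall w, 0 <= X w).
Hypothesis SI : size_biased g X.
Variables (m1 s2 s3 : R).
Hypotheses (m1E : (\int[leb]_(x in D) (x * g x)%:E = m1%:E)%E)
  (s2E : (\int[leb]_(x in D) (x ^+ 2 * g x)%:E = s2%:E)%E).

Let mD : measurable D. Proof. by []. Qed.

Let D0 x : D x -> 0 < x. Proof. by rewrite /= in_itv/= andbT. Qed.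

Let mxg k : measurable_fun D (fun x => (x ^+ k * g x)%:E).
Proof. by apply: measurable_funTS; mfun. Qed.

Lemma size_biased_mean : (\int[P]_w (X w)%:E = m1%:E)%E.
Proof.
have c1 : continuous (fun _ : R => 1 : R) by move=> x; exact: cvg_cst.
have := SI c1 (fun=> ltac:(by rewrite ler01 lexx) : 0 <= 1 <= (1 : R)).
under eq_integral do rewrite mulr1.
by move=> ->; rewrite -m1E; apply: eq_integral => x _; rewrite probability_integral_cst mule1.
Qed.

Lemma size_biased_second_moment : (\int[P]_w (X w ^+ 2)%:E = (m1 ^+ 2 + s2)%:E)%E.
Proof.
pose F (n : nat) (x : R) := Num.min `|x| n%:R.
have cF n : continuous (F n).
  move=> x; apply: (@continuous_min _ _ (fun x => `|x|) (fun=> n%:R)).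
    exact: norm_continuous.
  exact: cst_continuous.
have F0 n x : 0 <= F n x <= n%:R by rewrite /F le_min normr_ge0 ler0n ge_min lexx orbT.
have mF n : measurable_fun [set: R] (F n) by exact: continuous_measurable_fun.
have F_nd x : nondecreasing_seq (F ^~ x).
  by move=> a b ab; rewrite /F le_min ge_min lexx/= ge_min ler_nat ab orbT.
have F_cvg x : 0 <= x -> F n x @[n --> \oo] --> x.
  move=> x0; apply: cvg_near_cst; near=> n; rewrite /F ger0_norm//; apply/min_idPl.
  by near: n; exact: nbhs_infty_ger.
have mFX n : measurable_fun [set: T] (fun w => F n (X w)) by exact: measurableT_comp.
have mFxX n x : measurable_fun [set: T] (fun w => F n (x + X w)).
  by apply: measurableT_comp => //; exact: measurable_funD.
have l1 : (\int[P]_w (X w * F n (X w))%:E)%E @[n --> \oo] --> (\int[P]_w (X w ^+ 2)%:E)%E.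
  have -> : (\int[P]_w (X w ^+ 2)%:E = \int[P]_w (limn (fun n => (X w * F n (X w))%:E)))%E.
    apply: eq_integral => w _; apply/esym/cvg_lim => //; apply: cvg_seq_EFin.
    by rewrite expr2; apply: cvgMr; exact: F_cvg.
  apply: cvg_monotone_convergence => //.
  - by move=> n; apply/measurable_EFinP; exact: measurable_funM.
  - by move=> n w _; rewrite lee_fin mulr_ge0//; case/andP: (F0 n (X w)).
  - by move=> w _ a b ab; rewrite lee_fin ler_wpM2l//; exact: F_nd.
have mI n : measurable_fun [set: R] (fun x => \int[P]_w (F n (x + X w))%:E)%E.
  have mX2 : measurable_fun [set: R * T] (fun z => X z.2).
    by apply: (measurableT_comp mX); exact: measurable_snd.
  have m2 : measurable_fun [set: R * T] (fun z => (F n (z.1 + X z.2))%:E).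
    by apply/measurable_EFinP; apply: (measurableT_comp (mF n)); apply: measurable_funD.
  apply: (measurable_fun_fubini_tonelli_F (m2 := P) _ m2) => z.
  by rewrite lee_fin; case/andP: (F0 n (z.1 + X z.2)).
have l2 : (\int[leb]_(x in D) ((x * g x)%:E * \int[P]_w (F n (x + X w))%:E))%E @[n --> \oo]
    --> (m1 ^+ 2 + s2)%:E.
  have -> : ((m1 ^+ 2 + s2)%:E = \int[leb]_(x in D)
      (limn (fun n => (x * g x)%:E * \int[P]_w (F n (x + X w))%:E)))%E.
    transitivity (\int[leb]_(x in D) ((x * g x)%:E * (x + m1)%:E))%E.
      have -> : ((m1 ^+ 2 + s2)%:E = \int[leb]_(x in D) (x ^+ 2 * g x)%:E +
          \int[leb]_(x in D) (m1%:E * (x * g x)%:E))%E.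
        rewrite s2E ge0_integralZl//.
        - by rewrite m1E -EFinM -EFinD addrC -expr2.
        - exact: (mxg 1).
        - by move=> x /D0/ltW x0; rewrite lee_fin mulr_ge0.
        - by rewrite -m1E integral_ge0// => x /D0/ltW x0; rewrite lee_fin mulr_ge0.
      rewrite -ge0_integralD//.
      - by apply: eq_integral => x _; rewrite -!EFinM -EFinD; congr (_%:E); ring.
      - by move=> x /D0/ltW x0; rewrite lee_fin mulr_ge0// sqr_ge0.
      - move=> x /D0/ltW x0; rewrite mule_ge0// ?lee_fin ?mulr_ge0//.
        by rewrite -lee_fin -m1E integral_ge0// => y /D0/ltW y0; rewrite lee_fin mulr_ge0.
      - by apply: emeasurable_funM => //; exact: (mxg 1).
    apply: eq_integral => x /set_mem /D0 x0; apply/esym/cvg_lim => //.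
    apply: cvgeZl => //.
    have -> : ((x + m1)%:E = \int[P]_w (limn (fun n => (F n (x + X w))%:E)))%E.
      transitivity (\int[P]_w (x%:E + (X w)%:E))%E.
        rewrite ge0_integralD//.
        - by rewrite probability_integral_cst size_biased_mean.
        - by move=> w _; rewrite lee_fin ltW.
        - by move=> w _; rewrite lee_fin.
        - exact/measurable_EFinP.
      apply: eq_integral => w _; apply/esym/cvg_lim => //; rewrite -EFinD.
      by apply: cvg_seq_EFin; apply: F_cvg; rewrite addr_ge0// ltW.
    apply: cvg_monotone_convergence => //.
    - by move=> n; apply/measurable_EFinP.
    - by move=> n w _; rewrite lee_fin; case/andP: (F0 n (x + X w)).
    - by move=> w _ a b ab; rewrite lee_fin; exact: F_nd.
  apply: cvg_monotone_convergence => //.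
  - by move=> n; apply: emeasurable_funM; [exact: (mxg 1)|exact: measurable_funTS].
  - move=> n x /D0/ltW x0; rewrite mule_ge0 ?lee_fin ?mulr_ge0// integral_ge0// => w _.
    by rewrite lee_fin; case/andP: (F0 n (x + X w)).
  - move=> x /D0/ltW x0 a b ab; apply: lee_wpmul2l; first by rewrite lee_fin mulr_ge0.
    apply: ge0_le_integral => //.
    + by move=> w _; rewrite lee_fin; case/andP: (F0 a (x + X w)).
    + exact/measurable_EFinP.
    + exact/measurable_EFinP.
    + by move=> w _; rewrite lee_fin; exact: F_nd.
apply: (cvg_unique _ l1) => //; apply: cvg_trans l2; apply: near_eq_cvg; near=> n.
by rewrite (SI (cF n) (F0 n)).
Unshelve. all: by end_near. Qed.

End size_bias.

Section stein_bound.
Context d (T : measurableType d) {R : realType} (P : probability T R).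
Local Notation D := (`]0%R, +oo[%classic : set R).

Lemma integrable_bounded (Z : T -> R) (B : R) : measurable_fun [set: T] Z ->
  (forall w, `|Z w| <= B) -> P.-integrable [set: T] (EFin \o Z).
Proof.
move=> mZ ZB.
have iB : P.-integrable [set: T] (fun=> B%:E) by exact: finite_measure_integrable_cst.
apply: (le_integrable _ _ _ iB) => //.
  exact/measurable_EFinP.
by move=> w _ /=; rewrite lee_fin; apply: le_trans (ZB w) (ler_norm _).
Qed.

Lemma normr_Rintegral_le (Z : T -> R) (B : R) : measurable_fun [set: T] Z ->
  (forall w, `|Z w| <= B) -> `|\int[P]_w Z w| <= B.
Proof.
move=> mZ ZB; have iZ := integrable_bounded mZ ZB.
apply: le_trans (le_normr_Rintegral _ iZ) _ => //.
have -> : B = \int[P]_w B by rewrite Rintegral_cst// [X in fine X](@probability_setT _ _ _ P) mulr1.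
apply: le_Rintegral => //; first exact: integrable_norm.
exact: finite_measure_integrable_cst.
Qed.

Variables (g : R -> R) (X : T -> R).
Hypotheses (mg : measurable_fun [set: R] g) (g0 : forall x, 0 <= g x).
Hypotheses (mX : measurable_fun [set: T] X) (X0 : forall w, 0 <= X w).
Hypothesis SI : size_biased P g X.
Variables (m1 s3 sigma : R).
Hypotheses (m1E : (\int[leb]_(x in D) (x * g x)%:E = m1%:E)%E)
  (s2E : (\int[leb]_(x in D) (x ^+ 2 * g x)%:E = (sigma ^+ 2)%:E)%E)
  (s3E : (\int[leb]_(x in D) (x ^+ 3 * g x)%:E = s3%:E)%E)
  (sigma0 : 0 < sigma).
Variables (f f' : R -> R) (K : R).
Hypotheses (K0 : 0 <= K) (df : forall x : R, is_derive x 1 f (f' x))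
  (f'lip : forall x y, `|f' x - f' y| <= K * `|x - y|) (fK : forall x, `|f x| <= K).

Let mD : measurable D. Proof. by []. Qed.
Let D0 x : D x -> 0 < x. Proof. by rewrite /= in_itv/= andbT. Qed.
Let cf : continuous f.
Proof.
move=> x; have [dfx _] := df x.
by move/derivable1_diffP/differentiable_continuous: dfx.
Qed.
Let mf : measurable_fun [set: R] f. Proof. exact: continuous_measurable_fun. Qed.
Let mf' : measurable_fun [set: R] f'.
Proof. by apply: continuous_measurable_fun; exact: lipschitz_continuous f'lip. Qed.

Let Xs w := (X w - m1) / sigma.
Let mXs : measurable_fun [set: T] Xs.
Proof. by apply: measurable_funM => //; exact: measurable_funB. Qed.

Let Fx x w := f ((x + X w - m1) / sigma).
Let mFx x : measurable_fun [set: T] (Fx x).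
Proof.
apply: measurableT_comp => //; apply: measurable_funM => //; apply: measurable_funB => //.
exact: measurable_funD.
Qed.
Let iFx x : P.-integrable [set: T] (EFin \o Fx x).
Proof. exact: integrable_bounded (mFx x) (fun w => fK _). Qed.
Let eF x := \int[P]_w Fx x w.

Lemma taylor_lipschitz y t : 0 <= t -> `|f (y + t) - f y - t * f' y| <= K * t ^+ 2.
Proof.
move=> t0; have yt : y <= y + t by rewrite lerDl.
have [|z + ->] := MVT_segment yt (fun z _ => df z); first exact: continuous_subspaceT.
rewrite in_itv/= addrAC subrr add0r => /andP[yz zt].
rewrite mulrC -mulrBr normrM ger0_norm//.
have h1 : `|f' z - f' y| <= K * t.
  apply: le_trans (f'lip z y) _; rewrite ler_wpM2l// ger0_norm ?subr_ge0//.
  by rewrite lerBlDl.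
by rewrite expr2 (mulrCA K) ler_wpM2l.
Qed.

Let iX : P.-integrable [set: T] (EFin \o X).
Proof.
apply/integrableP; split; first exact/measurable_EFinP.
under eq_integral => w _ do rewrite /= ger0_norm//.
by rewrite /= (size_biased_mean SI m1E) ltry.
Qed.

Let iXs : P.-integrable [set: T] (EFin \o Xs).
Proof.
have -> : EFin \o Xs = (fun w => (sigma^-1)%:E * ((X w)%:E - m1%:E))%E.
  by apply/funext => w; rewrite /= -EFinB -EFinM mulrC.
apply: integrableZl => //; apply: integrableB => //.
exact: finite_measure_integrable_cst.
Qed.

Let if' : P.-integrable [set: T] (EFin \o (fun w => f' (Xs w))).
Proof.
have i1 : P.-integrable [set: T] (fun w => `|f' 0|%:E + K%:E * `|(Xs w)%:E|)%E.
  apply: integrableD => //; first exact: finite_measure_integrable_cst.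
  by apply: integrableZl => //; exact: integrable_abse.
apply: (le_integrable _ _ _ i1) => //.
  by apply/measurable_EFinP; exact: measurableT_comp.
move=> w _ /=; rewrite lee_fin.
apply: le_trans (ler_norm _); have := f'lip (Xs w) 0; rewrite subr0 => h.
rewrite -[f' (Xs w)](subrK (f' 0)); apply: le_trans (ler_normD _ _) _.
by rewrite [leRHS]addrC lerD2r.
Qed.

Let e1 := \int[P]_w f' (Xs w).

Let eF_le x : `|eF x| <= K.
Proof. by apply: normr_Rintegral_le => [|w]; [exact: mFx|exact: fK]. Qed.

Let eF_taylor x : 0 < x -> `|eF x - eF 0 - x / sigma * e1| <= K * (x / sigma) ^+ 2.
Proof.
move=> x0; rewrite /eF /e1.
rewrite -RintegralZl// -RintegralB//.
have iF : P.-integrable [set: T] (EFin \o (fun w => Fx x w - Fx 0 w)).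
  rewrite (_ : _ \o _ = (fun w => (Fx x w)%:E - (Fx 0 w)%:E)%E); last by apply/funext.
  by apply: integrableB => //; exact: iFx.
have iF' : P.-integrable [set: T] (EFin \o (fun w => x / sigma * f' (Xs w))).
  rewrite (_ : _ \o _ = (fun w => (x / sigma)%:E * (f' (Xs w))%:E)%E); last first.
    by apply/funext => w; rewrite /= EFinM.
  exact: integrableZl.
rewrite -RintegralB//; apply: normr_Rintegral_le.
  apply: measurable_funB; first exact: measurable_funB.
  by apply: measurable_funM => //; exact: measurableT_comp.
move=> w; have -> : Fx x w = f (Xs w + x / sigma) by rewrite /Fx /Xs -mulrDl; congr (f (_ / _)); ring.
have -> : Fx 0 w = f (Xs w) by rewrite /Fx add0r.
by apply: taylor_lipschitz; rewrite divr_ge0// ltW.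
Qed.

Let G x := (\int[P]_w (Fx x w + K)%:E)%E.

Let GE x : G x = (eF x + K)%:E.
Proof.
rewrite /G /eF; have iF := iFx x.
rewrite EFinD /Rintegral fineK; last exact: integrable_fin_num.
transitivity (\int[P]_w ((Fx x w)%:E + K%:E))%E; first exact: eq_integral.
rewrite integralD//; last exact: finite_measure_integrable_cst.
by rewrite probability_integral_cst.
Qed.

Let meF : measurable_fun [set: R] eF.
Proof.
have mG : measurable_fun [set: R] G.
  have mX2 : measurable_fun [set: R * T] (fun z => X z.2).
    by apply: (measurableT_comp mX); exact: measurable_snd.
  have m2 : measurable_fun [set: R * T] (fun z => (Fx z.1 z.2 + K)%:E).
    apply/measurable_EFinP; apply: measurable_funD => //.
    apply: (measurableT_comp mf); apply: measurable_funM => //.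
    by apply: measurable_funB => //; apply: measurable_funD.
  apply: (measurable_fun_fubini_tonelli_F (m2 := P) _ m2) => z.
  by rewrite lee_fin -lerBlDr sub0r; have := fK ((z.1 + X z.2 - m1) / sigma); rewrite ler_norml => /andP[].
rewrite (_ : eF = (fun x => fine (G x) - K)); last first.
  by apply/funext => x; rewrite GE /= addrK.
by apply: measurable_funB => //; apply: measurableT_comp => //; exact: fine_measurable.
Qed.

Let ixg k c : (\int[leb]_(x in D) (x ^+ k * g x)%:E = c%:E)%E ->
  leb.-integrable D (EFin \o (fun x => x ^+ k * g x)).
Proof.
move=> kE; apply/integrableP; split; first by apply/measurable_EFinP; apply: measurable_funTS; mfun.
apply: (@le_lt_trans _ _ c%:E); last by rewrite ltry.
rewrite -kE le_eqVlt; apply/orP; left; apply/eqP; apply: eq_integral => x /set_mem /D0 x0.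
by congr (_%:E); rewrite ger0_norm// mulr_ge0// exprn_ge0// ltW.
Qed.

Let i1 : leb.-integrable D (EFin \o (fun x => x * g x)). Proof. exact: (ixg (k := 1) m1E). Qed.

Let ixgeF : leb.-integrable D (EFin \o (fun x => x * g x * eF x)).
Proof.
have i2 : leb.-integrable D (fun x => K%:E * (x * g x)%:E)%E by exact: integrableZl.
apply: (le_integrable _ _ _ i2) => //.
  by apply/measurable_EFinP; apply: measurable_funTS; apply: measurable_funM => //; mfun.
move=> x Dx /=; rewrite lee_fin normrM [leRHS]normrM (ger0_norm K0) mulrC.
by apply: ler_wpM2r.
Qed.

Let size_bias_bounded : \int[P]_w (X w * Fx 0 w) = \int[leb]_(x in D) (x * g x * eF x).
Proof.
have cF : continuous (fun y => f ((y - m1) / sigma) + K).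
  move=> y; apply: cvgD; last exact: cvg_cst.
  apply: continuous_cvg; first exact: cf.
  by apply: cvgMl; apply: cvgB; [exact: cvg_id|exact: cvg_cst].
have FK y : 0 <= f ((y - m1) / sigma) + K <= K + K.
  have := fK ((y - m1) / sigma); rewrite ler_norml => /andP[a b].
  by apply/andP; split; lra.
have := congr1 fine (SI cF FK).
have -> : fine (\int[P]_w (X w * (f ((X w - m1) / sigma) + K))%:E)%E =
    \int[P]_w (X w * Fx 0 w) + K * m1.
  have iXF : P.-integrable [set: T] (EFin \o (fun w => X w * Fx 0 w)).
    have i2 : P.-integrable [set: T] (fun w => K%:E * (X w)%:E)%E by exact: integrableZl.
    apply: (le_integrable _ _ _ i2) => //.
      by apply/measurable_EFinP; exact: measurable_funM.
    by move=> w _ /=; rewrite lee_fin normrM [leRHS]normrM (ger0_norm K0) mulrC;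
      apply: ler_wpM2r => //; exact: fK.
  have m1R : m1 = \int[P]_w X w by rewrite /Rintegral (size_biased_mean SI m1E).
  rewrite {2}m1R -RintegralZl// -RintegralD//; last first.
    by rewrite (_ : _ \o _ = (fun w => K%:E * (X w)%:E)%E)//; exact: integrableZl.
  by congr fine; apply: eq_integral => w _; rewrite /Fx add0r mulrDr (mulrC K).
have -> : fine (\int[leb]_(x in D) ((x * g x)%:E * \int[P]_w (f ((x + X w - m1) / sigma) + K)%:E))%E =
    \int[leb]_(x in D) (x * g x * eF x) + K * m1.
  have m1R : m1 = \int[leb]_(x in D) (x * g x) by rewrite /Rintegral m1E.
  rewrite {2}m1R -RintegralZl// -RintegralD//; last first.
    by rewrite (_ : _ \o _ = (fun x => K%:E * (x * g x)%:E)%E)//; exact: integrableZl.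
  congr fine; apply: eq_integral => x _; rewrite [X in (_ * X)%E]GE -EFinM.
  by congr (_%:E); ring.
exact: addIr.
Qed.

(* By the size-bias identity, the mean of [X f(X)] is compared with that of
   [f'] through a first order expansion of [f] in the jump [x], of error [x ^ 2];
   weighted by [x * g x], this error is the third cumulant [s3]. *)
Lemma stein_discrepancy :
  `|\int[P]_w (f' (Xs w) - Xs w * f (Xs w))| <= K * s3 / sigma ^+ 3.
Proof.
have sn0 : sigma != 0 by rewrite gt_eqF.
have iXsf : P.-integrable [set: T] (EFin \o (fun w => Xs w * f (Xs w))).
  have i2 : P.-integrable [set: T] (fun w => K%:E * (Xs w)%:E)%E by exact: integrableZl.
  apply: (le_integrable _ _ _ i2) => //.
    by apply/measurable_EFinP; apply: measurable_funM => //; exact: measurableT_comp.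
  by move=> w _ /=; rewrite lee_fin normrM [leRHS]normrM (ger0_norm K0) mulrC;
      apply: ler_wpM2r => //; exact: fK.
rewrite RintegralB// -/e1.
have E2 : sigma * \int[P]_w (Xs w * f (Xs w)) =
    \int[leb]_(x in D) (x * g x * eF x) - m1 * eF 0.
  rewrite -size_bias_bounded /eF -!RintegralZl//.
  rewrite -RintegralB//.
  - apply: eq_Rintegral => w _; rewrite /Fx add0r -/(Xs w) -mulrBl mulrA.
    by congr (_ * _); rewrite /Xs mulrC divfK.
  - have i2 : P.-integrable [set: T] (fun w => K%:E * (X w)%:E)%E by exact: integrableZl.
    apply: (le_integrable _ _ _ i2) => //.
      by apply/measurable_EFinP; exact: measurable_funM.
    by move=> w _ /=; rewrite lee_fin normrM [leRHS]normrM (ger0_norm K0) mulrC;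
      apply: ler_wpM2r => //; exact: fK.
  - rewrite (_ : _ \o _ = (fun w => m1%:E * (Fx 0 w)%:E)%E)//.
    by apply: integrableZl => //; exact: iFx.
have i2 := ixg s2E.
have i3 := ixg s3E.
have key : `|\int[leb]_(x in D) (x * g x * eF x) - m1 * eF 0 - sigma * e1| <= K / sigma ^+ 2 * s3.
  have m1R : m1 = \int[leb]_(x in D) (x * g x) by rewrite /Rintegral m1E.
  have s2R : sigma * e1 = \int[leb]_(x in D) (x ^+ 2 * g x * (e1 / sigma)).
    by rewrite RintegralZr// /Rintegral s2E/=; field.
  have s3R : s3 = \int[leb]_(x in D) (x ^+ 3 * g x) by rewrite /Rintegral s3E.
  have j1 : leb.-integrable D (EFin \o (fun x => x * g x * eF 0)).
    rewrite (_ : _ \o _ = (fun x => (x * g x)%:E * (eF 0)%:E)%E)//.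
    exact: integrableZr.
  have j2 : leb.-integrable D (EFin \o (fun x => x ^+ 2 * g x * (e1 / sigma))).
    rewrite (_ : _ \o _ = (fun x => (x ^+ 2 * g x)%:E * (e1 / sigma)%:E)%E)//.
    exact: integrableZr.
  have j3 : leb.-integrable D (EFin \o (fun x => K / sigma ^+ 2 * (x ^+ 3 * g x))).
    rewrite (_ : _ \o _ = (fun x => (K / sigma ^+ 2)%:E * (x ^+ 3 * g x)%:E)%E)//.
    exact: integrableZl.
  have j12 : leb.-integrable D (EFin \o (fun x => x * g x * eF x - x * g x * eF 0)).
    rewrite (_ : _ \o _ = (fun x => (x * g x * eF x)%:E - (x * g x * eF 0)%:E)%E)//.
    exact: integrableB.
  have j123 : leb.-integrable D (EFin \o (fun x => x * g x * eF x - x * g x * eF 0 -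
      x ^+ 2 * g x * (e1 / sigma))).
    rewrite (_ : _ \o _ = (fun x => (x * g x * eF x - x * g x * eF 0)%:E -
      (x ^+ 2 * g x * (e1 / sigma))%:E)%E)//.
    exact: integrableB.
  rewrite s2R {1}m1R -RintegralZr// -RintegralB// -RintegralB//.
  rewrite s3R -RintegralZl//.
  apply: le_trans (le_normr_Rintegral _ j123) _ => //.
  apply: le_Rintegral => //; first exact: integrable_norm.
  move=> x /D0 x0.
  have -> : x * g x * eF x - x * g x * eF 0 - x ^+ 2 * g x * (e1 / sigma) =
      x * g x * (eF x - eF 0 - x / sigma * e1) by field.
  have xg0 : 0 <= x * g x by rewrite mulr_ge0// ltW.
  rewrite normrM (ger0_norm xg0).
  apply: le_trans (ler_wpM2l xg0 (eF_taylor x0)) _.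
  by rewrite le_eqVlt; apply/orP; left; apply/eqP; field.
rewrite -(ler_pM2l sigma0) -{1}(gtr0_norm sigma0) -normrM mulrBr E2 distrC.
apply: le_trans key _; rewrite le_eqVlt; apply/orP; left; apply/eqP; by field.
Qed.

End stein_bound.

Section ramp.
Context {R : realType}.

Definition ramp (a dlt y : R) : R := Num.max 0 (Num.min 1 ((a + dlt - y) / dlt)).

Variables (a dlt : R).
Hypothesis dlt0 : 0 < dlt.

Lemma ramp_itv y : 0 <= ramp a dlt y <= 1.
Proof. by rewrite /ramp le_max lexx ge_max ler01 ge_min lexx. Qed.

Lemma ramp_left y : y <= a -> ramp a dlt y = 1.
Proof.
move=> ya; have h : 1 <= (a + dlt - y) / dlt by rewrite ler_pdivlMr// mul1r; lra.
by rewrite /ramp (min_idPl h); apply/max_idPr.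
Qed.

Lemma ramp_right y : a + dlt <= y -> ramp a dlt y = 0.
Proof.
move=> ya; have h : (a + dlt - y) / dlt <= 0.
  by rewrite pmulr_lle0 ?invr_gt0// subr_le0.
by rewrite /ramp; apply/max_idPl; rewrite ge_min h orbT.
Qed.

Lemma ramp_lipschitz y z : `|ramp a dlt y - ramp a dlt z| <= dlt^-1 * `|y - z|.
Proof.
have clamp (u v : R) : `|Num.max 0 (Num.min 1 u) - Num.max 0 (Num.min 1 v)| <= `|u - v|.
  wlog uv : u v / u <= v.
    by move=> hw; have [/hw//|/ltW/hw] := leP u v; rewrite distrC (distrC v).
  rewrite distrC [leRHS]distrC (ger0_norm (_ : 0 <= v - u)) ?subr_ge0//.
  have [v1|v1] := leP 1 v; have [u1|u1] := leP 1 u; rewrite ler_norml.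
  - by rewrite subrr; apply/andP; split; lra.
  - by have [u0|u0] := leP 0 u; rewrite !maxEle ler01; apply/andP; split; lra.
  - by exfalso; lra.
  - by have [u0|u0] := leP 0 u; have [v0|v0] := leP 0 v; apply/andP; split; lra.
apply: le_trans (clamp _ _) _; rewrite -mulrBl.
have -> : a + dlt - y - (a + dlt - z) = - (y - z) by ring.
by rewrite normrM normrN mulrC gtr0_norm ?invr_gt0.
Qed.

End ramp.

Section clt.
Context d (T : measurableType d) {R : realType} (P : probability T R).
Local Notation D := (`]0%R, +oo[%classic : set R).
Variables (g : R -> R -> R) (X : R -> T -> R) (m s3 sigma : R -> R).
Hypotheses (mg : forall L, 0 < L -> measurable_fun [set: R] (g L))
  (g0 : forall L, 0 < L -> forall x, 0 <= g L x)
  (mX : forall L, 0 < L -> measurable_fun [set: T] (X L))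
  (X0 : forall L, 0 < L -> forall w, 0 <= X L w)
  (SI : forall L, 0 < L -> size_biased P (g L) (X L))
  (mE : forall L, 0 < L -> (\int[leb]_(x in D) (x * g L x)%:E = (m L)%:E)%E)
  (s2E : forall L, 0 < L -> (\int[leb]_(x in D) (x ^+ 2 * g L x)%:E = (sigma L ^+ 2)%:E)%E)
  (s3E : forall L, 0 < L -> (\int[leb]_(x in D) (x ^+ 3 * g L x)%:E = (s3 L)%:E)%E)
  (sigma0 : forall L, 0 < L -> 0 < sigma L)
  (lyapunov : s3 L / sigma L ^+ 3 @[L --> +oo] --> (0 : R)).

Let Xs L w := (X L w - m L) / sigma L.

Let mXs L : 0 < L -> measurable_fun [set: T] (Xs L).
Proof. by move=> L0; apply: measurable_funM => //; apply: measurable_funB => //; exact: mX. Qed.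

Lemma ramp_mean_cvg (a dlt e : R) : 0 < dlt -> 0 < e -> \forall L \near +oo,
  `|\int[P]_w ramp a dlt (Xs L w) - gauss_mean (ramp a dlt)| <= e.
Proof.
move=> d0 e0.
pose A := Num.max 1 (`|a| + dlt).
have A1 : 1 <= A by rewrite le_max lexx.
have Aa : `|a| + dlt <= A by rewrite le_max lexx orbT.
have hl x : x <= - A -> ramp a dlt x = 1.
  by move=> xA; apply: ramp_left => //; have := ler_norm (- a); rewrite normrN; lra.
have hr x : A <= x -> ramp a dlt x = 0.
  by move=> xA; apply: ramp_right => //; have := ler_norm a; lra.
have di0 : 0 <= dlt^-1 by rewrite invr_ge0 ltW.
have [f [f' [K [K0 df f'lip fK fE]]]] :=
  stein_solution A1 di0 (ramp_itv a dlt) hl hr (ramp_lipschitz a d0).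
have K1 : 0 < K + 1 by rewrite ltr_wpDl.
near=> L.
have L0 : 0 < L by near: L; exact: nbhs_pinfty_gt.
have := stein_discrepancy (mg L0) (g0 L0) (mX L0) (X0 L0) (SI L0) (mE L0) (s2E L0)
  (s3E L0) (sigma0 L0) K0 df f'lip fK.
have mr : measurable_fun [set: T] (fun w => ramp a dlt (Xs L w)).
  apply: measurableT_comp; last exact: mXs.
  by apply: continuous_measurable_fun; exact: lipschitz_continuous (ramp_lipschitz a d0).
have -> : \int[P]_w (f' ((X L w - m L) / sigma L) - (X L w - m L) / sigma L * f ((X L w - m L) / sigma L))
    = \int[P]_w ramp a dlt (Xs L w) - gauss_mean (ramp a dlt).
  under eq_Rintegral do rewrite fE.
  rewrite RintegralB//.
  - by rewrite Rintegral_cst// [X in fine X](@probability_setT _ _ _ P) mulr1.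
  - apply: (@integrable_bounded _ _ _ P _ 1) => // w.
    by have /andP[r0 r1] := ramp_itv a dlt (Xs L w); rewrite ger0_norm.
  - exact: finite_measure_integrable_cst.
move/le_trans; apply.
have : `|s3 L / sigma L ^+ 3| <= e / (K + 1).
  near: L; apply: cvgr0_norm_le; first exact: lyapunov.
  by rewrite divr_gt0.
rewrite ler_pdivlMr// => h; rewrite -mulrA.
have h2 := ler_norm (s3 L / sigma L ^+ 3).
apply: (@le_trans _ _ (K * `|s3 L / sigma L ^+ 3|)); first exact: ler_wpM2l.
by apply: le_trans h; rewrite mulrC ler_wpM2l// lerDl.
Unshelve. all: by end_near. Qed.

Lemma lyapunov_clt x : fine (P [set w | Xs L w <= x]) @[L --> +oo] -->
  fine (normal_prob 0 1 `]-oo, x]%classic).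
Proof.
rewrite -[fine (normal_prob _ _ _)]/(gauss_cdf x).
apply/cvgrPdist_le => e e0.
have e2 : 0 < e / 2 by rewrite divr_gt0.
have /cvgrPdist_le /(_ _ e2) [dlt /= dlt0 hd] := @continuous_gauss_cdf R x.
pose r := dlt / 2.
have r0 : 0 < r by rewrite divr_gt0.
have near1 : `|gauss_cdf x - gauss_cdf (x + r)| <= e / 2.
  by apply: hd => /=; rewrite opprD addrA subrr add0r normrN gtr0_norm// /r; lra.
have near2 : `|gauss_cdf x - gauss_cdf (x - r)| <= e / 2.
  by apply: hd => /=; rewrite opprB addrCA subrr addr0 gtr0_norm// /r; lra.
near=> L.
have up : `|\int[P]_w ramp x r (Xs L w) - gauss_mean (ramp x r)| <= e / 2.
  by near: L; exact: ramp_mean_cvg.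
have lo : `|\int[P]_w ramp (x - r) r (Xs L w) - gauss_mean (ramp (x - r) r)| <= e / 2.
  by near: L; exact: ramp_mean_cvg.
have /andP[_ cup] := gauss_mean_bounds (ramp_itv x r) (ramp_lipschitz x r0)
  (@ramp_left _ x r r0) (@ramp_right _ x r r0).
have /andP[clo _] := gauss_mean_bounds (ramp_itv (x - r) r) (ramp_lipschitz (x - r) r0)
  (@ramp_left _ (x - r) r r0) (@ramp_right _ (x - r) r r0).
set A := [set w | _].
have mA : measurable A.
  have -> : A = Xs L @^-1` `]-oo, x] by apply/seteqP; split => w /=; rewrite in_itv.
  by rewrite -[X in measurable X]setTI; apply: mXs.
have PA : fine (P A) = \int[P]_w \1_A w by rewrite /Rintegral integral_indic// setIT.
have mr a : measurable_fun [set: T] (fun w => ramp a r (Xs L w)).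
  apply: measurableT_comp; last exact: mXs.
  by apply: continuous_measurable_fun; exact: lipschitz_continuous (ramp_lipschitz a r0).
have ir a : P.-integrable [set: T] (EFin \o (fun w => ramp a r (Xs L w))).
  apply: (@integrable_bounded _ _ _ P _ 1) => // w.
  by have /andP[h0 h1] := ramp_itv a r (Xs L w); rewrite ger0_norm.
have iA : P.-integrable [set: T] (EFin \o (\1_A : T -> R)).
  apply: (@integrable_bounded _ _ _ P _ 1); first exact: measurable_indic.
  by move=> w; rewrite indicE normr_nat; case: (_ \in _).
have PA_up : fine (P A) <= \int[P]_w ramp x r (Xs L w).
  rewrite PA; apply: le_Rintegral => // w _; rewrite indicE.
  case: (boolP (w \in A)) => [/set_mem wA|_]; last by case/andP: (ramp_itv x r (Xs L w)).
  by rewrite ramp_left.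
have PA_lo : \int[P]_w ramp (x - r) r (Xs L w) <= fine (P A).
  rewrite PA; apply: le_Rintegral => // w _; rewrite indicE.
  case: (boolP (w \in A)) => [_|/negP wA]; first by case/andP: (ramp_itv (x - r) r (Xs L w)).
  rewrite ramp_right// subrK leNgt; apply/negP => /ltW wx.
  by apply: wA; rewrite inE.
move: near1 near2 up lo; rewrite !ler_norml => /andP[? ?] /andP[? ?] /andP[? ?] /andP[? ?].
by apply/andP; split; lra.
Unshelve. all: by end_near. Qed.

End clt.

(** * Explicit integrals *)

Section improper_integrals.
Context {R : realType}.
Local Notation D := (`]0%R, +oo[%classic : set R).
Local Notation mu := (@lebesgue_measure R).

Lemma leb_mu (f : R -> R) (A : set R) : measurable A -> measurable_fun A f ->
  (\int[leb]_(x in A) (f x)%:E = \int[mu]_(x in A) (f x)%:E)%E.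
Proof. by move=> mA mf; apply: lebE => //; exact/measurable_EFinP. Qed.

Lemma ge0_FTC2_half_line (f F : R -> R) (a l : R) : measurable_fun [set: R] f ->
  (forall x, a <= x -> 0 <= f x) -> (forall x, a <= x -> {for x, continuous f}) ->
  (forall x : R, a <= x -> derivable F x 1 /\ 'D_1 F x = f x) -> F x @[x --> +oo] --> l ->
  (\int[leb]_(x in `]a, +oo[) (f x)%:E = (l - F a)%:E)%E.
Proof.
move=> mf f0 cf dF Fl.
rewrite leb_mu//; last exact: measurable_funTS.
rewrite integral_itv_obnd_cbnd; last first.
  by apply/measurable_EFinP; exact: measurable_funTS.
rewrite (@ge0_continuous_FTC2y _ f F a l)//.
- by apply: continuous_in_subspaceT => x /set_mem; rewrite /= in_itv/= andbT => /cf.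
- by move=> x /ltW ax; have [] := dF x ax.
- apply: cvg_at_right_filter; have [d _] := dF a (lexx a).
  by move/derivable1_diffP/differentiable_continuous: d.
- move=> x; rewrite in_itv/= andbT => /ltW ax; rewrite derive1E.
  by have [_ ->] := dF x ax.
Qed.

Lemma cvg_expRNM (c : R) : 0 < c -> expR (- (c * x)) @[x --> +oo] --> (0 : R).
Proof.
move=> c0; apply/cvgrPdist_le => e e0; near=> x.
rewrite sub0r normrN ger0_norm ?expR_ge0// expRN -[leRHS]invrK.
rewrite lef_pV2 ?posrE ?expR_gt0 ?invr_gt0//.
apply: (le_trans (_ : _ <= 1 + c * x)); last exact: expR_ge1Dx.
apply: (@le_trans _ _ (c * x)); last by rewrite lerDr.
by rewrite -ler_pdivrMl//; near: x; apply: nbhs_pinfty_ge; exact: num_real.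
Unshelve. all: by end_near. Qed.

Lemma cvg_expRNM_pow (c : R) (k : nat) : 0 < c ->
  x ^+ k * expR (- (c * x)) @[x --> +oo] --> (0 : R).
Proof.
move=> c0; elim: k c c0 => [|k IHk] c c0.
  by under eq_fun do rewrite expr0 mul1r; exact: cvg_expRNM.
have h2 : 0 < c / 2 by rewrite divr_gt0.
have xe (x : R) : 0 <= x -> x * expR (- (c / 2 * x)) <= 2 / c.
  move=> x0; rewrite expRN ler_pdivrMr ?expR_gt0//.
  have {1}-> : x = 2 / c * (c / 2 * x) by field; rewrite gt_eqF.
  rewrite ler_wpM2l ?divr_ge0 ?(ltW c0)//.
  by apply: le_trans (expR_ge1Dx _); rewrite lerDr.
apply: (@squeeze_cvgr _ _ _ _ (fun=> 0) (fun x : R => 2 / c * (x ^+ k * expR (- (c / 2 * x))))).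
- near=> x; have x0 : 0 <= x by near: x; apply: nbhs_pinfty_ge; exact: num_real.
  rewrite mulr_ge0 ?exprn_ge0 ?expR_ge0//=.
  have -> : x ^+ k.+1 * expR (- (c * x)) =
      (x * expR (- (c / 2 * x))) * (x ^+ k * expR (- (c / 2 * x))).
    have -> : - (c * x) = - (c / 2 * x) + - (c / 2 * x) by field.
    by rewrite expRD exprS; ring.
  by rewrite ler_wpM2r ?xe// mulr_ge0 ?exprn_ge0 ?expR_ge0.
- exact: cvg_cst.
- by rewrite -(mulr0 (2 / c)); apply: cvgMr; exact: (IHk _ h2).
Unshelve. all: by end_near. Qed.

Lemma is_derive_pair (F : R -> R) (x df : R) : is_derive x 1 F df ->
  derivable F x 1 /\ 'D_1 F x = df.
Proof. by case. Qed.

Lemma continuous_expRNM (c : R) : continuous (fun x : R => expR (- (c * x))).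
Proof.
move=> x; apply: continuous_comp; last exact: continuous_expR.
by apply: cvgN; apply: cvgMr; exact: cvg_id.
Qed.

Lemma integral_expRNM (c : R) : 0 < c ->
  (\int[leb]_(x in D) (expR (- (c * x)))%:E = (c^-1)%:E)%E.
Proof.
move=> c0; have cn0 : c != 0 by rewrite gt_eqF.
rewrite (@ge0_FTC2_half_line _ (fun x => - c^-1 * expR (- (c * x))) _ 0).
- by rewrite mulr0 oppr0 expR0 mulr1 sub0r opprK.
- by mfun.
- by move=> x _; exact: expR_ge0.
- by move=> x _; exact: continuous_expRNM.
- move=> x _; apply: is_derive_pair; apply: is_derive_eq; rewrite /GRing.scale/=; by field.
- by rewrite -(mulr0 (- c^-1)); apply: cvgMr; exact: cvg_expRNM.
Qed.

Lemma is_derive_expRNM (c x : R) :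
  is_derive x 1 (fun x : R => expR (- (c * x))) (- c * expR (- (c * x))).
Proof. by apply: is_derive_eq; rewrite /GRing.scale/= mulr1 mulrN mulrC mulNr. Qed.

Lemma is_derive_mul (u v : R -> R) (x du dv : R) : is_derive x 1 u du ->
  is_derive x 1 v dv -> is_derive x 1 (fun x => u x * v x) (u x * dv + v x * du).
Proof. by move=> iu iv; exact: is_deriveM. Qed.

Lemma is_derive_scale_add (u v : R -> R) (a b x du dv : R) : is_derive x 1 u du ->
  is_derive x 1 v dv -> is_derive x 1 (fun x => a * u x + b * v x) (a * du + b * dv).
Proof.
move=> iu iv; have := is_deriveD (is_deriveZ a iu) (is_deriveZ b iv).
by move/is_derive_eq; apply.
Qed.

Lemma integral_x_expRNM (c : R) : 0 < c ->
  (\int[leb]_(x in D) (x * expR (- (c * x)))%:E = (c ^- 2)%:E)%E.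
Proof.
move=> c0; have cn0 : c != 0 by rewrite gt_eqF.
have dxe := is_derive_mul (is_derive_id _ _) (is_derive_expRNM c _).
rewrite (@ge0_FTC2_half_line _
  (fun x => - c^-1 * (x * expR (- (c * x))) + - c ^- 2 * expR (- (c * x))) _ 0).
- by congr (_%:E); rewrite mulr0 oppr0 expR0; field.
- by mfun.
- by move=> x x0; rewrite mulr_ge0 ?expR_ge0.
- by move=> x _; apply: cvgM; [exact: cvg_id|exact: continuous_expRNM].
- move=> x _; apply: is_derive_pair.
  have := is_derive_scale_add (- c^-1) (- c ^- 2) (dxe x) (is_derive_expRNM c x).
  by move/is_derive_eq; apply => /=; move: (expR _) => e; field.
- rewrite -[X in _ --> X](_ : - c^-1 * 0 + - c ^- 2 * 0 = 0 :> R); last by rewrite !mulr0 addr0.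
  apply: cvgD; apply: cvgMr; last exact: cvg_expRNM.
  by have := cvg_expRNM_pow 1 c0; under eq_fun do rewrite expr1.
Qed.

Lemma integral_x2_expRNM (c : R) : 0 < c ->
  (\int[leb]_(x in D) (x ^+ 2 * expR (- (c * x)))%:E = (2 * c ^- 3)%:E)%E.
Proof.
move=> c0; have cn0 : c != 0 by rewrite gt_eqF.
have dxe := is_derive_mul (is_derive_id _ _) (is_derive_expRNM c _).
have dx2e (x : R) := is_derive_mul (is_derive_id (x : R^o) (1 : R^o)) (dxe x).
rewrite (@ge0_FTC2_half_line _
  (fun x => - c^-1 * (x * (x * expR (- (c * x)))) + 1 * (- (2 * c ^- 2) * (x * expR (- (c * x)))
    + - (2 * c ^- 3) * expR (- (c * x)))) _ 0).
- by congr (_%:E); rewrite mulr0 oppr0 expR0; field.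
- by mfun.
- by move=> x x0; rewrite mulr_ge0 ?expR_ge0// exprn_ge0.
- by move=> x _; apply: cvgM; [exact: exprn_continuous|exact: continuous_expRNM].
- move=> x _; apply: is_derive_pair.
  have := is_derive_scale_add (- (2 * c ^- 2)) (- (2 * c ^- 3)) (dxe x) (is_derive_expRNM c x).
  move/(is_derive_scale_add (- c^-1) 1 (dx2e x)).
  by move/is_derive_eq; apply => /=; move: (expR _) => e; field.
- rewrite -[X in _ --> X](_ : - c^-1 * 0 + 1 * (- (2 * c ^- 2) * 0 + - (2 * c ^- 3) * 0) = 0 :> R);
    last by ring.
  have e1 : x * expR (- (c * x)) @[x --> +oo] --> (0 : R).
    by have := cvg_expRNM_pow 1 c0; under eq_fun do rewrite expr1.
  apply: cvgD; apply: cvgMr.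
    by have := cvg_expRNM_pow 2 c0; under eq_fun do rewrite expr2 -mulrA.
  by apply: cvgD; apply: cvgMr => //; exact: cvg_expRNM.
Qed.

End improper_integrals.

Section tonelli_on.
Context d1 d2 (T1 : measurableType d1) (T2 : measurableType d2) {R : realType}.
Variables (m1 : {sigma_finite_measure set T1 -> \bar R})
  (m2 : {sigma_finite_measure set T2 -> \bar R}).
Local Open Scope ereal_scope.

Lemma ge0_tonelli_on (A : set T1) (B : set T2) (f : T1 * T2 -> \bar R) :
  measurable A -> measurable B -> measurable_fun [set: T1 * T2] f ->
  (forall z, 0 <= f z) ->
  \int[m1]_(x in A) \int[m2]_(y in B) f (x, y) =
  \int[m2]_(y in B) \int[m1]_(x in A) f (x, y).
Proof.
move=> mA mB mf f0.
pose h z := f z * ((\1_A z.1)%:E * (\1_B z.2)%:E).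
have mh : measurable_fun [set: T1 * T2] h.
  apply: emeasurable_funM => //; apply: emeasurable_funM.
    apply/measurable_EFinP; apply: (measurableT_comp (f := (\1_A : T1 -> R))).
      exact: measurable_indic.
    exact: measurable_fst.
  apply/measurable_EFinP; apply: (measurableT_comp (f := (\1_B : T2 -> R))).
    exact: measurable_indic.
  exact: measurable_snd.
have h0 z : 0 <= h z by rewrite mule_ge0// mule_ge0// lee_fin indicE.
have := fubini_tonelli (m1 := m1) (m2 := m2) h mh h0.
congr (_ = _).
  rewrite [RHS]integral_mkcond epatch_indic; apply: eq_integral => x _ /=.
  rewrite [X in X * _]integral_mkcond epatch_indic.
  rewrite -ge0_integralZr ?lee_fin ?indicE//.
  - by apply: eq_integral => y _; rewrite /h/= -muleA; congr (_ * _); rewrite muleC indicE.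
  - apply: emeasurable_funM; last by apply/measurable_EFinP; exact: measurable_indic.
    by apply: (measurableT_comp mf); exact: measurable_pair1.
  - by move=> y _; rewrite mule_ge0// lee_fin indicE.
rewrite [RHS]integral_mkcond epatch_indic; apply: eq_integral => y _ /=.
rewrite [X in X * _]integral_mkcond epatch_indic.
rewrite -ge0_integralZr ?lee_fin ?indicE//.
- by apply: eq_integral => x _; rewrite /h/= -muleA; congr (_ * _); rewrite indicE.
- apply: emeasurable_funM; last by apply/measurable_EFinP; exact: measurable_indic.
  by apply: (measurableT_comp mf); exact: measurable_pair2.
- by move=> x _; rewrite mule_ge0// lee_fin indicE.
Qed.

End tonelli_on.

Section special_integrals.
Context {R : realType}.
Local Notation D := (`]0%R, +oo[%classic : set R).
Local Notation mu := (@lebesgue_measure R).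

Lemma cvg_integral_half_line (f : R -> R) (c : R) : 0 < c -> measurable_fun [set: R] f ->
  (forall x, 0 <= f x) ->
  (\int[leb]_(x in `[(c / n.+1%:R)%R, +oo[) (f x)%:E)%E @[n --> \oo] -->
  (\int[leb]_(x in D) (f x)%:E)%E.
Proof.
move=> c0 mf f0.
have cn0 n : 0 < c / n.+1%:R by rewrite divr_gt0.
have E n : (\int[leb]_(x in `[(c / n.+1%:R)%R, +oo[) (f x)%:E =
    \int[leb]_(x in D) (f x * \1_(`[c / n.+1%:R, +oo[%classic) x)%:E)%E.
  rewrite integral_mkcond [RHS]integral_mkcond; apply: eq_integral => x _.
  rewrite !patchE indicE; case: ifPn => [xc|xc].
    rewrite ifT ?mulr1//; move: xc; rewrite !inE/= !in_itv/= !andbT.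
    exact: lt_le_trans.
  by rewrite mulr0; case: ifPn.
under eq_fun do rewrite E.
have -> : (\int[leb]_(x in D) (f x)%:E =
    \int[leb]_(x in D) limn (fun n => (f x * \1_(`[c / n.+1%:R, +oo[%classic) x)%:E))%E.
  apply: eq_integral => x /set_mem; rewrite /= in_itv/= andbT => x0.
  apply/esym/cvg_lim => //; apply: cvg_near_cst; near=> n; congr (_%:E).
  rewrite indicE mem_set ?mulr1//= in_itv/= andbT ler_pdivrMr// mulrC -ler_pdivrMr//.
  apply: (@le_trans _ _ n%:R); last by rewrite ler_nat.
  near: n; exact: nbhs_infty_ger.
apply: cvg_monotone_convergence => //.
- move=> n; apply/measurable_EFinP; apply: measurable_funTS.
  by apply: measurable_funM => //; exact: measurable_indic.
- by move=> n x _; rewrite lee_fin mulr_ge0// indicE.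
- move=> x _ a b ab; rewrite lee_fin ler_wpM2l// !indicE ler_nat.
  have sub : `[c / a.+1%:R, +oo[%classic `<=` (`[c / b.+1%:R, +oo[%classic : set R).
    move=> y; rewrite /= !in_itv/= !andbT; apply: le_trans.
    by rewrite ler_pM2l// lef_pV2 ?posrE// ler_nat.
  case: (boolP (x \in `[c / a.+1%:R, +oo[%classic)) => // /set_mem /sub xb.
  by rewrite mem_set.
Unshelve. all: by end_near. Qed.

Lemma FTC2_segment (f F : R -> R) (a b : R) : a < b -> measurable_fun [set: R] f ->
  (forall x, a <= x -> x <= b -> {for x, continuous f}) ->
  (forall x : R, a <= x -> x <= b -> derivable F x 1 /\ 'D_1 F x = f x) ->
  (\int[leb]_(x in `[a, b]) (f x)%:E = (F b - F a)%:E)%E.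
Proof.
move=> ab mf cf dF; rewrite leb_mu//; last exact: measurable_funTS.
have cF (x : R) : a <= x -> x <= b -> {for x, continuous F}.
  move=> ax xb; have [d _] := dF x ax xb.
  by move/derivable1_diffP/differentiable_continuous: d.
rewrite (@continuous_FTC2 _ _ F)//.
- apply: continuous_in_subspaceT => x /set_mem; rewrite /= in_itv/= => /andP[ax xb].
  exact: cf.
- split.
  + by move=> x; rewrite in_itv/= => /andP[/ltW ax /ltW xb]; have [] := dF x ax xb.
  + by apply: cvg_at_right_filter; apply: cF => //; exact: ltW.
  + by apply: cvg_at_left_filter; apply: cF => //; exact: ltW.
- move=> x; rewrite in_itv/= => /andP[/ltW ax /ltW xb]; rewrite derive1E.
  by have [_ ->] := dF x ax xb.
Qed.

Lemma ge0_integral_half_line1 (f : R -> R) : measurable_fun [set: R] f ->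
  (forall x, 0 < x -> 0 <= f x) ->
  (\int[leb]_(x in D) (f x)%:E =
   \int[leb]_(x in `]0%R, 1%R]) (f x)%:E + \int[leb]_(x in `]1%R, +oo[) (f x)%:E)%E.
Proof.
move=> mf f0.
have DE : D = (`]0%R, 1] : set R) `|` `]1%R, +oo[%classic.
  apply/seteqP; split => x /=; rewrite !in_itv/= !andbT.
    by move=> x0; case: (leP x 1) => h; [left; rewrite x0|right].
  by case => [/andP[]//|]; exact: lt_trans.
have dis : [disjoint (`]0%R, 1]%classic : set R) & (`]1%R, +oo[%classic : set R)].
  apply/disj_setPS => x [] /=; rewrite !in_itv/= andbT => /andP[_ x1].
  by rewrite ltNge x1.
rewrite DE ge0_integral_setU//.
- by apply/measurable_EFinP; exact: measurable_funTS.
- move=> x [] /=; rewrite in_itv/= ?andbT; first by move=> /andP[x0 _]; rewrite lee_fin f0.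
  by move=> x1; rewrite lee_fin f0//; exact: lt_trans x1.
Qed.

Lemma is_derive_powR (b x : R) : 0 < x -> b != 0 ->
  is_derive x 1 (fun y : R => b^-1 * y `^ b) (x `^ (b - 1)).
Proof.
move=> x0 b0; have := is_deriveZ b^-1 (is_derive1_powR b x0).
by move/is_derive_eq; apply; rewrite /GRing.scale/= mulrA mulVf// mul1r.
Qed.

Lemma continuous_powR_gt0 (b x : R) : 0 < x -> {for x, continuous (fun y : R => y `^ b)}.
Proof.
move=> x0; have [d _] := is_derive1_powR b x0.
by move/derivable1_diffP/differentiable_continuous: d.
Qed.

Lemma cvg_powRN (b : R) : 0 < b -> x `^ (- b) @[x --> +oo] --> (0 : R).
Proof.
move=> b0; apply/cvgrPdist_le => e e0; near=> x.
have x0 : 0 < x by near: x; exact: nbhs_pinfty_gt.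
rewrite sub0r normrN ger0_norm ?powR_ge0// powRN -[leRHS]invrK.
rewrite lef_pV2 ?posrE ?powR_gt0 ?invr_gt0//.
have -> : e^-1 = (e^-1 `^ b^-1) `^ b.
  by rewrite -powRrM mulVf ?gt_eqF// powRr1// invr_ge0 ltW.
have ex : e^-1 `^ b^-1 <= x by near: x; apply: nbhs_pinfty_ge; exact: num_real.
by apply: ge0_ler_powR; rewrite ?nnegrE ?powR_ge0 ?(ltW b0) ?(ltW x0).
Unshelve. all: by end_near. Qed.

Lemma integral_powR_tail (b L : R) : 0 < b -> 0 < L ->
  (\int[leb]_(z in `]L, +oo[) (z `^ (- b - 1))%:E = (L `^ (- b) / b)%:E)%E.
Proof.
move=> b0 L0; have bn0 : - b != 0 by rewrite oppr_eq0 gt_eqF.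
rewrite (@ge0_FTC2_half_line _ _ (fun z => (- b)^-1 * z `^ (- b)) _ 0).
- by congr (_%:E); rewrite sub0r invrN mulNr opprK mulrC.
- exact: measurable_powR.
- by move=> x _; exact: powR_ge0.
- by move=> x Lx; apply: continuous_powR_gt0; exact: lt_le_trans Lx.
- by move=> x Lx; apply: is_derive_pair; apply: is_derive_powR => //; exact: lt_le_trans Lx.
- by rewrite -(mulr0 (- b)^-1); apply: cvgMr; exact: cvg_powRN.
Qed.

Lemma integral_powR_head (b L : R) : 0 < b -> 0 < L ->
  (\int[leb]_(z in `]0%R, L]) (z `^ (b - 1))%:E = (L `^ b / b)%:E)%E.
Proof.
move=> b0 L0; have bn0 : b != 0 by rewrite gt_eqF.
pose f (z : R) := z `^ (b - 1) * \1_(`]-oo, L]%classic) z.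
have mf : measurable_fun [set: R] f.
  by apply: measurable_funM; [exact: measurable_powR|exact: measurable_indic].
have f0 z : 0 <= f z by rewrite mulr_ge0 ?powR_ge0// indicE.
have -> : (\int[leb]_(z in `]0%R, L]) (z `^ (b - 1))%:E = \int[leb]_(z in D) (f z)%:E)%E.
  rewrite integral_mkcond [RHS]integral_mkcond; apply: eq_integral => z _.
  rewrite !patchE /f indicE !mem_setE/= !in_itv/= andbT.
  by case: (0 < z); case: (z <= L); rewrite ?mulr1 ?mulr0.
have h2 : 0 < L / 2 by rewrite divr_gt0.
have h := cvg_integral_half_line h2 mf f0.
rewrite -(cvg_lim _ h)//; apply/cvg_lim => //.
have cn n : 0 < L / 2 / n.+1%:R by rewrite divr_gt0.
have cL n : L / 2 / n.+1%:R < L.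
  rewrite -mulrA -invfM gtr_pMr// invf_lt1 ?mulr_gt0//.
  by apply: (@lt_le_trans _ _ (2 * 1)); [rewrite mulr1 ltr1n|rewrite ler_pM2l// ler1n].
have F n : (\int[leb]_(x in `[(L / 2 / n.+1%:R)%R, +oo[) (f x)%:E =
    (b^-1 * L `^ b - b^-1 * (L / 2 / n.+1%:R) `^ b)%:E)%E.
  have c0 := cn n; move: (cL n); move: (L / 2 / n.+1%:R) c0 => c c0 {}cL.
  transitivity (\int[leb]_(z in `[c, L]) (z `^ (b - 1))%:E)%E.
    rewrite integral_mkcond [RHS]integral_mkcond; apply: eq_integral => z _.
    rewrite !patchE /f indicE !mem_setE/= !in_itv/= andbT.
    by case: (c <= z); case: (z <= L); rewrite ?mulr1 ?mulr0.
  apply: (@FTC2_segment _ (fun z : R => b^-1 * z `^ b)) => //.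
  - by move=> x cx _; apply: continuous_powR_gt0; exact: lt_le_trans cx.
  - by move=> x cx _; apply: is_derive_pair; apply: is_derive_powR => //; exact: lt_le_trans cx.
under eq_fun do rewrite F.
apply: cvg_EFin; first by near=> n.
rewrite -[X in _ --> X](_ : b^-1 * L `^ b - b^-1 * 0 = L `^ b / b); last by rewrite mulr0 subr0 mulrC.
apply: cvgB; first exact: cvg_cst.
apply: cvgMr.
have -> : (fun n => (L / 2 / n.+1%:R) `^ b) = (fun n => (L / 2) `^ b * (n.+1%:R `^ (- b))).
  apply/funext => n; rewrite powRM ?ltW ?invr_gt0//; congr (_ * _).
  by rewrite -[X in X `^ b]powR_inv1// -powRrM mulN1r.
rewrite -(mulr0 ((L / 2) `^ b)); apply: cvgMr.
suff ny : (n.+1%:R : R) @[n --> \oo] --> +oo by exact: (cvg_comp _ _ ny (cvg_powRN b0)).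
apply/cvgryPge => A; near=> n; apply: (@le_trans _ _ n%:R); last by rewrite ler_nat.
by near: n; exact: nbhs_infty_ger.
Unshelve. all: by end_near. Qed.

End special_integrals.

Section gamma_integrals.
Context {R : realType}.
Local Notation D := (`]0%R, +oo[%classic : set R).
Local Notation mu := (@lebesgue_measure R).

Lemma FrullaniE (m c : R) : 0 < m -> 0 < c ->
  (\int[leb]_(x in D) ((1 - expR (- (m * x))) * (x^-1 * expR (- (c * x))))%:E =
   (ln (1 + m / c))%:E)%E.
Proof.
move=> m0 c0.
transitivity (\int[leb]_(x in D) \int[leb]_(w in `[0%R, m]) (expR (- ((w + c) * x)))%:E)%E.
  apply: eq_integral => x /set_mem; rewrite /= in_itv/= andbT => x0.
  have xn0 : x != 0 by rewrite gt_eqF.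
  rewrite (@FTC2_segment _ _ (fun w => (- x^-1 * expR (- (c * x))) * expR (- (x * w))))//.
  - congr (_%:E); rewrite mulr0 oppr0 expR0 (mulrC x m).
    by move: (expR _) (expR _) => e1 e2; ring.
  - by mfun.
  - move=> w _ _; apply: continuous_comp; last exact: continuous_expR.
    by apply: cvgN; apply: cvgMl; apply: cvgD; [exact: cvg_id|exact: cvg_cst].
  - move=> w _ _; apply: is_derive_pair.
    have := is_deriveZ (- x^-1 * expR (- (c * x))) (is_derive_expRNM x w).
    move/is_derive_eq; apply; rewrite /GRing.scale/=.
    have -> : - ((w + c) * x) = - (c * x) + - (x * w) by ring.
    by rewrite expRD; move: (expR _) (expR _) => e1 e2; field.
have mf : measurable_fun [set: R * R] (fun z : R * R => (expR (- ((z.2 + c) * z.1)))%:E) by mfun.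
have mA : measurable (`[0%R, m]%classic : set R) by [].
have mD : measurable D by [].
have f0 (z : R * R) : (0 <= (expR (- ((z.2 + c) * z.1)))%:E)%E by rewrite lee_fin expR_ge0.
rewrite (ge0_tonelli_on leb leb mD mA mf f0).
transitivity (\int[leb]_(w in `[0%R, m]) ((w + c) `^ (- 1))%:E)%E.
  apply: eq_integral => w /set_mem; rewrite /= in_itv/= => /andP[w0 _].
  have wc : 0 < w + c by rewrite ltr_wpDl.
  by rewrite integral_expRNM// powR_inv1// ltW.
have wc (w : R) : 0 <= w -> 0 < w + c by move=> w0; rewrite ltr_wpDl.
rewrite (@FTC2_segment _ _ (fun w => ln (w + c)))//.
- rewrite add0r -ln_div ?posrE// ?wc ?ltW//; congr (ln _)%:E; field; exact: lt0r_neq0.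
- by mfun.
- move=> w /wc w0 _; apply: (cvg_comp (fun w : R => w + c) (fun u => u `^ (-1)) _ (continuous_powR_gt0 w0)).
  by apply: cvgD; [exact: cvg_id|exact: cvg_cst].
- move=> w /wc w0 _; apply: is_derive_pair.
  have dw : is_derive w 1 (fun w : R => w + c) (1 + 0).
    by apply: is_deriveD.
  have := @is_derive1_comp _ (@ln R) (fun w : R => w + c) w _ _ (is_derive1_ln w0) dw.
  by move/is_derive_eq; apply; rewrite addr0 mulr1 powR_inv1// ltW.
Qed.

Lemma integral_GammafE (a : R) : 0 < a -> a <= 2 -> 0 < Gammaf a /\
  (\int[leb]_(x in D) (x `^ (a - 1) * expR (- x))%:E = (Gammaf a)%:E)%E.
Proof.
move=> a0 a2; pose f (x : R) := x `^ (a - 1) * expR (- x).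
have mf : measurable_fun [set: R] f.
  by apply: measurable_funM; [exact: measurable_powR|mfun].
have f0 x : 0 <= f x by rewrite mulr_ge0 ?powR_ge0 ?expR_ge0.
have mfE A : measurable_fun A (EFin \o f) by apply/measurable_EFinP; exact: measurable_funTS.
have E := ge0_integral_half_line1 mf (fun x _ => f0 x).
have lo : ((expR (-1) / a)%:E <= \int[leb]_(x in `]0%R, 1%R]) (f x)%:E)%E.
  have -> : expR (-1) / a = expR (-1) * (1 `^ a / a) by rewrite powR1 mul1r.
  rewrite EFinM -integral_powR_head// -ge0_integralZl//; last first.
  - by move=> x _; rewrite lee_fin powR_ge0.
  - by apply/measurable_EFinP; apply: measurable_funTS; exact: measurable_powR.
  apply: ge0_le_integral => //.
  - by move=> x _; rewrite -EFinM lee_fin mulr_ge0 ?powR_ge0 ?expR_ge0.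
  - apply: emeasurable_funM => //.
    by apply/measurable_EFinP; apply: measurable_funTS; exact: measurable_powR.
  - move=> x; rewrite /= in_itv/= => /andP[x0 x1].
    by rewrite -EFinM lee_fin /f mulrC ler_wpM2l ?powR_ge0// ler_expR lerN2.
have hi1 : (\int[leb]_(x in `]0%R, 1%R]) (f x)%:E < +oo)%E.
  apply: (@le_lt_trans _ _ (\int[leb]_(x in `]0%R, 1%R]) (x `^ (a - 1))%:E)%E); last first.
    by rewrite integral_powR_head// ltry.
  apply: ge0_le_integral => //.
  - by move=> x _; rewrite lee_fin.
  - by apply/measurable_EFinP; apply: measurable_funTS; exact: measurable_powR.
  - move=> x; rewrite /= in_itv/= => /andP[x0 x1].
    by rewrite lee_fin /f ler_piMr ?powR_ge0// -expR0 ler_expR oppr_le0 ltW.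
have hi2 : (\int[leb]_(x in `]1%R, +oo[) (f x)%:E < +oo)%E.
  apply: (@le_lt_trans _ _ (\int[leb]_(x in D) (x * expR (- (1 * x)))%:E)%E); last first.
    by rewrite integral_x_expRNM// ltry.
  apply: (@le_trans _ _ (\int[leb]_(x in `]1%R, +oo[) (x * expR (- (1 * x)))%:E)%E).
    apply: ge0_le_integral => //.
    - by move=> x _; rewrite lee_fin.
    - by apply: measurable_funTS; mfun.
    - move=> x; rewrite /= in_itv/= andbT => x1.
      rewrite lee_fin /f mul1r ler_wpM2r ?expR_ge0//.
      rewrite -[leRHS]powRr1 ?(le_trans ler01 (ltW x1))//.
      by apply: ler_powR; [exact: ltW|lra].
  apply: ge0_subset_integral => //.
  - by apply: measurable_funTS; mfun.
  - by move=> x; rewrite /= in_itv/= andbT => x0; rewrite lee_fin mulr_ge0 ?expR_ge0 ?ltW.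
  - by move=> x; rewrite /= !in_itv/= !andbT; exact: lt_trans.
have fin : (\int[leb]_(x in D) (f x)%:E)%E \is a fin_num.
  rewrite ge0_fin_numE; first by rewrite E lte_add_pinfty.
  by apply: integral_ge0 => x _; rewrite lee_fin.
have -> : Gammaf a = fine (\int[leb]_(x in D) (f x)%:E)%E.
  by rewrite /Gammaf /Rintegral leb_mu//; exact: measurable_funTS.
rewrite fineK//; split=> //.
apply: (@lt_le_trans _ _ (expR (-1) / a)); first by rewrite divr_gt0 ?expR_gt0.
rewrite -lee_fin fineK// (le_trans lo)// E leeDl// integral_ge0// => x _.
by rewrite lee_fin.
Qed.

Lemma Gammaf_scaling (a x : R) : 0 < a -> a <= 2 -> 0 < x ->
  (\int[leb]_(z in D) (z `^ (a - 1) * expR (- (z * x)))%:E = (Gammaf a * x `^ (- a))%:E)%E.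
Proof.
move=> a0 a2 x0; have [_ GE] := integral_GammafE a0 a2.
pose f (z : R) := z `^ (a - 1) * expR (- z).
have mf : measurable_fun [set: R] f.
  by apply: measurable_funM; [exact: measurable_powR|mfun].
have f0 z : 0 <= f z by rewrite mulr_ge0 ?powR_ge0 ?expR_ge0.
pose g (z : R) := z `^ (a - 1) * expR (- (z * x)).
have mg : measurable_fun [set: R] g.
  by apply: measurable_funM; [exact: measurable_powR|mfun].
have g0 z : 0 <= g z by rewrite mulr_ge0 ?powR_ge0 ?expR_ge0.
have hf := cvg_integral_half_line x0 mf f0.
have hg := cvg_integral_half_line ltr01 mg g0.
have key n : (\int[leb]_(z in `[(x / n.+1%:R)%R, +oo[) (f z)%:E =
    (x `^ a)%:E * \int[leb]_(z in `[(1 / n.+1%:R)%R, +oo[) (g z)%:E)%E.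
  have n0 : 0 < 1 / n.+1%:R :> R by rewrite divr_gt0.
  rewrite -ge0_integralZl//; last 3 first.
  - by apply: measurable_funTS; exact/measurable_EFinP.
  - by move=> z _; rewrite lee_fin.
  - by rewrite lee_fin powR_ge0.
  have dF : derive1 (fun z : R => x * z) = cst x.
    apply/funext => z; rewrite derive1E.
    by have [_ ->] := (is_deriveZ x (is_derive_id (z : R^o) (1 : R^o))); rewrite /GRing.scale/= mulr1.
  rewrite leb_mu//; last exact: measurable_funTS.
  have -> : x / n.+1%:R = (fun z : R => x * z) (1 / n.+1%:R) by rewrite /= mul1r.
  rewrite increasing_ge0_integration_by_substitutiony.
  - rewrite dF; rewrite -leb_mu//; last first.
      apply: measurable_funTS; apply: measurable_funM => //.
      by apply: (measurableT_comp mf); mfun.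
    apply: eq_integral => z /set_mem; rewrite /= in_itv/= andbT => z0.
    have {}z0 := lt_le_trans n0 z0.
    rewrite -EFinM /f /g /=; congr (_%:E).
    transitivity ((x * z) `^ (a - 1) * expR (- (x * z)) * x); first by [].
    rewrite powRM ?ltW// (mulrC x z).
    have -> : x `^ a = x `^ (a - 1) * x.
      rewrite -{3}(powRr1 (ltW x0)) -powRD ?subrK//; by rewrite (gt_eqF x0) implybT.
    by ring.
  - by move=> u v _ _ uv; rewrite ltr_pM2l.
  - by move=> z _; rewrite dF; exact: cvg_cst.
  - by rewrite dF; exact: is_cvg_cst.
  - by rewrite dF; exact: is_cvg_cst.
  - split.
      move=> z _; by have [] := (is_deriveZ x (is_derive_id (z : R^o) (1 : R^o))).
    by apply: cvg_at_right_filter; apply: cvgMr; exact: cvg_id.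
  - apply/cvgryPge => A; near=> z; rewrite -ler_pdivrMl//.
  - apply: continuous_in_subspaceT => z /set_mem; rewrite /= in_itv/= andbT => z0.
    have {}z0 : 0 < z by apply: lt_le_trans z0; rewrite mulr_gt0.
    apply: cvgM; first exact: continuous_powR_gt0.
    by apply: continuous_comp; [apply: cvgN; exact: cvg_id|exact: continuous_expR].
  - by [].
have hg2 : ((x `^ a)%:E * \int[leb]_(z in `[(1 / n.+1%:R)%R, +oo[) (g z)%:E @[n --> \oo] -->
   (x `^ a)%:E * \int[leb]_(z in D) (g z)%:E)%E by exact: cvgeZl.
have E : ((x `^ a)%:E * \int[leb]_(z in D) (g z)%:E = (Gammaf a)%:E)%E.
  rewrite -(cvg_lim _ hg2)// -GE -(cvg_lim _ hf)//; congr (limn _).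
  by apply/funext => n; rewrite key.
rewrite EFinM -E muleC muleA -EFinM powRN mulVf ?mul1e//.
by rewrite gt_eqF// powR_gt0.
Unshelve. all: by end_near. Qed.

End gamma_integrals.

(** * Thorin densities *)

Section thorin.
Context d (T : measurableType d) {R : realType}.
Variable nu : {sigma_finite_measure set T -> \bar R}.
Variables kap w : T -> R.
Local Notation D := (`]0%R, +oo[%classic : set R).

(* A mixture of the Levy densities [exp (- w x) / x] of exponential laws. *)
Definition thorin_density (x : R) : R :=
  fine (\int[nu]_z (kap z * expR (- (w z * x)))%:E)%E * x `^ (- 1).

Hypothesis mk : measurable_fun [set: T] kap.
Hypothesis k0 : forall z, 0 <= kap z.
Hypothesis mw : measurable_fun [set: T] w.
Hypothesis kw : forall z, kap z != 0 -> 0 < w z.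

Let ke0 (x : R) z : (0 <= (kap z * expR (- (w z * x)))%:E)%E.
Proof. by rewrite lee_fin mulr_ge0 ?expR_ge0. Qed.

Lemma measurable_thorin_density : measurable_fun [set: R] thorin_density.
Proof.
apply: measurable_funM; last exact: measurable_powR.
apply: (measurableT_comp (f := @fine R)) => //.
have m2 : measurable_fun [set: R * T] (fun p : R * T => (kap p.2 * expR (- (w p.2 * p.1)))%:E).
  by mfun.
apply: (measurable_fun_fubini_tonelli_F (m2 := nu) _ m2) => z.
exact: ke0.
Qed.

Lemma thorin_density_ge0 x : 0 <= thorin_density x.
Proof. by rewrite mulr_ge0 ?powR_ge0 ?fine_ge0 ?integral_ge0. Qed.

Hypothesis kfin : forall x : R, 0 < x ->
  (\int[nu]_z (kap z * expR (- (w z * x)))%:E < +oo)%E.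

Lemma thorin_integral (h : R -> R) : measurable_fun [set: R] h ->
  (forall x, 0 < x -> 0 <= h x) ->
  (\int[leb]_(x in D) (h x * thorin_density x)%:E =
   \int[nu]_z ((kap z)%:E * \int[leb]_(x in D) (h x * (x^-1 * expR (- (w z * x))))%:E))%E.
Proof.
move=> mh h0.
pose f (p : R * T) := (kap p.2 * (`|h p.1| * (p.1 `^ (- 1) * expR (- (w p.2 * p.1)))))%:E.
have mf : measurable_fun [set: R * T] f by rewrite /f; mfun.
have f0 p : (0 <= f p)%E by rewrite lee_fin !mulr_ge0 ?powR_ge0 ?expR_ge0.
have mD : measurable D by [].
transitivity (\int[leb]_(x in D) \int[nu]_z f (x, z))%E.
  apply: eq_integral => x /set_mem; rewrite /= in_itv/= andbT => x0.
  have kf : (\int[nu]_z (kap z * expR (- (w z * x)))%:E)%E \is a fin_num.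
    by rewrite ge0_fin_numE ?kfin// integral_ge0.
  rewrite /thorin_density mulrCA EFinM fineK// muleC -ge0_integralZl//.
  - apply: eq_integral => z _; rewrite /f/= -EFinM (ger0_norm (h0 _ x0)).
    by congr (_%:E); ring.
  - by mfun.
  - by rewrite lee_fin mulr_ge0 ?powR_ge0 ?h0.
rewrite (ge0_tonelli_on leb nu mD measurableT mf f0).
apply: eq_integral => z _; rewrite -ge0_integralZl//.
- apply: eq_integral => x /set_mem; rewrite /= in_itv/= andbT => x0.
  by rewrite /f/= -EFinM (ger0_norm (h0 _ x0)) powR_inv1// ltW.
- apply: (@eq_measurable_fun _ _ _ _ _ (fun x : R => (h x * (x `^ (-1) * expR (- (w z * x))))%:E)).
    by move=> x /set_mem; rewrite /= in_itv/= andbT => x0; rewrite powR_inv1// ltW.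
  by apply: measurable_funTS; mfun.
- move=> x; rewrite /= in_itv/= andbT => x0.
  by rewrite lee_fin !mulr_ge0 ?h0 ?expR_ge0// invr_ge0 ltW.
- by rewrite lee_fin.
Qed.

Let thorin_integral_eq (h H : R -> R) : measurable_fun [set: R] h ->
  (forall x, 0 < x -> 0 <= h x) ->
  (forall c : R, 0 < c ->
    (\int[leb]_(x in D) (h x * (x^-1 * expR (- (c * x))))%:E = (H c)%:E)%E) ->
  (\int[leb]_(x in D) (h x * thorin_density x)%:E =
   \int[nu]_z (kap z * H (w z))%:E)%E.
Proof.
move=> mh h0 hH; rewrite thorin_integral//; apply: eq_integral => z _.
have [->|/kw w0] := eqVneq (kap z) 0; first by rewrite mul0e mul0r.
by rewrite hH// EFinM.
Qed.

Lemma thorin_integral_expR (m : R) : 0 < m ->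
  (\int[leb]_(x in D) ((1 - expR (- (m * x))) * thorin_density x)%:E =
   \int[nu]_z (kap z * ln (1 + m / w z))%:E)%E.
Proof.
move=> m0; apply: (thorin_integral_eq (H := fun c => ln (1 + m / c))).
- by mfun.
- by move=> x x0; rewrite subr_ge0 -expR0 ler_expR oppr_le0 mulr_ge0 ?ltW.
- by move=> c c0; exact: FrullaniE.
Qed.

Lemma thorin_integral_x :
  (\int[leb]_(x in D) (x * thorin_density x)%:E = \int[nu]_z (kap z * (w z)^-1)%:E)%E.
Proof.
apply: (thorin_integral_eq (h := id)) => [|x /ltW//|c c0]; first by mfun.
rewrite -integral_expRNM//; apply: eq_integral => x /set_mem; rewrite /= in_itv/= andbT => x0.
by rewrite mulrA divff ?mul1r// gt_eqF.
Qed.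

Lemma thorin_integral_x2 :
  (\int[leb]_(x in D) (x ^+ 2 * thorin_density x)%:E = \int[nu]_z (kap z * w z ^- 2)%:E)%E.
Proof.
apply: (thorin_integral_eq (h := fun x => x ^+ 2) (H := fun c => c ^- 2)) => [|x x0|c c0].
- by mfun.
- by rewrite exprn_ge0// ltW.
rewrite -integral_x_expRNM//; apply: eq_integral => x /set_mem; rewrite /= in_itv/= andbT => x0.
by rewrite expr2 -mulrA (mulrA x x^-1) divff ?mul1r// gt_eqF.
Qed.

Lemma thorin_integral_x3 :
  (\int[leb]_(x in D) (x ^+ 3 * thorin_density x)%:E = \int[nu]_z (kap z * (2 * w z ^- 3))%:E)%E.
Proof.
apply: (thorin_integral_eq (h := fun x => x ^+ 3) (H := fun c => 2 * c ^- 3)) => [|x x0|c c0].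
- by mfun.
- by rewrite exprn_ge0// ltW.
rewrite -integral_x2_expRNM//; apply: eq_integral => x /set_mem; rewrite /= in_itv/= andbT => x0.
by rewrite exprSr -mulrA (mulrA x x^-1) divff ?mul1r// gt_eqF.
Qed.

Lemma ex_thorin_measure : exists U : {measure set R -> \bar R},
  U `]-oo, 0%R]%classic = 0%E /\ forall m : R, 0 < m ->
  (\int[U]_(s in D) (ln (1 + m / s))%:E =
   \int[leb]_(x in D) ((1 - expR (- (m * x))) * thorin_density x)%:E)%E.
Proof.
exists (pushforward (density_measure nu mk k0) w); split.
  rewrite [LHS]/(\int[nu]_(z in w @^-1` `]-oo, 0%R]) (kap z)%:E)%E.
  rewrite -[RHS](integral0 nu (w @^-1` `]-oo, 0%R])).
  apply: eq_integral => z /set_mem; rewrite /= in_itv/= => wz.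
  by apply/eqP; rewrite eqe; apply/negP => /negP/kw; rewrite ltNge wz.
move=> m m0; rewrite [RHS](thorin_integral_expR m0).
have mD : measurable D by [].
have wmD : measurable (w @^-1` D) by rewrite -[X in measurable X]setTI; exact: mw.
have mL : measurable_fun [set: R] (fun s : R => ln (1 + m * s `^ (- 1))).
  by apply: (measurableT_comp (@measurable_ln R)); mfun.
have mF : measurable_fun D (fun s : R => (ln (1 + m / s))%:E).
  apply: (@eq_measurable_fun _ _ _ _ _ (fun s : R => (ln (1 + m * s `^ (- 1)))%:E)).
    by move=> s /set_mem; rewrite /= in_itv/= andbT => s0; rewrite powR_inv1// ltW.
  by apply/measurable_EFinP; exact: measurable_funTS.
have F0 (s : R) : s \in D -> (0 <= (ln (1 + m / s))%:E)%E.
  move=> /set_mem; rewrite /= in_itv/= andbT => s0.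
  by rewrite lee_fin ln_ge0// lerDl divr_ge0 ?ltW.
rewrite (ge0_integral_pushforward mw (density_measure nu mk k0) mD mF F0).
rewrite integral_mkcond ge0_integral_density.
- apply: eq_integral => z _; rewrite patchE.
  have [->|/kw w0] := eqVneq (kap z) 0; first by rewrite mule0 mul0r.
  have wz : z \in w @^-1` D by apply/mem_set; rewrite /= in_itv/= w0.
  by rewrite wz /= -EFinM mulrC.
- apply/(measurable_restrictT _ wmD).1.
  by apply: (measurable_comp mD _ mF) => [_ [z Dz <-]//|]; exact: measurable_funTS.
- by move=> z; apply: erestrict_ge0 => u wu; apply: F0; rewrite inE.
Unshelve. all: exact: mw. Qed.

End thorin.

(** * The CGMY time change *)

Section gamma_ratio.
Context {R : realType}.
Local Notation D := (`]0%R, +oo[%classic : set R).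
Local Notation mu := (@lebesgue_measure R).

Lemma measurable_gamma_pdf (a : R) : measurable_fun [set: R] (gamma_pdf a).
Proof. by rewrite /gamma_pdf; apply: measurable_funM => //; mfun. Qed.

Lemma ex_gamma_law (a : R) : 0 < a -> a <= 2 -> exists p : probability R R,
  forall f : R -> R, measurable_fun [set: R] f -> (forall x, 0 <= f x) ->
  (\int[p]_x (f x)%:E = \int[mu]_(x in D) (f x * gamma_pdf a x)%:E)%E.
Proof.
move=> a0 a2; have [G0 GE] := integral_GammafE a0 a2.
pose g (u : R) := gamma_pdf a u * \1_D u.
have mD : measurable D by [].
have mpdf := measurable_gamma_pdf a.
have pdf0 u : 0 <= gamma_pdf a u by rewrite !mulr_ge0 ?powR_ge0 ?expR_ge0 ?invr_ge0 ?ltW.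
have mg : measurable_fun [set: R] g.
  by apply: measurable_funM => //; exact: measurable_indic.
have g0 u : 0 <= g u by rewrite mulr_ge0// indicE.
have gE (f : R -> R) : measurable_fun [set: R] f ->
    (\int[leb]_x ((f x)%:E * (g x)%:E) = \int[mu]_(x in D) (f x * gamma_pdf a x)%:E)%E.
  move=> mf; rewrite -leb_mu//; last by apply: measurable_funTS; exact: measurable_funM.
  rewrite [RHS]integral_mkcond; apply: eq_integral => x _; rewrite patchE /g indicE.
  by rewrite -EFinM mulrA; case: ifPn; rewrite ?mulr1 ?mulr0.
have g1 : (\int[leb]_x (g x)%:E = 1)%E.
  have := gE (cst 1) (measurable_cst _); under eq_integral do rewrite mul1e; move=> ->.
  rewrite -leb_mu//; last by apply: measurable_funTS; exact: measurable_funM.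
  transitivity (\int[leb]_(x in D) ((Gammaf a)^-1%:E * (x `^ (a - 1) * expR (- x))%:E))%E.
    by apply: eq_integral => x _; rewrite mul1r -EFinM mulrC.
  rewrite ge0_integralZl//.
  - by rewrite GE -EFinM mulVf// gt_eqF.
  - by apply: measurable_funTS; mfun.
  - by move=> x _; rewrite lee_fin mulr_ge0 ?powR_ge0 ?expR_ge0.
  - by rewrite lee_fin invr_ge0 ltW.
have [p pE] := ex_density_probability mg g0 g1.
exists p => f mf f0; rewrite -gE// pE//; first exact/measurable_EFinP.
Qed.

Definition absratio (z : R * R) : R := `|z.1| * `|z.2| `^ (- 1).

Lemma measurable_absratio : measurable_fun [set: R * R] absratio.
Proof. by rewrite /absratio; mfun. Qed.

HB.instance Definition _ := isMeasurableFun.Build _ _ _ _ absratio measurable_absratio.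

Lemma absratioE (u v : R) : 0 < u -> 0 < v -> absratio (u, v) = u / v.
Proof. by move=> u0 v0; rewrite /absratio/= !gtr0_norm// powR_inv1// ltW. Qed.

Lemma ex_gamma_ratio_law (a b : R) : 0 < a -> a <= 2 -> 0 < b -> b <= 2 ->
  exists p : probability R R, forall (f : R -> R) (B : R),
  measurable_fun [set: R] (fun x => f `|x|) -> (forall x, 0 <= x -> 0 <= f x <= B) ->
  (\int[p]_x (f `|x|%R)%:E = (E_gamma_ratio a b f)%:E)%E.
Proof.
move=> a0 a2 b0 b2; have [p pE] := ex_gamma_law a0 a2; have [q qE] := ex_gamma_law b0 b2.
exists (distribution (p \x q)%E absratio) => f B mf fB.
have nfB (x : R) : 0 <= f `|x| <= B by exact: fB.
have nf0 (x : R) : (0 <= (f `|x|%R)%:E)%E by rewrite lee_fin; have /andP[] := nfB x.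
have mfr : measurable_fun [set: R * R] (fun z : R * R => (f `|absratio z|%R)%:E).
  by apply/measurable_EFinP; apply: (measurableT_comp mf measurable_absratio).
rewrite ge0_integral_distribution//; last exact/measurable_EFinP.
transitivity (\int[p]_u \int[q]_v (f `|absratio (u, v)|%R)%:E)%E.
  exact: (fubini_tonelli1 (m1 := p) (m2 := q) _ mfr (fun z => nf0 _)).
pose H u := fine (\int[q]_v (f `|absratio (u, v)|%R)%:E)%E.
have mfu u : measurable_fun [set: R] (fun v => f `|absratio (u, v)|).
  have /measurable_EFinP m1 := mfr.
  by apply: (measurableT_comp m1); exact: measurable_pair1.
have qfin u : (\int[q]_v (f `|absratio (u, v)|%R)%:E)%E \is a fin_num.
  apply: (@probability_integral_fin _ _ _ _ _ B) => //; first exact/measurable_EFinP.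
  by move=> v; rewrite lee_fin; have /andP[] := nfB (absratio (u, v)).
have H0 u : 0 <= H u by rewrite fine_ge0// integral_ge0.
have mH : measurable_fun [set: R] H.
  apply: (measurableT_comp (f := @fine R)) => //.
  exact: (measurable_fun_fubini_tonelli_F (m2 := q) _ mfr (fun z => nf0 _)).
transitivity (\int[p]_u (H u)%:E)%E; first by apply: eq_integral => u _; rewrite fineK.
have pH : (\int[p]_u (H u)%:E)%E \is a fin_num.
  apply: (@probability_integral_fin _ _ _ _ _ B) => //; first exact/measurable_EFinP.
  move=> u; rewrite fineK//; apply: probability_integral_le => //; first exact/measurable_EFinP.
  by move=> v; rewrite lee_fin; have /andP[] := nfB (absratio (u, v)).
rewrite -(fineK pH) pE// /E_gamma_ratio; congr (_%:E).
rewrite -/(Rintegral _ _ _); apply: eq_Rintegral => u /set_mem; rewrite /= in_itv/= andbT => u0.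
congr (_ * _); rewrite /H qE//; last by move=> v; have /andP[] := nfB (absratio (u, v)).
rewrite -/(Rintegral _ _ _); apply: eq_Rintegral => v /set_mem; rewrite /= in_itv/= andbT => v0.
by rewrite absratioE// gtr0_norm// divr_gt0.
Qed.

End gamma_ratio.

(* [leb \x rho] has no canonical sigma-finite structure: the instance of the
   library for products of sub-probabilities hides the general one. *)
Definition lebprod {R : realType} (rho : probability R R) : set (R * R)%type -> \bar R :=
  (leb \x rho)%E.

Section lebprod_measure.
Context {R : realType} (rho : probability R R).

HB.instance Definition _ := Measure.copy (lebprod rho) (leb \x rho)%E.

Let lebprod_sigma_finite : sigma_finite [set: R * R] (lebprod rho).
Proof.
have [F TF Foo] := @sigma_finiteT _ _ _ (leb : {sigma_finite_measure set R -> \bar R}).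
exists (fun n => F n `*` [set: R]).
  apply/esym; rewrite -subTset => -[x y] _; have [n _ Fx] : (\bigcup_i F i) x by rewrite -TF.
  by exists n => //; split.
move=> k; have [mF Fk] := Foo k; split; first exact: measurableX.
rewrite /lebprod product_measure1E// [X in (_ * X)%E](@probability_setT _ _ _ rho).
by rewrite mule1.
Qed.

HB.instance Definition _ := Measure_isSigmaFinite.Build _ _ _ (lebprod rho)
  lebprod_sigma_finite.

End lebprod_measure.

Section cgmy_density.
Context {R : realType}.
Local Notation D := (`]0%R, +oo[%classic : set R).
Variables (c a : R) (rho : probability R R) (s : R -> R).
Hypotheses (c0 : 0 < c) (a0 : 0 < a) (a1 : a < 1).
Hypotheses (ms : measurable_fun [set: R] s) (s0 : forall r, 0 <= s r).

Definition cgmy_weight (A : set R) (p : R * R) : R := c * p.1 `^ (a - 1) * \1_A p.1.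

Definition cgmy_rate (p : R * R) : R := p.1 + s p.2.

Definition cgmy_density (A : set R) : R -> R :=
  thorin_density (lebprod rho) (cgmy_weight A) cgmy_rate.

Lemma cgmy_weight_ge0 A p : 0 <= cgmy_weight A p.
Proof. by rewrite !mulr_ge0 ?powR_ge0 ?(ltW c0)// indicE. Qed.

Lemma measurable_cgmy_rate : measurable_fun [set: R * R] cgmy_rate.
Proof. by rewrite /cgmy_rate; mfun. Qed.

Section on_set.
Variable A : set R.
Hypotheses (mA : measurable A) (AD : A `<=` D).

Lemma measurable_cgmy_weight : measurable_fun [set: R * R] (cgmy_weight A).
Proof.
rewrite /cgmy_weight; apply: measurable_funM; first by mfun.
have m1 : measurable_fun [set: R] (\1_A : R -> R) by exact: measurable_indic.
by mfun.
Qed.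

Lemma cgmy_weight_rate p : cgmy_weight A p != 0 -> 0 < cgmy_rate p.
Proof.
rewrite /cgmy_weight indicE; case: (boolP (p.1 \in A)) => [/set_mem/AD|_]; last by rewrite mulr0 eqxx.
by rewrite /= in_itv/= andbT => p0 _; rewrite ltr_wpDr.
Qed.

Section fubini.
Variable F : R * R -> R.
Hypotheses (mF : measurable_fun [set: R * R] F) (F0 : forall p, 0 < p.1 -> 0 <= F p).

Let mH : measurable_fun [set: R * R] (fun p => (cgmy_weight A p * F p)%:E).
Proof. by apply/measurable_EFinP; apply: measurable_funM => //; exact: measurable_cgmy_weight. Qed.

Let H0 p : (0 <= (cgmy_weight A p * F p)%:E)%E.
Proof.
rewrite lee_fin /cgmy_weight indicE; case: (boolP (p.1 \in A)) => [/set_mem/AD|_]; last by rewrite mulr0 mul0r.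
by rewrite /= in_itv/= andbT => p0; rewrite !mulr_ge0 ?powR_ge0 ?F0 ?(ltW c0).
Qed.

Let sectionE r : (\int[leb]_z (cgmy_weight A (z, r) * F (z, r))%:E =
  \int[leb]_(z in A) (c * z `^ (a - 1) * F (z, r))%:E)%E.
Proof.
rewrite [RHS]integral_mkcond.
apply: eq_integral => z _; rewrite patchE /cgmy_weight/= indicE.
by case: (z \in A); rewrite ?mulr1 ?mulr0 ?mul0r.
Qed.

Lemma measurable_integral_cgmy :
  measurable_fun [set: R] (fun r => \int[leb]_(z in A) (c * z `^ (a - 1) * F (z, r))%:E)%E.
Proof.
under eq_fun do rewrite -sectionE.
exact: (measurable_fun_fubini_tonelli_G (m1 := leb) _ mH H0).
Qed.

Lemma ge0_integral_cgmy :
  (\int[lebprod rho]_p (cgmy_weight A p * F p)%:E =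
   \int[rho]_r \int[leb]_(z in A) (c * z `^ (a - 1) * F (z, r))%:E)%E.
Proof.
rewrite [LHS](fubini_tonelli2 (m1 := leb) (m2 := rho) _ mH H0).
by apply: eq_integral => r _; rewrite /fubini_G sectionE.
Qed.

End fubini.

End on_set.

Let mDD : measurable D. Proof. by []. Qed.

Lemma cgmy_weight_le A p : cgmy_weight (A `&` D) p <= cgmy_weight D p.
Proof.
rewrite /cgmy_weight ler_wpM2l ?mulr_ge0 ?powR_ge0 ?(ltW c0)// !indicE ler_nat in_setI.
by case: (_ \in A); case: (_ \in D).
Qed.

Lemma integral_cgmy_expR (x : R) : 0 < x ->
  (\int[lebprod rho]_p (cgmy_weight D p * expR (- (cgmy_rate p * x)))%:E =
   (c * Gammaf a * x `^ (- a))%:E * \int[rho]_r (expR (- (s r * x)))%:E)%E.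
Proof.
move=> x0.
have a2 : a <= 2 by apply: ltW; apply: (lt_trans a1); rewrite ltr1n.
rewrite (ge0_integral_cgmy mDD (@subset_refl _ D)); last 2 first.
- by have := measurable_cgmy_rate => mw; mfun.
- by move=> p _; exact: expR_ge0.
have [G0 _] := integral_GammafE a0 a2.
have cG : 0 <= c * Gammaf a * x `^ (- a) by rewrite !mulr_ge0 ?powR_ge0 ?ltW.
rewrite -ge0_integralZl//; last by mfun.
apply: eq_integral => r _.
transitivity (\int[leb]_(z in D) ((c * expR (- (s r * x)))%:E * (z `^ (a - 1) * expR (- (z * x)))%:E))%E.
  apply: eq_integral => z _; rewrite -EFinM; congr (_%:E).
  have -> : - (cgmy_rate (z, r) * x) = - (s r * x) + - (z * x) by rewrite /cgmy_rate/=; ring.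
  by rewrite expRD; ring.
rewrite ge0_integralZl//.
- by rewrite Gammaf_scaling// -!EFinM; congr (_%:E); ring.
- by apply: measurable_funTS; mfun.
- by move=> z _; rewrite lee_fin mulr_ge0 ?powR_ge0 ?expR_ge0.
- by rewrite lee_fin mulr_ge0 ?expR_ge0 ?ltW.
Qed.

Let gamma_ge0 : 0 <= Gammaf a.
Proof.
have a2 : a <= 2 by apply: ltW; apply: (lt_trans a1); rewrite ltr1n.
by have [/ltW] := integral_GammafE a0 a2.
Qed.

Let int_expR_le1 x : 0 <= x -> (\int[rho]_r (expR (- (s r * x)))%:E <= 1)%E.
Proof.
move=> x0; apply: probability_integral_le => [||r].
- by mfun.
- by move=> r; rewrite lee_fin expR_ge0.
- by rewrite lee_fin -expR0 ler_expR oppr_le0 mulr_ge0.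
Qed.

Lemma integral_cgmy_expR_le (A : set R) (x : R) : measurable A -> A `<=` D -> 0 < x ->
  (\int[lebprod rho]_p (cgmy_weight A p * expR (- (cgmy_rate p * x)))%:E <=
   (c * Gammaf a * x `^ (- a))%:E)%E.
Proof.
move=> mA AD x0; have mw := measurable_cgmy_rate.
have mk B : measurable B -> measurable_fun [set: R * R] (cgmy_weight B) by exact: measurable_cgmy_weight.
apply: (@le_trans _ _ (\int[lebprod rho]_p (cgmy_weight D p * expR (- (cgmy_rate p * x)))%:E)%E).
  apply: ge0_le_integral => //.
  - by move=> p _; rewrite lee_fin mulr_ge0 ?expR_ge0 ?cgmy_weight_ge0.
  - by have mkA := mk _ mA; mfun.
  - by have mkD := mk _ mDD; mfun.
  - move=> p _; rewrite lee_fin ler_wpM2r ?expR_ge0//.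
    by rewrite -[in leLHS](setIidl AD) cgmy_weight_le.
rewrite integral_cgmy_expR// -[leRHS]mule1.
apply: lee_wpmul2l; first by rewrite lee_fin !mulr_ge0 ?powR_ge0// ltW.
exact/int_expR_le1/ltW.
Qed.

End cgmy_density.

Section cgmy_moments.
Context {R : realType}.
Local Notation D := (`]0%R, +oo[%classic : set R).
Variables (c a : R) (rho : probability R R) (s : R -> R).
Hypotheses (c0 : 0 < c) (a0 : 0 < a) (a1 : a < 1).
Hypotheses (ms : measurable_fun [set: R] s) (s0 : forall r, 0 <= s r).
Local Notation g := (cgmy_density c a rho s).
Local Notation kap := (cgmy_weight c a).
Local Notation w := (cgmy_rate s).

Let mw : measurable_fun [set: R * R] w := measurable_cgmy_rate ms.
Let k0 A p : 0 <= kap A p := cgmy_weight_ge0 a c0 A p.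

Section on_set.
Variable A : set R.
Hypotheses (mA : measurable A) (AD : A `<=` D).

Let mk : measurable_fun [set: R * R] (kap A) := measurable_cgmy_weight c a mA.

Lemma cgmy_kfin (x : R) : 0 < x ->
  (\int[lebprod rho]_p (kap A p * expR (- (w p * x)))%:E < +oo)%E.
Proof.
by move=> x0; apply: le_lt_trans (integral_cgmy_expR_le rho c0 a0 a1 ms s0 mA AD x0) (ltry _).
Qed.

Lemma measurable_cgmy_density : measurable_fun [set: R] (g A).
Proof. exact: measurable_thorin_density. Qed.

Lemma cgmy_density_ge0 x : 0 <= g A x.
Proof. exact: thorin_density_ge0. Qed.

Lemma cgmy_density_le (x : R) : 0 < x -> g A x <= c * Gammaf a * x `^ (- a - 1).
Proof.
move=> x0; rewrite powRD; last by rewrite (gt_eqF x0) implybT.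
rewrite mulrA ler_wpM2r ?powR_ge0// -lee_fin fineK ?integral_cgmy_expR_le//.
rewrite ge0_fin_numE ?cgmy_kfin// integral_ge0// => p _.
by rewrite lee_fin mulr_ge0 ?expR_ge0.
Qed.

Lemma cgmy_density_fin :
  (\int[leb]_(x in D) ((1 - expR (- x)) * g A x)%:E < +oo)%E.
Proof.
pose f (x : R) := (1 - expR (- x)) * g A x.
have mg := measurable_cgmy_density.
have mf : measurable_fun [set: R] f by rewrite /f; mfun.
have e1 (x : R) : 0 < x -> 0 <= 1 - expR (- x).
  by move=> x0; rewrite subr_ge0 -expR0 ler_expR oppr_le0 ltW.
have f0 (x : R) : 0 < x -> 0 <= f x by move=> x0; rewrite mulr_ge0 ?e1 ?cgmy_density_ge0.
set K := c * Gammaf a.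
have K0 : 0 <= K.
  have a2 : a <= 2 by apply: ltW; apply: (lt_trans a1); rewrite ltr1n.
  by have [/ltW G0 _] := integral_GammafE a0 a2; rewrite mulr_ge0// ltW.
rewrite (ge0_integral_half_line1 mf f0).
apply: lte_add_pinfty.
  apply: (@le_lt_trans _ _ (\int[leb]_(x in `]0%R, 1%R]) (K%:E * (x `^ ((1 - a) - 1))%:E))%E).
    apply: ge0_le_integral => //.
    - by move=> x /=; rewrite in_itv/= => /andP[x0 _]; rewrite lee_fin f0.
    - by apply/measurable_EFinP; exact: measurable_funTS.
    - by apply: measurable_funTS; mfun.
    - move=> x /=; rewrite in_itv/= => /andP[x0 _]; rewrite -EFinM lee_fin.
      apply: (@le_trans _ _ (x * (K * x `^ (- a - 1)))).
        apply: ler_pM; rewrite ?e1 ?cgmy_density_ge0 ?cgmy_density_le//.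
        by have := expR_ge1Dx (- x); lra.
      rewrite mulrCA ler_wpM2l// -{1}(powRr1 (ltW x0)) -powRD; last by rewrite (gt_eqF x0) implybT.
      by rewrite le_eqVlt; apply/orP; left; apply/eqP; congr (_ `^ _); ring.
  rewrite ge0_integralZl//.
  - by rewrite integral_powR_head ?subr_gt0// -EFinM ltry.
  - by apply: measurable_funTS; mfun.
  - by move=> x _; rewrite lee_fin powR_ge0.
apply: (@le_lt_trans _ _ (\int[leb]_(x in `]1%R, +oo[) (K%:E * (x `^ (- a - 1))%:E))%E).
  apply: ge0_le_integral => //.
  - by move=> x /=; rewrite in_itv/= andbT => /(lt_trans ltr01) x0; rewrite lee_fin f0.
  - by apply/measurable_EFinP; exact: measurable_funTS.
  - by apply: measurable_funTS; mfun.
  - move=> x /=; rewrite in_itv/= andbT => /(lt_trans ltr01) x0; rewrite -EFinM lee_fin.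
    rewrite -[leRHS]mul1r; apply: ler_pM; rewrite ?e1 ?cgmy_density_ge0 ?cgmy_density_le//.
rewrite ge0_integralZl//.
- by rewrite integral_powR_tail// -EFinM ltry.
- by apply: measurable_funTS; mfun.
- by move=> x _; rewrite lee_fin powR_ge0.
Qed.

End on_set.

Section tail.
Variable L : R.
Hypothesis L0 : 0 < L.
Local Notation A := (`]L, +oo[%classic : set R).

Let mA : measurable A. Proof. by []. Qed.

Let AD : A `<=` D.
Proof. by move=> x /=; rewrite !in_itv/= !andbT; exact: lt_trans. Qed.

Let mk : measurable_fun [set: R * R] (kap A) := measurable_cgmy_weight c a mA.

Lemma measurable_rateXV k : measurable_fun [set: R * R] (fun p => w p ^- k).
Proof.
apply: (measurableT_comp measurable_invr (g := fun p => w p ^+ k)).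
exact: measurable_funX.
Qed.

Let rate0 (p : R * R) : 0 < p.1 -> 0 < w p.
Proof. by move=> p0; rewrite ltr_wpDr. Qed.

Lemma cgmy_tail_moment k : (0 < k)%N ->
  (\int[lebprod rho]_p (kap A p * w p ^- k)%:E <= (c * (L `^ (- (k%:R - a)) / (k%:R - a)))%:E)%E.
Proof.
move=> kn0; have ka : 0 < k%:R - a.
  by rewrite subr_gt0; apply: (lt_le_trans a1); rewrite ler1n.
have wk0 (p : R * R) : 0 < p.1 -> 0 <= w p ^- k.
  by move=> p0; rewrite invr_ge0 exprn_ge0// ltW// rate0.
rewrite (ge0_integral_cgmy a rho c0 mA AD (measurable_rateXV k) wk0).
rewrite -(probability_integral_cst rho (c * (L `^ (- (k%:R - a)) / (k%:R - a)))%:E).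
apply: ge0_le_integral => //.
- move=> r _; apply: integral_ge0 => z /AD; rewrite /= in_itv/= andbT => z0.
  rewrite lee_fin !mulr_ge0 ?powR_ge0 ?(ltW c0)// invr_ge0 exprn_ge0// ltW//.
  by apply: rate0.
- exact: (measurable_integral_cgmy a c0 mA AD (measurable_rateXV k) wk0).
move=> r _; rewrite EFinM -integral_powR_tail// -ge0_integralZl//; last 3 first.
- by apply: measurable_funTS; mfun.
- by move=> z _; rewrite lee_fin powR_ge0.
- by rewrite lee_fin ltW.
apply: ge0_le_integral => //.
- move=> z /AD; rewrite /= in_itv/= andbT => z0.
  rewrite lee_fin !mulr_ge0 ?powR_ge0 ?(ltW c0)// invr_ge0 exprn_ge0// ltW//.
  by apply: rate0.
- apply: measurable_funTS; have mr := measurable_rateXV k.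
  by apply/measurable_EFinP; apply: measurable_funM; [mfun|apply: (measurableT_comp mr); mfun].
- by apply: measurable_funTS; mfun.
move=> z /AD; rewrite /= in_itv/= andbT => z0.
rewrite -EFinM lee_fin -mulrA ler_wpM2l ?(ltW c0)//.
have -> : z `^ (- (k%:R - a) - 1) = z `^ (a - 1) * z ^- k.
  rewrite -powR_mulrn ?ltW// -powRN -powRD; last by rewrite (gt_eqF z0) implybT.
  by congr (_ `^ _); ring.
rewrite ler_wpM2l ?powR_ge0// lef_pV2 ?posrE ?exprn_gt0 ?rate0//.
have zw : z <= w (z, r) by rewrite lerDl.
by apply: lerXn2r => //; rewrite nnegrE ltW// rate0.
Qed.

Lemma cgmy_tail_ratio : (\int[lebprod rho]_p (kap A p * (2 * w p ^- 3))%:E <=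
  (2 / L)%:E * \int[lebprod rho]_p (kap A p * w p ^- 2)%:E)%E.
Proof.
have kw2 p : 0 <= kap A p * w p ^- 2 by rewrite mulr_ge0// invr_ge0 sqr_ge0.
have mr3 := measurable_rateXV 3; have mr2 := measurable_rateXV 2.
rewrite -ge0_integralZl//; last 3 first.
- by apply/measurable_EFinP; apply: measurable_funM.
- by move=> p _; rewrite lee_fin.
- by rewrite lee_fin divr_ge0// ltW.
have kw p : kap A p * w p ^- 3 <= L^-1 * (kap A p * w p ^- 2).
  rewrite mulrCA; have [->|kn0] := eqVneq (kap A p) 0; first by rewrite !mul0r.
  rewrite ler_wpM2l//.
  have Lw : L < w p.
    move: kn0; rewrite /cgmy_weight indicE; case: (boolP (p.1 \in A)) => [/set_mem|_]; last by rewrite mulr0 eqxx.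
    by rewrite /= in_itv/= andbT => Lp _; rewrite (lt_le_trans Lp)// lerDl.
  have w0 : 0 < w p := lt_trans L0 Lw.
  rewrite exprSr invfM mulrC ler_wpM2r ?invr_ge0 ?sqr_ge0//.
  by rewrite lef_pV2 ?posrE// ltW.
apply: ge0_le_integral => //.
- move=> p _; rewrite lee_fin.
  have [->|kn0] := eqVneq (kap A p) 0; first by rewrite !mul0r.
  rewrite mulr_ge0// mulr_ge0// invr_ge0 exprn_ge0// ltW//.
  exact: (cgmy_weight_rate s0 AD kn0).
- by apply/measurable_EFinP; do 2 apply: measurable_funM => //.
- by apply: emeasurable_funM => //; apply/measurable_EFinP; apply: measurable_funM.
- by move=> p _; rewrite -EFinM lee_fin mulrCA -(mulrA 2) ler_pM2l.
Qed.

Lemma cgmy_tail_lower (L' : R) : 1 <= L' -> L <= L' ->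
  ((c * 2 `^ (a - 1) * L' `^ (a - 2))%:E * \int[rho]_r ((2 + s r) ^- 2)%:E <=
   \int[lebprod rho]_p (kap A p * w p ^- 2)%:E)%E.
Proof.
move=> L'1 LL'; have L'0 : 0 < L' := lt_le_trans ltr01 L'1.
have w20 (p : R * R) : 0 < p.1 -> 0 <= w p ^- 2.
  by move=> p0; rewrite invr_ge0 sqr_ge0.
rewrite (ge0_integral_cgmy a rho c0 mA AD (measurable_rateXV 2) w20).
have ms2 : measurable_fun [set: R] (fun r => (2 + s r) ^- 2).
  by apply: (measurableT_comp measurable_invr (g := fun r => (2 + s r) ^+ 2)); mfun.
rewrite -ge0_integralZl//; last 3 first.
- exact/measurable_EFinP.
- by move=> r _; rewrite lee_fin invr_ge0 sqr_ge0.
- by rewrite lee_fin !mulr_ge0 ?powR_ge0 ?ltW.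
have mz r : measurable_fun [set: R] (fun z : R => (c * z `^ (a - 1) * w (z, r) ^- 2)%:E).
  have mr := measurable_rateXV 2.
  by apply/measurable_EFinP; apply: measurable_funM; [mfun|apply: (measurableT_comp mr); mfun].
have z0 z r : (0 <= (c * z `^ (a - 1) * w (z, r) ^- 2)%:E)%E.
  by rewrite lee_fin !mulr_ge0 ?powR_ge0 ?(ltW c0)// invr_ge0 sqr_ge0.
apply: ge0_le_integral => //.
- by move=> r _; rewrite -EFinM lee_fin !mulr_ge0 ?powR_ge0 ?(ltW c0)// invr_ge0 sqr_ge0.
- by apply: emeasurable_funM => //; exact/measurable_EFinP.
- exact: (measurable_integral_cgmy a c0 mA AD (measurable_rateXV 2) w20).
move=> r _.
apply: (@le_trans _ _ (\int[leb]_(z in `]L', (2 * L')%R]) (c * z `^ (a - 1) * w (z, r) ^- 2)%:E)%E); last first.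
  apply: ge0_subset_integral => //; first exact: measurable_funTS.
  by move=> z /=; rewrite !in_itv/= andbT => /andP[+ _]; exact: le_lt_trans.
apply: (@le_trans _ _ (\int[leb]_(z in `]L', (2 * L')%R]) (c * (2 * L') `^ (a - 1) * (L' * (2 + s r)) ^- 2)%:E)%E).
  have lE : @leb R `]L', (2 * L')%R]%classic = L'%:E.
    rewrite [LHS]lebesgue_measure_itv/= lte_fin ifT; last by rewrite ltr_pMl// ltr1n.
    by rewrite -EFinB; congr (_%:E); ring.
  rewrite integral_cst// [X in (_ <= _ * X)%E]lE.
  rewrite -!EFinM lee_fin powRM ?(ltW L'0)// le_eqVlt; apply/orP; left; apply/eqP.
  have -> : L' `^ (a - 2) = L' `^ (a - 1) * L'^-1.
    rewrite -powR_inv1 ?ltW// -powRD; last by rewrite (gt_eqF L'0) implybT.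
    by congr (_ `^ _); ring.
  have : 2 + s r != 0 by rewrite gt_eqF// ltr_pwDl.
  have := gt_eqF L'0; move: (s r) (_ `^ _) (_ `^ _) => v e1 e2 /negbT h1 h2; field.
  by rewrite h1 h2.
apply: ge0_le_integral => //.
- by move=> z _; rewrite lee_fin !mulr_ge0 ?powR_ge0 ?(ltW c0)// invr_ge0 sqr_ge0.
- exact: measurable_funTS.
move=> z; rewrite /= in_itv/= => /andP[Lz zL].
have zp : 0 < z := lt_trans L'0 Lz.
rewrite lee_fin; apply: ler_pM.
- by rewrite mulr_ge0 ?powR_ge0// ltW.
- by rewrite invr_ge0 sqr_ge0.
- rewrite ler_wpM2l ?(ltW c0)//.
  have -> : a - 1 = - (1 - a) by ring.
  rewrite !powRN lef_pV2 ?posrE ?powR_gt0 ?mulr_gt0//.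
  by apply: ge0_ler_powR; rewrite ?nnegrE ?subr_ge0 ?(ltW a1) ?mulr_ge0 ?(ltW zp)// ltW.
- rewrite lef_pV2 ?posrE ?exprn_gt0 ?mulr_gt0 ?rate0 ?ltr_pwDl//.
  apply: lerXn2r; rewrite ?nnegrE ?mulr_ge0 ?addr_ge0 ?(ltW zp) ?(ltW L'0)//.
  rewrite /cgmy_rate/= mulrDr (mulrC L') lerD//.
  by rewrite ler_peMl.
Qed.

End tail.

End cgmy_moments.

Section gamma_ratio_density.
Context {R : realType}.
Local Notation D := (`]0%R, +oo[%classic : set R).
Local Notation mu := (@lebesgue_measure R).
Variables (C G M Y t : R).
Hypotheses (C0 : 0 < C) (G0 : 0 <= G) (M0 : 0 <= M) (Y0 : 0 < Y) (Y2 : Y < 2) (t0 : 0 < t).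
Local Notation a := (Y / 2).
Local Notation tth := ((G + M) / 2).
Local Notation Ct := (t * C * 2 `^ (Y / 2 - 1) / Gammaf Y).
Variable rho : probability R R.
Hypothesis rhoE : forall (f : R -> R) (B : R),
  measurable_fun [set: R] (fun x => f `|x|) -> (forall x, 0 <= x -> 0 <= f x <= B) ->
  (\int[rho]_x (f `|x|%R)%:E = (E_gamma_ratio a (1 / 2) f)%:E)%E.

Definition ratio_rate (r : R) : R := (G * M + tth ^+ 2 * `|r|) / 2.

Lemma ratio_rate_ge0 r : 0 <= ratio_rate r.
Proof. by rewrite /ratio_rate divr_ge0// addr_ge0// mulr_ge0// sqr_ge0. Qed.

Lemma measurable_ratio_rate : measurable_fun [set: R] ratio_rate.
Proof. by rewrite /ratio_rate; mfun. Qed.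

Lemma Ct_gt0 : 0 < Ct.
Proof.
have [GY _] := integral_GammafE Y0 (ltW Y2).
by rewrite !mulr_gt0 ?powR_gt0 ?invr_gt0.
Qed.

Let a0 : 0 < a. Proof. by rewrite divr_gt0. Qed.
Let a1 : a < 1. Proof. by rewrite ltr_pdivrMr// mul1r. Qed.
Let c0 := Ct_gt0.
Let Cz0 z : 0 <= Ct * z `^ (a - 1).
Proof. by apply: mulr_ge0; [exact: ltW|exact: powR_ge0]. Qed.
Let s0 := ratio_rate_ge0.
Let ms := measurable_ratio_rate.

Local Notation kap := (cgmy_weight Ct a).
Local Notation w := (cgmy_rate ratio_rate).
Local Notation g := (cgmy_density Ct a rho ratio_rate).

Lemma integral_ratio_rate (x : R) : 0 < x ->
  (\int[rho]_r (expR (- (ratio_rate r * x)))%:E = (expR (- (G * M * x / 2)) *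
   E_gamma_ratio a (1 / 2) (fun r => expR (- (tth ^+ 2 * x / 2 * r))))%:E)%E.
Proof.
move=> x0; rewrite EFinM -(@rhoE _ 1); last 2 first.
- by mfun.
- move=> r r0; rewrite expR_ge0/= -[leRHS]expR0 ler_expR oppr_le0.
  by rewrite mulr_ge0// mulr_ge0// mulr_ge0 ?sqr_ge0// ltW.
rewrite -ge0_integralZl//.
- apply: eq_integral => r _; rewrite -EFinM -expRD; congr (expR _)%:E.
  by rewrite /ratio_rate; field.
- by mfun.
Qed.

(* The integral of [z ^ (a - 1) * exp (- z x)] over all [z > 0] is
   [Gamma(a) * x ^ (- a)], the power factor of the density of the time change. *)
Lemma cgmy_density_split (L x : R) : 0 < L -> 0 < x ->
  g `]0%R, L]%classic x + g `]L, +oo[%classic x = t * nuT C G M Y x.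
Proof.
move=> L0 x0.
have sub1 : `]0%R, L]%classic `<=` D by move=> z /=; rewrite !in_itv/= andbT => /andP[].
have sub2 : (`]L, +oo[%classic : set R) `<=` D.
  by move=> z /=; rewrite !in_itv/= !andbT; exact: lt_trans.
have m1 : measurable (`]0%R, L]%classic : set R) by [].
have m2 : measurable (`]L, +oo[%classic : set R) by [].
pose I A := (\int[lebprod rho]_p (kap A p * expR (- (w p * x)))%:E)%E.
have Ifin A : measurable A -> A `<=` D -> I A \is a fin_num.
  move=> mA AD; rewrite ge0_fin_numE ?(cgmy_kfin rho c0 a0 a1 ms s0 mA AD x0)//.
  by apply: integral_ge0 => p _; rewrite lee_fin mulr_ge0 ?expR_ge0 ?(cgmy_weight_ge0 _ c0).
have ID : (I `]0%R, L]%classic + I `]L, +oo[%classic = I D)%E.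
  have mw := measurable_cgmy_rate ms.
  have mk1 := measurable_cgmy_weight Ct a m1; have mk2 := measurable_cgmy_weight Ct a m2.
  rewrite /I -ge0_integralD//.
  - apply: eq_integral => p _; rewrite -EFinD -mulrDl; congr ((_ * _)%:E).
    rewrite /cgmy_weight -mulrDr; congr (_ * _); rewrite !indicE !mem_setE/= !in_itv/= !andbT.
    case: (ltP L p.1) => h; last by rewrite /= andbT addr0.
    by rewrite andbF add0r (lt_trans L0 h).
  - by move=> p _; rewrite lee_fin mulr_ge0 ?expR_ge0 ?(cgmy_weight_ge0 _ c0).
  - by mfun.
  - by move=> p _; rewrite lee_fin mulr_ge0 ?expR_ge0 ?(cgmy_weight_ge0 _ c0).
  - by mfun.
rewrite /cgmy_density /thorin_density -mulrDl -/(I _) -/(I _) -fineD ?Ifin// ID.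
rewrite /I integral_cgmy_expR// integral_ratio_rate// -EFinM/=.
rewrite /nuT; set E := E_gamma_ratio _ _ _.
have -> : ((G + M) / 2) ^+ 2 - ((G - M) / 2) ^+ 2 = G * M by field.
have -> : x `^ (1 + a) = x * x `^ a.
  by rewrite powRD ?powRr1 ?(ltW x0)// (gt_eqF x0) implybT.
rewrite powRN (powR_inv1 (ltW x0)).
have [GY _] := integral_GammafE Y0 (ltW Y2).
have := powR_gt0 a x0; move: (expR _) (2 `^ _) (Gammaf a) (x `^ a) => e1 e2 e3 e4 e40.
by field; rewrite !gt_eqF.
Qed.

Section log_exponent.
Variables (L m : R).
Hypotheses (L0 : 0 < L) (m0 : 0 < m).
Local Notation A := (`]0%R, L]%classic : set R).

Let mA : measurable A. Proof. by []. Qed.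

Let AD : A `<=` D. Proof. by move=> z /=; rewrite !in_itv/= andbT => /andP[]. Qed.

Let J (s : R -> R) (r : R) : \bar R :=
  (\int[leb]_(z in A) (Ct * z `^ (a - 1) * ln (1 + m / cgmy_rate s (z, r)))%:E)%E.

Section rate.
Variable s : R -> R.
Hypotheses (ms' : measurable_fun [set: R] s) (s0' : forall r, 0 <= s r).

Let mF : measurable_fun [set: R * R] (fun p => ln (1 + m / cgmy_rate s p)).
Proof.
have mw := measurable_cgmy_rate ms'.
apply: (measurableT_comp (@measurable_ln R)); mfun.
Qed.

Let F0 (p : R * R) : 0 < p.1 -> 0 <= ln (1 + m / cgmy_rate s p).
Proof. by move=> p0; rewrite ln_ge0// lerDl divr_ge0 ?(ltW m0)// addr_ge0// ltW. Qed.

Let JE : (\int[lebprod rho]_p (kap A p * ln (1 + m / cgmy_rate s p))%:E = \int[rho]_r J s r)%E.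
Proof. exact: (ge0_integral_cgmy a rho c0 mA AD mF F0). Qed.

Let mJ : measurable_fun [set: R] (J s).
Proof. exact: (measurable_integral_cgmy a c0 mA AD mF F0). Qed.

Let levyE : (\int[leb]_(x in D) ((1 - expR (- (m * x))) * cgmy_density Ct a rho s A x)%:E =
  \int[rho]_r J s r)%E.
Proof.
rewrite -JE; apply: thorin_integral_expR => //.
- exact: measurable_cgmy_weight.
- by move=> p; exact: cgmy_weight_ge0.
- exact: measurable_cgmy_rate.
- by move=> p; exact: (cgmy_weight_rate s0' AD).
- by move=> x x0; exact: cgmy_kfin.
Qed.

Lemma log_exponent_aux : [/\ measurable_fun [set: R] (J s),
  forall r, (0 <= J s r)%E,
  (\int[leb]_(x in D) ((1 - expR (- (m * x))) * cgmy_density Ct a rho s A x)%:E =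
   \int[rho]_r J s r)%E & (\int[rho]_r J s r < +oo)%E].
Proof.
split=> //.
  move=> r; apply: integral_ge0 => z /AD; rewrite /= in_itv/= andbT => z0.
  by rewrite lee_fin mulr_ge0 ?Cz0 ?F0.
rewrite -levyE.
have mg := measurable_cgmy_density a rho c0 ms' mA.
have g0 x := cgmy_density_ge0 a rho s c0 A x.
have gf := cgmy_density_fin rho c0 a0 a1 ms' s0' mA AD.
have /integrableP[_] := integrable_levy_exponent mg g0 gf m0.
apply: le_lt_trans; apply: ge0_le_integral => //.
- move=> x /=; rewrite in_itv/= andbT => x0; rewrite lee_fin mulr_ge0 ?g0//.
  by rewrite subr_ge0 -[leRHS]expR0 ler_expR oppr_le0 mulr_ge0// ltW.
- by apply: measurable_funTS; mfun.
- by apply: measurable_funTS; apply: (measurableT_comp (f := @abse R)) => //; mfun.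
- by move=> x _; exact: lee_abs.
Qed.

End rate.

Let E r := Rintegral mu `[0%R, L]%classic (fun z =>
  ln (1 + m * (1 / ((G * M + tth ^+ 2 * r) / 2 + z))) * fZ Y L z).

Let K : R := a * L `^ (- a) / Ct.

Let K0 : 0 < K. Proof. by rewrite !mulr_gt0 ?powR_gt0 ?invr_gt0. Qed.

Let EJ r : J ratio_rate r \is a fin_num -> E `|r| = K * fine (J ratio_rate r).
Proof.
have mw := measurable_cgmy_rate ms.
move=> Jfin; rewrite -[X in X * _]/(fine K%:E) -fineM// /E /Rintegral; congr fine.
rewrite -integral_itv_obnd_cbnd; last first.
  apply/measurable_EFinP; apply: measurable_funTS; apply: measurable_funM; last by rewrite /fZ; mfun.
  by apply: (measurableT_comp (@measurable_ln R)); mfun.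
rewrite -leb_mu//; last first.
  apply: measurable_funTS; apply: measurable_funM; last by rewrite /fZ; mfun.
  by apply: (measurableT_comp (@measurable_ln R)); mfun.
rewrite /J -ge0_integralZl//.
- apply: eq_integral => z _; rewrite -EFinM; congr (_%:E).
  rewrite /fZ /K /cgmy_rate/= mul1r [z + _]addrC -/(ratio_rate r).
  have := c0; move: Ct => e1; move: (ln _) (_ `^ _) (_ `^ _) => e2 e3 e4 e10.
  by field; rewrite gt_eqF.
- apply: measurable_funTS; apply/measurable_EFinP; apply: measurable_funM; first by mfun.
  by apply: (measurableT_comp (@measurable_ln R)); rewrite /cgmy_rate; mfun.
- move=> z /AD; rewrite /= in_itv/= andbT => z0.
  rewrite lee_fin mulr_ge0 ?Cz0// ln_ge0// lerDl divr_ge0 ?(ltW m0)//.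
  by rewrite addr_ge0 ?s0// ltW.
- by rewrite lee_fin ltW.
Qed.

Lemma log_exponentE :
  (\int[leb]_(x in D) ((1 - expR (- (m * x))) * g A x)%:E =
   (2 * Ct * L `^ a / Y * E_log_R G M Y L m)%:E)%E.
Proof.
have [mJ J0 -> _] := log_exponent_aux ms s0.
have z0 (r : R) : 0 <= (cst 0 : R -> R) r by [].
have [mZ Z0 _ Zfin] := log_exponent_aux (measurable_cst (0 : R)) z0.
pose B : \bar R := J (cst 0) 0.
have Bfin : B \is a fin_num.
  by rewrite ge0_fin_numE ?Z0//; move: Zfin; rewrite (probability_integral_cst rho B).
have Jmeas (s : R -> R) r : measurable_fun [set: R] s -> measurable_fun A
    (fun z : R => (Ct * z `^ (a - 1) * ln (1 + m / cgmy_rate s (z, r)))%:E).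
  move=> ms'; apply: measurable_funTS; apply/measurable_EFinP.
  apply: measurable_funM; first by mfun.
  by apply: (measurableT_comp (@measurable_ln R)); rewrite /cgmy_rate; mfun.
have JB r : (J ratio_rate r <= B)%E.
  apply: ge0_le_integral => //.
  - move=> z /AD; rewrite /= in_itv/= andbT => z0'.
    rewrite lee_fin mulr_ge0 ?Cz0// ln_ge0// lerDl divr_ge0 ?(ltW m0)//.
    by rewrite addr_ge0 ?s0// ltW.
  - exact: Jmeas.
  - exact: Jmeas.
  - move=> z /AD; rewrite /= in_itv/= andbT => zp.
    have r0 : 0 <= ratio_rate r by exact: s0.
    rewrite lee_fin ler_wpM2l ?Cz0// /cgmy_rate/= addr0.
    have zr : 0 < z + ratio_rate r by rewrite ltr_wpDr.
    rewrite ler_ln ?posrE ?addr_gt0 ?divr_gt0// lerD2l ler_wpM2l ?(ltW m0)//.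
    by rewrite lef_pV2 ?posrE// lerDl.
have Jfin r : J ratio_rate r \is a fin_num.
  by rewrite ge0_fin_numE// (le_lt_trans (JB r))// -ge0_fin_numE// Z0.
have mE : measurable_fun [set: R] (fun r => E `|r|).
  under eq_fun do rewrite EJ//.
  apply: measurable_funM => //; apply: (measurableT_comp (f := @fine R)) => //.
have EB (r : R) : 0 <= r -> 0 <= E r <= K * fine B.
  move=> r0; rewrite -[r]ger0_norm// EJ// mulr_ge0 ?fine_ge0 ?(ltW K0)//=.
  by rewrite ler_pM2l// fine_le.
have := rhoE mE EB; rewrite -/(E_log_R G M Y L m) => EE.
have KE : 2 * Ct * L `^ a / Y = K^-1.
  rewrite /K powRN; have := powR_gt0 a L0; have := c0.
  move: Ct => e1; move: (_ `^ _) => e2 e10 e20; field.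
  by rewrite !gt_eqF.
rewrite KE EFinM -EE -ge0_integralZl//.
- apply: eq_integral => r _; rewrite EJ// -EFinM mulrA mulVf ?mul1r ?fineK//.
  by rewrite gt_eqF.
- exact/measurable_EFinP.
- by move=> r _; rewrite lee_fin EJ// mulr_ge0 ?fine_ge0 ?(ltW K0).
- by rewrite lee_fin invr_ge0 ltW.
Qed.

End log_exponent.

End gamma_ratio_density.

Section cgmy_tail_cumulants.
Context {R : realType}.
Local Notation D := (`]0%R, +oo[%classic : set R).
Variables (c a : R) (rho : probability R R) (s : R -> R).
Hypotheses (c0 : 0 < c) (a0 : 0 < a) (a1 : a < 1).
Hypotheses (ms : measurable_fun [set: R] s) (s0 : forall r, 0 <= s r).
Local Notation g L := (cgmy_density c a rho s (`]L, +oo[%classic : set R)).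
Local Notation kap := (cgmy_weight c a).
Local Notation w := (cgmy_rate s).

Lemma ex_integral_rate : exists2 k : R, 0 < k &
  (\int[rho]_r ((2 + s r) ^- 2)%:E = k%:E)%E.
Proof.
have f0 r : 0 < (2 + s r) ^- 2 by rewrite invr_gt0 exprn_gt0// ltr_pwDl.
have mf : measurable_fun [set: R] (fun r => (2 + s r) ^- 2).
  by apply: (measurableT_comp measurable_invr (g := fun r => (2 + s r) ^+ 2)); mfun.
have fin : (\int[rho]_r ((2 + s r) ^- 2)%:E)%E \is a fin_num.
  apply: (@probability_integral_fin _ _ _ _ _ 1).
  - exact/measurable_EFinP.
  - by move=> r; rewrite lee_fin ltW.
  - move=> r; rewrite lee_fin invf_le1 ?exprn_gt0 ?ltr_pwDl// exprn_ege1//.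
    by rewrite (@le_trans _ _ 2)// ?ler1n// lerDl.
have I0 : (0 <= \int[rho]_r ((2 + s r) ^- 2)%:E)%E.
  by apply: integral_ge0 => r _; rewrite lee_fin ltW.
exists (fine (\int[rho]_r ((2 + s r) ^- 2)%:E)%E); last by rewrite fineK.
rewrite -lte_fin fineK// lt_neqAle I0 andbT; apply/eqP => I1.
have /ae_eq_integral_abs : (measurable [set: R]) by [].
move=> /(_ _ rho (fun r => ((2 + s r) ^- 2)%:E)) [|+ _]; first exact/measurable_EFinP.
under eq_integral do rewrite gee0_abs ?lee_fin ?ltW//.
rewrite -I1 => /(_ erefl) [N [mN N0 sub]].
have NT : N = [set: R].
  rewrite -subTset => r _; apply: sub => /= /(_ I) [] /eqP.
  by rewrite gt_eqF.
rewrite NT in N0; have /eqP := etrans (esym N0) (@probability_setT _ _ _ rho).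
by rewrite eqe eq_sym oner_eq0.
Qed.

Lemma cgmy_tail_cumulants (L : R) : 0 < L -> exists m s2 s3 : R,
  [/\ (\int[leb]_(x in D) (x * g L x)%:E = m%:E)%E,
      (\int[leb]_(x in D) (x ^+ 2 * g L x)%:E = s2%:E)%E,
      (\int[leb]_(x in D) (x ^+ 3 * g L x)%:E = s3%:E)%E,
      0 <= m <= c * (L `^ (- (1 - a)) / (1 - a)) &
      [/\ s2 <= c * (L `^ (- (2 - a)) / (2 - a)),
      0 <= s3 <= 2 / L * s2 &
      forall (L' k : R), 1 <= L' -> L <= L' ->
        (\int[rho]_r ((2 + s r) ^- 2)%:E = k%:E)%E ->
        c * 2 `^ (a - 1) * L' `^ (a - 2) * k <= s2]].
Proof.
move=> L0; have mA : measurable (`]L, +oo[%classic : set R) by [].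
have AD : (`]L, +oo[%classic : set R) `<=` D.
  by move=> x /=; rewrite !in_itv/= !andbT; exact: lt_trans.
have mk := measurable_cgmy_weight c a mA; have mw := measurable_cgmy_rate ms.
have k0 p : 0 <= kap (`]L, +oo[%classic : set R) p by exact: cgmy_weight_ge0.
have kw p := @cgmy_weight_rate _ c a _ s0 _ AD p.
have kf x := @cgmy_kfin _ _ _ rho _ c0 a0 a1 ms s0 _ mA AD x.
have x1E : (\int[leb]_(x in D) (x * g L x)%:E = _)%E := thorin_integral_x mk k0 mw kw kf.
have x2E : (\int[leb]_(x in D) (x ^+ 2 * g L x)%:E = _)%E := thorin_integral_x2 mk k0 mw kw kf.
have x3E : (\int[leb]_(x in D) (x ^+ 3 * g L x)%:E = _)%E := thorin_integral_x3 mk k0 mw kw kf.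
have kH (H : R -> R) : (forall v, 0 < v -> 0 <= H v) ->
    (0 <= \int[lebprod rho]_p (kap (`]L, +oo[%classic : set R) p * H (w p))%:E)%E.
  move=> H0; apply: integral_ge0 => p _; rewrite lee_fin.
  have [->|kn0] := eqVneq (kap (`]L, +oo[%classic : set R) p) 0; first by rewrite mul0r.
  by rewrite mulr_ge0// H0//; exact: kw.
have fin (I : \bar R) (B : R) : (0 <= I)%E -> (I <= B%:E)%E -> I = (fine I)%:E.
  by move=> I0 IB; rewrite fineK// ge0_fin_numE// (le_lt_trans IB)// ltry.
have i1 := @kH (fun v => v^-1) (fun v v0 => ltac:(by rewrite invr_ge0 ltW)).
have i2 := @kH (fun v => v ^- 2) (fun v v0 => ltac:(by rewrite invr_ge0 sqr_ge0)).
have i3 := @kH (fun v => 2 * v ^- 3) (fun v v0 => ltac:(by rewrite mulr_ge0// invr_ge0 exprn_ge0// ltW)).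
have t1 := @cgmy_tail_moment _ _ _ rho _ c0 a1 ms s0 _ L0 1 isT.
have t2 := @cgmy_tail_moment _ _ _ rho _ c0 a1 ms s0 _ L0 2 isT.
have t3 := cgmy_tail_ratio a rho c0 ms s0 L0.
have lo := cgmy_tail_lower rho c0 a1 ms s0 L0.
move: t1; under eq_integral do rewrite expr1; move=> t1.
have E1 := fin _ _ i1 t1; have E2 := fin _ _ i2 t2.
have E3 : (\int[lebprod rho]_p (kap (`]L, +oo[%classic : set R) p * (2 * w p ^- 3))%:E =
    (fine (\int[lebprod rho]_p (kap (`]L, +oo[%classic : set R) p * (2 * w p ^- 3))%:E))%:E)%E.
  by move: t3; rewrite E2 => t3; exact: fin i3 t3.
exists (fine (\int[lebprod rho]_p (kap (`]L, +oo[%classic : set R) p * (w p)^-1)%:E)%E),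
  (fine (\int[lebprod rho]_p (kap (`]L, +oo[%classic : set R) p * w p ^- 2)%:E)%E),
  (fine (\int[lebprod rho]_p (kap (`]L, +oo[%classic : set R) p * (2 * w p ^- 3))%:E)%E).
split.
- exact: etrans x1E E1.
- exact: etrans x2E E2.
- exact: etrans x3E E3.
- by rewrite -!lee_fin -E1; apply/andP; split.
split.
- by rewrite -lee_fin -E2.
- by rewrite -!lee_fin EFinM -E2 -E3; apply/andP; split.
- by move=> L' k L'1 LL' kE; have := lo L' L'1 LL'; rewrite kE -lee_fin -E2 -EFinM.
Qed.

End cgmy_tail_cumulants.

Lemma lyapunov_ratio {R : realType} (a K : R) (s2 s3 : R -> R) : 0 < a -> 0 < K ->
  (forall L, 0 < L -> 0 <= s3 L <= 2 / L * s2 L) ->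
  (forall L, 1 <= L -> K * L `^ (a - 2) <= s2 L) ->
  s3 L / Num.sqrt (s2 L) ^+ 3 @[L --> +oo] --> (0 : R).
Proof.
move=> a0 K0 s3b s2b.
apply: (@squeeze_cvgr _ _ _ _ (fun=> 0) (fun L : R => 2 / Num.sqrt K * L `^ (- (a / 2)))).
- near=> L; have L1 : 1 <= L by near: L; apply: nbhs_pinfty_ge; exact: num_real.
  have L0 : 0 < L := lt_le_trans ltr01 L1.
  have /andP[s30 s3L] := s3b _ L0; have s2L := s2b _ L1.
  have s20 : 0 < s2 L by apply: lt_le_trans s2L; rewrite mulr_gt0 ?powR_gt0.
  rewrite divr_ge0 ?exprn_ge0 ?sqrtr_ge0//=.
  have q0 : 0 < Num.sqrt (s2 L) by rewrite sqrtr_gt0.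
  have k0 : 0 < Num.sqrt K by rewrite sqrtr_gt0.
  have lo : Num.sqrt K * L `^ (a / 2) <= L * Num.sqrt (s2 L).
    have -> : L * Num.sqrt (s2 L) = Num.sqrt (L ^+ 2 * s2 L).
      by rewrite sqrtrM ?sqr_ge0// sqrtr_sqr gtr0_norm.
    have -> : Num.sqrt K * L `^ (a / 2) = Num.sqrt (K * L `^ a).
      rewrite sqrtrM ?(ltW K0)//; congr (_ * _).
      by rewrite -powR12_sqrt ?powR_ge0// -powRrM.
    rewrite ler_sqrt; last by rewrite mulr_ge0 ?sqr_ge0 ?(ltW s20).
    have -> : L `^ a = L ^+ 2 * L `^ (a - 2).
      rewrite -powR_mulrn ?(ltW L0)// -powRD; last by rewrite (gt_eqF L0) implybT.
      by congr (_ `^ _); ring.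
    by rewrite mulrCA ler_pM2l ?exprn_gt0.
  apply: (@le_trans _ _ (2 / L * s2 L / Num.sqrt (s2 L) ^+ 3)).
    by rewrite ler_wpM2r// invr_ge0 exprn_ge0// ltW.
  have -> : 2 / L * s2 L / Num.sqrt (s2 L) ^+ 3 = 2 / (L * Num.sqrt (s2 L)).
    rewrite -{1}(sqr_sqrtr (ltW s20)); move: q0; move: (Num.sqrt (s2 L)) => q q0.
    by field; rewrite !gt_eqF.
  rewrite powRN -mulrA -invfM ler_wpM2l// lef_pV2 ?posrE ?mulr_gt0 ?powR_gt0//.
- exact: cvg_cst.
- rewrite -(mulr0 (2 / Num.sqrt K)); apply: cvgMr; apply: cvg_powRN.
  by rewrite divr_gt0.
Unshelve. all: by end_near. Qed.

Section expectation_sq.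
Context d (T : measurableType d) {R : realType} (P : probability T R) (X : T -> R).
Variables (m s2 : R).
Hypotheses (mX : measurable_fun [set: T] X)
  (mE : (\int[P]_x (X x)%:E = m%:E)%E) (s2E : (\int[P]_x (X x ^+ 2)%:E = s2%:E)%E).

Lemma variance_moments : variance P X = (s2 - m ^+ 2)%:E.
Proof.
have X2 : X \in Lfun P 2%:E.
  apply/andP; split; rewrite inE//= /finite_norm unlock/=.
  have -> : (\int[P]_x `|(X x)%:E| `^ 2 = s2%:E)%E.
    by rewrite -s2E; apply: eq_integral => x _; rewrite abse_EFin poweR_EFin powR_mulrn// real_normK ?num_real.
  by rewrite poweR_EFin ltry.
by rewrite varianceE// unlock mE s2E.
Qed.

End expectation_sq.

Section product_projections.
Context {R : realType} (U : probability R R).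
Let P : probability (R * R)%type R := (U \x U)%E.

Lemma integral_fst (f : R -> \bar R) : measurable_fun [set: R] f ->
  (forall x, 0 <= f x)%E -> (\int[P]_z f z.1 = \int[U]_x f x)%E.
Proof.
move=> mf f0; have mf1 : measurable_fun [set: R * R] (fun z => f z.1).
  by apply: measurableT_comp => //; exact: measurable_fst.
rewrite [LHS](fubini_tonelli1 (m1 := U) (m2 := U) _ mf1 (fun z => f0 _)).
by apply: eq_integral => x _; rewrite /fubini_F/= probability_integral_cst.
Qed.

Lemma integral_snd (f : R -> \bar R) : measurable_fun [set: R] f ->
  (forall x, 0 <= f x)%E -> (\int[P]_z f z.2 = \int[U]_x f x)%E.
Proof.
move=> mf f0; have mf1 : measurable_fun [set: R * R] (fun z => f z.2).
  by apply: measurableT_comp => //; exact: measurable_snd.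
rewrite [LHS](fubini_tonelli1 (m1 := U) (m2 := U) _ mf1 (fun z => f0 _)).
by rewrite /fubini_F/= probability_integral_cst.
Qed.

Lemma integral_fst_snd (f h : R -> R) (x y : R) : measurable_fun [set: R] f ->
  measurable_fun [set: R] h -> (forall u, 0 <= f u) -> (forall u, 0 <= h u) ->
  (\int[U]_u (f u)%:E = x%:E)%E -> (\int[U]_u (h u)%:E = y%:E)%E ->
  (\int[P]_z (f z.1 * h z.2)%:E = (x * y)%:E)%E.
Proof.
move=> mf mh f0 h0 xE yE.
have mfh : measurable_fun [set: R * R] (fun z => (f z.1 * h z.2)%:E) by mfun.
rewrite [LHS](fubini_tonelli1 (m1 := U) (m2 := U) _ mfh); last first.
  by move=> z; rewrite lee_fin mulr_ge0.
transitivity (\int[U]_u ((f u)%:E * y%:E))%E.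
  apply: eq_integral => u _; rewrite /fubini_F/= -yE -ge0_integralZl//.
  - exact/measurable_EFinP.
  - by move=> v _; rewrite lee_fin.
  - by rewrite lee_fin.
rewrite ge0_integralZr//.
- by rewrite xE.
- exact/measurable_EFinP.
- by move=> u _; rewrite lee_fin.
- by rewrite -yE; apply: integral_ge0 => u _; rewrite lee_fin.
Qed.

Lemma measure_snd (A : set R) : measurable A -> P (snd @^-1` A) = U A.
Proof.
move=> mA; have -> : (snd @^-1` A : set (R * R)) = [set: R] `*` A.
  by apply/seteqP; split => -[x y] //= [].
by rewrite [LHS]product_measure1E// [X in (X * _)%E](@probability_setT _ _ _ U) mul1e.
Qed.

Lemma indep2_fst_snd (X Y : R -> R) : measurable_fun [set: R] X -> measurable_fun [set: R] Y ->
  indep2 P (fun z => X z.1) (fun z => Y z.2).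
Proof.
move=> mX mY A B mA mB.
have mXA : measurable (X @^-1` A) by rewrite -[X in measurable X]setTI; exact: mX.
have mYB : measurable (Y @^-1` B) by rewrite -[X in measurable X]setTI; exact: mY.
have e1 : ((fun z : R * R => X z.1) @^-1` A) = (X @^-1` A) `*` [set: R].
  by apply/seteqP; split => -[x y] //= [].
have e2 : ((fun z : R * R => Y z.2) @^-1` B) = [set: R] `*` (Y @^-1` B).
  by apply/seteqP; split => -[x y] //= [].
have -> : ((fun z : R * R => X z.1) @^-1` A) `&` ((fun z : R * R => Y z.2) @^-1` B) =
    (X @^-1` A) `*` (Y @^-1` B) by [].
rewrite e1 e2 [LHS]product_measure1E// [X in (_ = X * _)%E]product_measure1E//.
rewrite [X in (_ = _ * X)%E]product_measure1E// [X in (_ = (_ * X) * _)%E](@probability_setT _ _ _ U).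
by rewrite [X in (_ = _ * (X * _))%E](@probability_setT _ _ _ U) mule1 mul1e.
Qed.

End product_projections.

Section laplace.
Context {R : realType} (U : probability R R).
Local Notation D := (`]0%R, +oo[%classic : set R).

Lemma ex_levy_quantile_on (g : R -> R) (b : bool) : (forall A, measurable A -> U A = leb (A `&` `]0, 1[)) ->
  (b -> [/\ measurable_fun [set: R] g, forall x, 0 <= g x &
    (\int[leb]_(x in D) ((1 - expR (- x)) * g x)%:E < +oo)%E]) ->
  exists Q : R -> R, [/\ measurable_fun [set: R] Q, forall u, 0 <= Q u &
   b -> (forall m, 0 < m ->
     (\int[U]_u (expR (- (m * Q u)))%:E = (expR (- levy_exponent g m))%:E)%E) /\
   ((\int[leb]_(x in D) (x * g x)%:E < +oo)%E -> size_biased U g Q)].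
Proof.
move=> UE; case: b => [[//|mg g0 gfin]|_]; last by exists (cst 0).
by have [Q [mQ Q0 QL QS]] := ex_levy_quantile UE mg g0 gfin; exists Q.
Qed.

Lemma levy_exponent_EFin (g : R -> R) (m : R) : measurable_fun [set: R] g ->
  (forall x, 0 <= g x) -> (\int[leb]_(x in D) ((1 - expR (- x)) * g x)%:E < +oo)%E -> 0 < m ->
  (\int[leb]_(x in D) ((1 - expR (- (m * x))) * g x)%:E = (levy_exponent g m)%:E)%E.
Proof.
move=> mg g0 gfin m0; rewrite fineK//; apply: integrable_fin_num => //.
exact: integrable_levy_exponent.
Qed.

End laplace.

Theorem theorem1 (R : realType) (C G M Y t : R) :
  0 < C -> 0 <= G -> 0 <= M -> 0 < Y -> Y < 2 -> 0 < t ->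
  let Ct := t * C * 2 `^ (Y / 2 - 1) / Gammaf Y in
  exists (d : measure_display) (Omega : measurableType d)
         (P : probability Omega R) (TL eL : R -> {RV P >-> R}),
    (forall L : R, 0 < L ->
       (* nonnegative, independent *)
       (forall w, 0 <= TL L w) /\ (forall w, 0 <= eL L w) /\
       indep2 P (TL L) (eL L) /\
       (* T(t) = T_L(t) + eps_L(t) in distribution: the sum has the law of the
          time-t marginal of the subordinator with Levy density nuT *)
       (forall m : R, 0 < m ->
          fine ('E_P[fun w => expR (- (m * (TL L w + eL L w)))])%E
          = subord_LT (nuT C G M Y) t m) /\
       (* (i) *)
       is_GGC P (TL L) /\
       (forall m : R, 0 < m ->
          - ln (fine ('E_P[fun w => expR (- (m * TL L w))])%E)
          = 2 * Ct * L `^ (Y / 2) / Y * E_log_R G M Y L m) /\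
       (* (ii), moment bound *)
       ('E_P[fun w => (eL L w ^+ 2)%R] <=
          (Ct ^+ 2 / ((1 - Y / 2) ^+ 2 * L `^ (2 - Y))
           + Ct / ((2 - Y / 2) * L `^ (2 - Y / 2)))%:E)%E) /\
    (* (ii), CLT for the standardized remainder as L -> oo *)
    (forall x : R,
       fine (P [set w | (eL L w - fine ('E_P[eL L])%E)
                          / Num.sqrt (fine ('V_P[eL L])%E) <= x])
         @[L --> +oo]
       --> fine (normal_prob 0 1 `]-oo, x]%classic)).
Proof.
move=> C0 G0 M0 Y0 Y2 t0 Ct.
have a0 : 0 < Y / 2 by rewrite divr_gt0.
have a1 : Y / 2 < 1 by rewrite ltr_pdivrMr// mul1r.
have Ct0 : 0 < Ct by exact: Ct_gt0.
have [|||| rho rhoE] := @ex_gamma_ratio_law R (Y / 2) (1 / 2).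
- by [].
- by apply: ltW; apply: (lt_trans a1); rewrite ltr1n.
- by rewrite divr_gt0.
- by lra.
have [U UE] := @ex_uniform01 R.
pose D := (`]0%R, +oo[%classic : set R).
pose s := ratio_rate G M.
have s0 : forall r, 0 <= s r := ratio_rate_ge0 G0 M0.
have ms : measurable_fun [set: R] s := measurable_ratio_rate G M.
pose A1 (L : R) := (`]0%R, L]%classic : set R).
pose A2 (L : R) := (`]L, +oo[%classic : set R).
have mA1 L : measurable (A1 L) by rewrite /A1.
have mA2 L : measurable (A2 L) by rewrite /A2.
have A1D L : A1 L `<=` D by move=> z; rewrite /A1 /D/= !in_itv/= andbT => /andP[].
have A2D L : 0 < L -> A2 L `<=` D.
  by move=> L0 z; rewrite /A2 /D/= !in_itv/= !andbT; exact: lt_trans.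
pose g A := cgmy_density Ct (Y / 2) rho s A.
have gP A : measurable A -> A `<=` D -> [/\ measurable_fun [set: R] (g A), forall x, 0 <= g A x &
    (\int[leb]_(x in D) ((1 - expR (- x)) * g A x)%:E < +oo)%E].
  move=> mA AD; split.
  - exact: measurable_cgmy_density.
  - exact: cgmy_density_ge0.
  - exact: cgmy_density_fin.
have [Q1 Q1P] := choice (fun L => @ex_levy_quantile_on R U (g (A1 L)) true UE (fun=> gP _ (mA1 L) (A1D L))).
have [Q2 Q2P] := choice (fun L => @ex_levy_quantile_on R U (g (A2 L)) (0 < L) UE (fun L0 => gP _ (mA2 L) (A2D L L0))).
have mQ1 L : measurable_fun [set: R] (Q1 L) by have [] := Q1P L.
have mQ2 L : measurable_fun [set: R] (Q2 L) by have [] := Q2P L.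
have Q10 L u : 0 <= Q1 L u by have [] := Q1P L.
have Q20 L u : 0 <= Q2 L u by have [] := Q2P L.
have Q1L L m : 0 < m -> (\int[U]_u (expR (- (m * Q1 L u)))%:E = (expR (- levy_exponent (g (A1 L)) m))%:E)%E.
  by have [_ _ /(_ isT)[h _]] := Q1P L; exact: h.
have Q2L L m : 0 < L -> 0 < m -> (\int[U]_u (expR (- (m * Q2 L u)))%:E = (expR (- levy_exponent (g (A2 L)) m))%:E)%E.
  by move=> L0; have [_ _ /(_ L0)[h _]] := Q2P L; exact: h.
have Q2S L : 0 < L -> (\int[leb]_(x in D) (x * g (A2 L) x)%:E < +oo)%E -> size_biased U (g (A2 L)) (Q2 L).
  by move=> L0; have [_ _ /(_ L0)[]] := Q2P L.
have mT L : measurable_fun [set: R * R] (fun z : R * R => Q1 L z.1).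
  by apply: (measurableT_comp (mQ1 L)); exact: measurable_fst.
have mE L : measurable_fun [set: R * R] (fun z : R * R => Q2 L z.2).
  by apply: (measurableT_comp (mQ2 L)); exact: measurable_snd.
pose P : probability (R * R)%type R := (U \x U)%E.
pose TL L : {RV P >-> R} := HB.pack (fun z : R * R => Q1 L z.1)
  (isMeasurableFun.Build _ _ _ _ _ (mT L)).
pose eL L : {RV P >-> R} := HB.pack (fun z : R * R => Q2 L z.2)
  (isMeasurableFun.Build _ _ _ _ _ (mE L)).
pose cumulants (L : R) (c : R * R * R) :=
  [/\ (\int[leb]_(x in D) (x * g (A2 L) x)%:E = c.1.1%:E)%E,
      (\int[leb]_(x in D) (x ^+ 2 * g (A2 L) x)%:E = c.1.2%:E)%E,
      (\int[leb]_(x in D) (x ^+ 3 * g (A2 L) x)%:E = c.2%:E)%E,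
      0 <= c.1.1 <= Ct * (L `^ (- (1 - Y / 2)) / (1 - Y / 2)) &
      [/\ c.1.2 <= Ct * (L `^ (- (2 - Y / 2)) / (2 - Y / 2)),
      0 <= c.2 <= 2 / L * c.1.2 &
      forall (L' k : R), 1 <= L' -> L <= L' ->
        (\int[rho]_r ((2 + s r) ^- 2)%:E = k%:E)%E ->
        Ct * 2 `^ (Y / 2 - 1) * L' `^ (Y / 2 - 2) * k <= c.1.2]].
have ex_cum L : exists c, 0 < L -> cumulants L c.
  have [L0|] := ltP 0 L; last by exists (0, 0, 0).
  have [m [s2 [s3 h]]] := cgmy_tail_cumulants rho Ct0 a0 a1 ms s0 L0.
  by exists (m, s2, s3).
have [cum cumP] := choice ex_cum.
have L1E L m : 0 < m ->
    (\int[leb]_(x in D) ((1 - expR (- (m * x))) * g (A1 L) x)%:E = (levy_exponent (g (A1 L)) m)%:E)%E.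
  by move=> m0; have [h1 h2 h3] := gP _ (mA1 L) (A1D L); exact: levy_exponent_EFin.
have L2E L m : 0 < L -> 0 < m ->
    (\int[leb]_(x in D) ((1 - expR (- (m * x))) * g (A2 L) x)%:E = (levy_exponent (g (A2 L)) m)%:E)%E.
  by move=> L0 m0; have [h1 h2 h3] := gP _ (mA2 L) (A2D L L0); exact: levy_exponent_EFin.
have ET L m : 0 < m -> - ln (fine ('E_P[fun w => expR (- (m * TL L w))])%E) = levy_exponent (g (A1 L)) m.
  move=> m0; rewrite -[RHS]opprK -[X in _ = - X]expRK; congr (- ln _).
  rewrite -[RHS]/(fine (expR (- levy_exponent (g (A1 L)) m))%:E) -Q1L//; congr fine; rewrite unlock.
  apply: (@integral_fst _ U (fun u => (expR (- (m * Q1 L u)))%:E)).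
    by have mQ := mQ1 L; mfun.
  by move=> u; rewrite lee_fin expR_ge0.
have mean L : 0 < L -> ('E_P[eL L] = (cum L).1.1%:E)%E.
  move=> L0; have [mg g0 gfin] := gP _ (mA2 L) (A2D L L0).
  have [m1 _ _ _ _] := cumP L L0.
  rewrite unlock; transitivity (\int[U]_u (Q2 L u)%:E)%E.
    apply: (@integral_snd _ U (fun u => (Q2 L u)%:E)); first exact/measurable_EFinP.
    by move=> u; rewrite lee_fin.
  by apply: (size_biased_mean _ m1); apply: Q2S => //; rewrite m1 ltry.
have sqr L : 0 < L -> (\int[P]_w (eL L w ^+ 2)%:E = ((cum L).1.1 ^+ 2 + (cum L).1.2)%:E)%E.
  move=> L0; have [mg g0 gfin] := gP _ (mA2 L) (A2D L L0).
  have [m1 s2 _ _ _] := cumP L L0.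
  transitivity (\int[U]_u (Q2 L u ^+ 2)%:E)%E.
    apply: (@integral_snd _ U (fun u => (Q2 L u ^+ 2)%:E)).
      by have mQ := mQ2 L; mfun.
    by move=> u; rewrite lee_fin sqr_ge0.
  by apply: (size_biased_second_moment mg g0 (mQ2 L) (Q20 L) _ m1 s2); apply: Q2S => //; rewrite m1 ltry.
have vari L : 0 < L -> ('V_P[eL L] = (cum L).1.2%:E)%E.
  move=> L0; have := mean L L0; rewrite unlock => mL.
  by rewrite (variance_moments (mE L) mL (sqr L L0)); congr (_%:E); ring.
exists _, _, P, TL, eL; split.
  move=> L L0; split; first by move=> w; exact: Q10.
  split; first by move=> w; exact: Q20.
  split; first exact: indep2_fst_snd.
  split.
    move=> m m0; rewrite /subord_LT.
    have -> : t * Rintegral (@lebesgue_measure R) `]0%R, +oo[%classic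
        (fun x => (1 - expR (- (m * x))) * nuT C G M Y x) =
        levy_exponent (g (A1 L)) m + levy_exponent (g (A2 L)) m.
      have [mg1 g10 _] := gP _ (mA1 L) (A1D L).
      have [mg2 g20 _] := gP _ (mA2 L) (A2D L L0).
      have e0 (x : R) : D x -> 0 <= 1 - expR (- (m * x)).
        rewrite /D/= in_itv/= andbT => x0.
        by rewrite subr_ge0 -[leRHS]expR0 ler_expR oppr_le0 mulr_ge0// ltW.
      have mf1 : measurable_fun D (fun x => ((1 - expR (- (m * x))) * g (A1 L) x)%:E).
        by apply: measurable_funTS; mfun.
      have mf2 : measurable_fun D (fun x => ((1 - expR (- (m * x))) * g (A2 L) x)%:E).
        by apply: measurable_funTS; mfun.
      have mD : measurable D by rewrite /D.
      have sumE : (\int[leb]_(x in D) ((1 - expR (- (m * x))) * (g (A1 L) x + g (A2 L) x))%:E =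
          (levy_exponent (g (A1 L)) m + levy_exponent (g (A2 L)) m)%:E)%E.
        rewrite EFinD; have := L1E L m m0; have := L2E L m L0 m0.
        move: (levy_exponent _ m) (levy_exponent _ m) => l2 l1 <- <-.
        transitivity (\int[leb]_(x in D) (((1 - expR (- (m * x))) * g (A1 L) x)%:E +
            ((1 - expR (- (m * x))) * g (A2 L) x)%:E))%E.
          by apply: eq_integral => x _; rewrite -EFinD mulrDr.
        apply: ge0_integralD => //.
        - by move=> x /e0 ?; rewrite lee_fin mulr_ge0.
        - by move=> x /e0 ?; rewrite lee_fin mulr_ge0.
      rewrite -[X in X * _]/(fine t%:E).
      have -> : Rintegral (@lebesgue_measure R) `]0%R, +oo[%classic
        (fun x => (1 - expR (- (m * x))) * nuT C G M Y x) =
        fine (\int[leb]_(x in D) (t^-1 * ((1 - expR (- (m * x))) * (g (A1 L) x + g (A2 L) x)))%:E).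
        rewrite leb_mu//; last by apply: measurable_funTS; mfun.
        apply: eq_Rintegral => x /set_mem; rewrite /= in_itv/= andbT => x0.
        rewrite (cgmy_density_split C0 G0 M0 Y0 Y2 t0 rhoE L0 x0).
        by move: (expR _) (nuT _ _ _ _ _) => e1 e2; field; rewrite gt_eqF.
      rewrite (@eq_integral _ _ _ leb D (fun x => t^-1%:E * ((1 - expR (- (m * x))) * (g (A1 L) x + g (A2 L) x))%:E)%E).
        rewrite ge0_integralZl//.
        - by rewrite sumE -EFinM/= mulrA divff ?mul1r// gt_eqF.
        - by apply: measurable_funTS; mfun.
        - by move=> x /e0 ?; rewrite lee_fin mulr_ge0// addr_ge0.
        - by rewrite lee_fin invr_ge0 ltW.
      by move=> x _; rewrite -EFinM.
    rewrite opprD expRD unlock.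
    have mQ := mQ1 L; have mQ' := mQ2 L.
    have := @integral_fst_snd _ U (fun u => expR (- (m * Q1 L u))) (fun u => expR (- (m * Q2 L u))) _ _
      ltac:(by mfun) ltac:(by mfun) (fun=> expR_ge0 _) (fun=> expR_ge0 _) (Q1L L m m0) (Q2L L m L0 m0).
    move=> h; rewrite -[RHS]/(fine (expR (- levy_exponent (g (A1 L)) m) * expR (- levy_exponent (g (A2 L)) m))%:E) -h.
    by congr fine; apply: eq_integral => z _; rewrite mulrDr opprD expRD.
  split.
    split; first by move=> w; exact: Q10.
    have [V [V0 VE]] := @ex_thorin_measure _ _ _ (lebprod rho) (cgmy_weight Ct (Y / 2) (A1 L)) (cgmy_rate s)
      (measurable_cgmy_weight _ _ (mA1 L)) (fun p => cgmy_weight_ge0 _ Ct0 _ p)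
      (measurable_cgmy_rate ms) (fun p => @cgmy_weight_rate _ _ _ _ s0 _ (A1D L) p)
      (fun x => @cgmy_kfin _ _ _ rho _ Ct0 a0 a1 ms s0 _ (mA1 L) (A1D L) x).
    exists 0, V; split => //; split => // m m0.
    by rewrite ET// mul0r add0e VE// -L1E.
  split.
    move=> m m0; rewrite ET//.
    have := L1E L m m0; rewrite (log_exponentE C0 G0 M0 Y0 Y2 t0 rhoE L0 m0) => -[<-].
    by [].
  rewrite unlock (sqr L L0) lee_fin.
  have [_ _ _ /andP[m0 mle] [s2le _ _]] := cumP L L0.
  have p0 := powR_gt0 (1 - Y / 2) L0; have q0 := powR_gt0 (2 - Y / 2) L0.
  apply: lerD.
    have -> : Ct ^+ 2 / ((1 - Y / 2) ^+ 2 * L `^ (2 - Y)) =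
        (Ct * (L `^ (- (1 - Y / 2)) / (1 - Y / 2))) ^+ 2.
      have -> : L `^ (2 - Y) = (L `^ (1 - Y / 2)) ^+ 2.
        by rewrite -powR_mulrn ?powR_ge0// -powRrM; congr (_ `^ _); field.
      rewrite powRN; move: (L `^ _) p0 => p p0.
      by field; rewrite !gt_eqF//; lra.
    by apply: lerXn2r => //; rewrite nnegrE// (le_trans m0).
  apply: le_trans s2le _; rewrite le_eqVlt; apply/orP; left; apply/eqP.
  rewrite powRN; move: (L `^ _) q0 => q q0.
  by field; rewrite !gt_eqF//; lra.
move=> x; have [k k0 kE] := ex_integral_rate rho ms s0.
have K0 : 0 < Ct * 2 `^ (Y / 2 - 1) * k by rewrite mulr_gt0// mulr_gt0// powR_gt0.
have lo L' L : 1 <= L' -> 0 < L -> L <= L' ->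
    Ct * 2 `^ (Y / 2 - 1) * k * L' `^ (Y / 2 - 2) <= (cum L).1.2.
  move=> L'1 L0 LL'; have [_ _ _ _ [_ _ h]] := cumP L L0.
  by rewrite mulrAC; exact: h.
have s20 L : 0 < L -> 0 < (cum L).1.2.
  move=> L0; apply: lt_le_trans (lo (Num.max 1 L) L _ L0 _).
  - by rewrite mulr_gt0// powR_gt0// lt_max ltr01.
  - by rewrite le_max lexx.
  - by rewrite le_max lexx orbT.
have clt := @lyapunov_clt _ _ R U (fun L => g (A2 L)) Q2 (fun L => (cum L).1.1)
  (fun L => (cum L).2) (fun L => Num.sqrt (cum L).1.2).
apply: cvg_trans (clt _ _ _ _ _ _ _ _ _ _ x).
- apply: near_eq_cvg; near=> L.
  have L0 : 0 < L by near: L; exact: nbhs_pinfty_gt.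
  rewrite mean// vari//=; congr fine.
  have mB : measurable [set u : R | (Q2 L u - (cum L).1.1) / Num.sqrt (cum L).1.2 <= x].
    have -> : [set u : R | (Q2 L u - (cum L).1.1) / Num.sqrt (cum L).1.2 <= x] =
        (fun u => (Q2 L u - (cum L).1.1) / Num.sqrt (cum L).1.2) @^-1` `]-oo, x].
      by apply/seteqP; split => u /=; rewrite in_itv.
    rewrite -[X in measurable X]setTI.
    have mQ : measurable_fun [set: R] (fun u => (Q2 L u - (cum L).1.1) / Num.sqrt (cum L).1.2).
      by have mQ := mQ2 L; mfun.
    exact: mQ.
  by rewrite -(measure_snd U mB).
- by move=> L L0; have [] := gP _ (mA2 L) (A2D L L0).
- by move=> L L0; have [] := gP _ (mA2 L) (A2D L L0).
- by move=> L _; exact: mQ2.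
- by move=> L _; exact: Q20.
- by move=> L L0; apply: Q2S => //; have [-> _ _ _ _] := cumP L L0; rewrite ltry.
- by move=> L L0; have [] := cumP L L0.
- by move=> L L0; have [_ -> _ _ _] := cumP L L0; rewrite sqr_sqrtr// ltW// s20.
- by move=> L L0; have [] := cumP L L0.
- by move=> L L0; rewrite sqrtr_gt0 s20.
- apply: (@lyapunov_ratio _ (Y / 2) _ (fun L => (cum L).1.2) (fun L => (cum L).2) a0 K0).
    by move=> L L0; have [_ _ _ _ [_ h _]] := cumP L L0.
  by move=> L L1; apply: lo => //; exact: lt_le_trans L1.
Unshelve. all: by end_near. Qed.
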